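(* Let $T>0$, $n\ge1$. Let $a_1=a_1(t,\eta)\in\mathcal G^{\rm sc}_{C^\infty([-T,T],S^1(\mathbb R^{2n}))}$ be real valued and independent of $x$, and let $a_0=a_0(t,x,\eta)\in\mathcal G^{\rm sc}_{C^\infty([-T,T],S^0(\mathbb R^{2n}))}$. Assume that $a_1$ and $a_0$ have representatives $(a_{1,\varepsilon})_\varepsilon$, $(a_{0,\varepsilon})_\varepsilon$ such that $(a_{1,\varepsilon})_\varepsilon$ is of slow scale log-type up to order $(k_n,l_n+1)$ with $k_n=3(\lfloor n/2\rfloor+1)$, $l_n=2(n+2)$, and $(a_{0,\varepsilon})_\varepsilon$ is of slow scale log-type up to order $(k_n',l_n')$ with $k_n'=l_n'=\lfloor n/2\rfloor+1$. Then there exist symbols $b_{-j}\in\mathcal G^{\rm sc}_{C^\infty([-T,T],S^{-j}(\mathbb R^{2n}))}$, $j\in\mathbb N=\{0,1,2,\dots\}$, which solve the transport equations $$D_tb_{-k}=\sum_{|\alpha|=1}\frac{\partial_\eta^\alpha a_1(t,\eta)}{\alpha!}D_x^\alpha b_{-k}+a_0b_{-k}+f_{-k},\qquad k=0,1,2,\dots,$$ where $f_0=0$ and, for $k\ge1$, $$f_{-k}=\sum_{j=0}^{k-1}\biggl(\sum_{|\alpha|=k-j}\frac{\partial_\eta^\alpha a_0(t,x,\eta)}{\alpha!}D_x^\alpha b_{-j}+\sum_{|\alpha|=k+1-j}\frac{\partial_\eta^\alpha a_1(t,\eta)}{\alpha!}D_x^\alpha b_{-j}\biggr),$$ and such that $b_0(0,x,\eta)=1$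 and $b_{-j}(0,x,\eta)=0$ for all $j>0$.
   Context: $D=-i\partial$. Nets are indexed by $\varepsilon\in(0,1]$, $O(\cdot)$ refers to $\varepsilon\to0$. A slow scale net is a net $(\mu_\varepsilon)$ in $\mathbb C$ with $|\mu_\varepsilon|^q=O(\varepsilon^{-1})$ for all $q\ge0$. For a locally convex space $E$ with seminorms $\{p_i\}$: $\mathcal M_E^{\rm sc}$ is the set of nets $(u_\varepsilon)$ in $E$ such that for every $i$ there is a slow scale net $(\omega_\varepsilon)$ with $p_i(u_\varepsilon)=O(\omega_\varepsilon)$; $\mathcal N_E$ is the set of nets with $p_i(u_\varepsilon)=O(\varepsilon^q)$ for all $i$ and all $q\in\mathbb N$; $\mathcal G_E^{\rm sc}=\mathcal M_E^{\rm sc}/\mathcal N_E$. Elements of $\mathcal G^{\rm sc}_{C^\infty([-T,T],S^m(\mathbb R^{2n}))}$ are called slow scale regular generalised symbols of order $m$. $S^m(\mathbb R^{2n})$ is the space of smooth symbols $a(x,\eta)$ with $\sup_{(x,\eta)\in\mathbb R^{2n}}\langle\eta\rangle^{-m+|\alpha|}|\partial_\eta^\alpha\partial_x^\beta a(x,\eta)|<\infty$ for all $\alpha,\beta$, with these suprema as seminorms; $C^\infty([-T,T],S^m(\mathbb R^{2n}))$ has the corresponding seminorms, with a supremum over $t\in[-T,T]$ of all $t$-derivatives. A net $(a_\varepsilon)$ of symbols of order $m$ is of slow scale log-type up to order $(k,h)$ if there is a slow scale net $(\mu_\varepsilon)$ with $\sup_{t\in[-T,T],(x,\eta)\in\mathbb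 R^{2n}}\langle\eta\rangle^{-m+|\alpha|}|\partial_\eta^\alpha\partial_x^\beta a_\varepsilon(t,x,\eta)|=O(\log\mu_\varepsilon)$ for all $|\alpha|\le k$, $|\beta|\le h$. Operations and equations are understood on representatives modulo negligible nets. *)

(* Defs.v *)
From HB Require Import structures.
From mathcomp Require Import all_boot all_order all_algebra.
From mathcomp Require Import all_classical all_reals all_analysis.
From mathcomp Require Import complex.

Set Implicit Arguments.
Unset Strict Implicit.
Unset Printing Implicit Defensive.

Import Order.TTheory GRing.Theory Num.Theory.
Import numFieldNormedType.Exports.
Import ComplexField.Normc.

Local Notation Re := complex.Re.
Local Notation Im := complex.Im.

Local Open Scope classical_set_scope.
Local Open Scope ring_scope.

(* A net is a function of eps : R, of which only the values
   for 0 < eps <= 1 matter. *)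

Section Nets.
Context {R : realType}.

(* p = O(w) as eps -> 0+, for p with values in [0, +oo].  The absolute value of
   w is deliberately not taken: in O(log mu) the logarithm must be
   nonnegative wherever p does not vanish, since a net such as
   mu = exp(- 1 / eps) is slow scale although |log mu| = 1 / eps. *)
Definition net_bigO (p : R -> \bar R) (w : R -> R) : Prop :=
  exists2 C : R, 0 <= C & \forall e \near 0^'+, (p e <= (C * w e)%:E)%E.

Definition slow_scale (mu : R -> R[i]) : Prop :=
  forall q : R, 0 <= q ->
    net_bigO (fun e => (normc (mu e) `^ q)%:E) (fun e => e^-1).

(* A locally convex space, given by the ambient type V, the elements of V that
   belong to the space, and its family of seminorms (allowed to be +oo outside
   the space). *)
Record lcspace (V : Type) := LCSpace {
  carrier : set V;
  sn_index : Type;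
  seminorm : sn_index -> V -> \bar R }.

Definition net_in (V : Type) (E : lcspace V) (u : R -> V) : Prop :=
  forall e, 0 < e <= 1 -> carrier E (u e).

Definition Msc (V : Type) (E : lcspace V) : set (R -> V) :=
  [set u | net_in E u /\
    forall i : sn_index E, exists2 w : R -> R[i], slow_scale w &
      net_bigO (fun e => seminorm i (u e)) (fun e => normc (w e))].

Definition Neg (V : Type) (E : lcspace V) : set (R -> V) :=
  [set u | net_in E u /\
    forall (i : sn_index E) (q : nat),
      net_bigO (fun e => seminorm i (u e)) (fun e => e ^+ q)].

(* The elements of the quotient Msc / Neg, as equivalence classes:
   for A in Gsc E, the nets in A are the representatives of A. *)
Definition Gsc (V : zmodType) (E : lcspace V) : set (set (R -> V)) :=
  [set A | exists2 u, Msc E u &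
    A = [set v | Msc E v /\ Neg E (fun e => v e - u e)]].

End Nets.

Arguments lcspace R V : clear implicits.

Section Symbols.
Context {R : realType} {n : nat}.

Notation phase := ('rV[R]_n * 'rV[R]_n)%type.

Definition deriv_along (v : phase) (a : phase -> R[i]) : phase -> R[i] :=
  fun z => ('D_v (fun w => Re (a w)) z +i* 'D_v (fun w => Im (a w)) z)%C.

(* Coordinate directions of R^2n: inl i is x_i, inr i is eta_i. *)
Definition dir (c : 'I_n + 'I_n) : phase :=
  match c with
  | inl i => (delta_mx 0 i, 0)
  | inr i => (0, delta_mx 0 i)
  end.

Definition smooth (a : phase -> R[i]) : Prop :=
  forall s : seq ('I_n + 'I_n),
    let b := foldr (fun c => deriv_along (dir c)) a s in
    [/\ continuous (fun z => Re (b z)), continuous (fun z => Im (b z)) &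
        forall c z, derivable (fun w => Re (b w)) z (dir c) /\
                    derivable (fun w => Im (b w)) z (dir c)].

Definition multi_index := 'I_n -> nat.

Definition mabs (alpha : multi_index) : nat := (\sum_i alpha i)%N.

Definition mfact (alpha : multi_index) : nat := (\prod_i (alpha i)`!)%N.

Definition partial_x (beta : multi_index) (a : phase -> R[i]) : phase -> R[i] :=
  foldr (fun i => iter (beta i) (deriv_along (dir (inl i)))) a (enum 'I_n).

Definition partial_eta (alpha : multi_index) (a : phase -> R[i]) :
    phase -> R[i] :=
  foldr (fun i => iter (alpha i) (deriv_along (dir (inr i)))) a (enum 'I_n).

Definition japanese (eta : 'rV[R]_n) : R :=
  Num.sqrt (1 + \sum_i eta 0 i ^+ 2).

Definition symbol_seminorm (m : R) (i : multi_index * multi_index)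
    (a : phase -> R[i]) : \bar R :=
  ereal_sup (range (fun z : phase =>
    (japanese z.2 `^ (- m + (mabs i.1)%:R)
       * normc (partial_eta i.1 (partial_x i.2 a) z))%:E)).

Definition Sym (m : R) : lcspace R (phase -> R[i]) := {|
  carrier := [set a | smooth a /\ forall i, (symbol_seminorm m i a < +oo)%E];
  seminorm := symbol_seminorm m |}.

(* Restricting the increments makes the derivatives at -T and T one-sided. *)
Definition increments (T t : R) : set_system R :=
  within [set h | t + h \in `[- T, T]] 0^'.

Definition time_deriv (T : R) (u : R -> phase -> R[i]) : R -> phase -> R[i] :=
  fun t z =>
    (lim ((h^-1 * (Re (u (t + h) z) - Re (u t z))) @[h --> increments T t])
     +i*
     lim ((h^-1 * (Im (u (t + h) z) - Im (u t z))) @[h --> increments T t]))%C.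

(* C^oo([-T, T], E) for a space E of functions on R^2n: all t-derivatives
   exist as limits of difference quotients in the topology of E.  As soon as
   convergence in E implies pointwise convergence, such a limit can only be the
   pointwise derivative. *)
Definition Cinfty (T : R) (E : lcspace R (phase -> R[i])) :
    lcspace R (R -> phase -> R[i]) := {|
  carrier := [set u | forall (l : nat) (t : R), t \in `[- T, T] ->
    let ul := iter l (time_deriv T) u in
    carrier E (ul t) /\
    forall i : sn_index E,
      seminorm i (fun z =>
        (h^-1)%:C%C * (ul (t + h) z - ul t z) - time_deriv T ul t z)
      @[h --> increments T t] --> 0%E];
  sn_index := nat * sn_index E;
  seminorm := fun i u =>
    ereal_sup [set seminorm i.2 (iter i.1 (time_deriv T) u t)
              | t in [set t | t \in `[- T, T]]] |}.

Definition CSym (T m : R) : lcspace R (R -> phase -> R[i]) := Cinfty T (Sym m).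

Notation symbol_net := (R -> R -> phase -> R[i]).

Definition slow_scale_log_type (T m : R) (k h : nat) (a : symbol_net) : Prop :=
  exists2 mu : R -> R[i], slow_scale mu &
    forall alpha beta : multi_index,
      (mabs alpha <= k)%N -> (mabs beta <= h)%N ->
      net_bigO (fun e => @seminorm R _ (CSym T m) (0%N, (alpha, beta)) (a e))
               (fun e => ln (normc (mu e))).

Definition real_valued (T : R) (a : symbol_net) : Prop :=
  forall e t z, 0 < e <= 1 -> t \in `[- T, T] -> Im (a e t z) = 0.

Definition x_independent (T : R) (a : symbol_net) : Prop :=
  forall e t x y eta, 0 < e <= 1 -> t \in `[- T, T] ->
    a e t (x, eta) = a e t (y, eta).

Definition D_t (T : R) (u : R -> phase -> R[i]) : R -> phase -> R[i] :=
  fun t z => - 'i%C * time_deriv T u t z.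

Definition D_x (alpha : multi_index) (a : phase -> R[i]) : phase -> R[i] :=
  fun z => (- 'i%C) ^+ mabs alpha * partial_x alpha a z.

(* The sum over |alpha| = d of (1 / alpha!) d_eta^alpha a * D_x^alpha b; all
   components of such an alpha are at most d. *)
Definition taylor_term (d : nat) (a b : phase -> R[i]) : phase -> R[i] :=
  fun z => \sum_(alpha : {ffun 'I_n -> 'I_d.+1} | mabs (fun i => alpha i) == d)
    partial_eta (fun i => alpha i) a z / (mfact (fun i => alpha i))%:R
    * D_x (fun i => alpha i) b z.

Definition transport_source (a1 a0 : R -> phase -> R[i])
    (b : nat -> R -> phase -> R[i]) (k : nat) : R -> phase -> R[i] :=
  fun t z => \sum_(j < k)
    (taylor_term (k - j) (a0 t) (b j t) z
     + taylor_term (k + 1 - j) (a1 t) (b j t) z).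

Definition transport_rhs (a1 a0 : R -> phase -> R[i])
    (b : nat -> R -> phase -> R[i]) (k : nat) : R -> phase -> R[i] :=
  fun t z => taylor_term 1 (a1 t) (b k t) z + a0 t z * b k t z
    + transport_source a1 a0 b k t z.

(* Here b j stands for b_{-j}.  Being an equality in the quotient, the k-th
   equation holds modulo negligible nets for any choice of representatives. *)
Definition solves_transport (T : R) (a1 a0 : set symbol_net)
    (b : nat -> set symbol_net) (k : nat) : Prop :=
  forall (u1 u0 : symbol_net) (v : nat -> symbol_net),
    a1 u1 -> a0 u0 -> (forall j, b j (v j)) ->
    Neg (CSym T (- k%:R)) (fun e t z =>
      D_t T (v k e) t z - transport_rhs (u1 e) (u0 e) (fun j => v j e) k t z).

Definition initial_value (m : R) (c : R[i]) (b : set symbol_net) : Prop :=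
  forall v, b v -> Neg (Sym m) (fun e z => v e 0 z - c).

End Symbols.

(* Main.v *)
Require Import Defs.
From mathcomp Require Import all_boot all_order all_algebra.
From mathcomp Require Import all_classical all_reals all_analysis.
From mathcomp Require Import complex.
From mathcomp Require Import ring lra.

Set Implicit Arguments.
Unset Strict Implicit.
Unset Printing Implicit Defensive.

Import Order.TTheory GRing.Theory Num.Theory.
Import numFieldNormedType.Exports.
Import ComplexField.Normc.

Local Notation Re := complex.Re.
Local Notation Im := complex.Im.

Local Open Scope classical_set_scope.
Local Open Scope ring_scope.

(* Multiplied by i, the k-th transport equation reads
     d_t b = sum_j (d_eta_j a1) d_x_j b + i a0 b + i f.
   As a1 is real and independent of x, its characteristics are the translations
   x |-> x + Phi(t, eta), where Phi is the primitive in t of grad_eta a1, vanishing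
   at t = 0. Along them the equation becomes d_t c = A c + F, with
   A = i a0(t, x - Phi, eta), solved by exp(P) times a primitive of exp(-P) F,
   where P is the primitive of A. The factor exp(P) is moderate because the log-type
   bound on a0 gives |exp(P)| <= exp(C log mu), a power of a slow scale net;
   its derivatives, and Phi, only involve the moderate nets of derivatives of
   a0 and a1. The equations are solved one after the other, and all operations
   respect negligible nets.

   The classes C^oo([-T, T], S^m) are handled through nets all of whose
   derivatives in t, x, eta, taken in any order, satisfy weighted uniform bounds;
   that this is equivalent to the definition by seminorms uses the symmetry of
   second derivatives. *)

(** * One-sided calculus on an interval *)

(** The seminorms of the symbol space see derivatives in one order only (time innermost, then x,
    then eta), and time derivatives are limits in its topology, whereas products, exponentials,
    primitives and translations produce derivatives in every order. Hence the detour through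
    [symbol], closed under all these operations by induction on the number of derivatives, with a
    flag that lets moderate and negligible nets share the closure lemmas. A growth rate is a
    statement near e = 0, but the bounds of [symbol] are asked for each e in (0, 1]. The definition
    of C^oo([-T, T], S^m) gives finite seminorms at each single time only, so finiteness of the
    supremum over t is deduced from compactness of [-T, T]. The logarithm in the hypothesis on a0 is
    decisive: the exponential of a slow scale net need not be slow scale, as log(1/e) shows, and the
    integrating factor would then leave the class. *)

Section OneVariable.
Context {R : realType}.
Implicit Types (a b s r K : R) (g : R -> R).

(* Derivative relative to [a, b], hence one-sided at the end points. *)
Definition diff_on a b g g1 := forall s, a <= s <= b ->
  forall eps, 0 < eps -> exists2 del, 0 < del & forall r, a <= r <= b ->
    `|r - s| < del -> `|g r - g s - (r - s) * g1 s| <= eps * `|r - s|.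

Lemma diff_onW a b a' b' g g1 : a <= a' -> b' <= b ->
  diff_on a b g g1 -> diff_on a' b' g g1.
Proof.
move=> aa bb H s /andP[s1 s2] eps eps0.
have [|del d0 Hd] := H s _ eps eps0; first by apply/andP; split; lra.
by exists del => // r /andP[r1 r2]; apply: Hd; apply/andP; split; lra.
Qed.

Lemma mean_value_le_endpoints a b g g1 K : a <= b -> diff_on a b g g1 ->
  (forall s, a <= s <= b -> `|g1 s| <= K) -> `|g b - g a| <= K * (b - a).
Proof.
move=> ab dg Hk.
have cont : {within `[a, b], continuous g}.
  apply/subspace_continuousP => s /=; rewrite in_itv/= => sab.
  apply/cvgrPdist_le => eps eps0.
  have [del d0 Hd] := dg s sab 1 ltr01.
  (* Tolerance 1 gives the crude bound [|g r - g s| <= c * |r - s|], enough for continuity. *)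
  pose c := 1 + `|g1 s|.
  have c0 : 0 < c by rewrite /c; have := normr_ge0 (g1 s); lra.
  rewrite near_withinE /=.
  near=> r => /=; rewrite in_itv/= => rab.
  have rd : `|r - s| < del.
    by near: r; apply/nbhs_ballP; exists del => //= y; rewrite /ball/= distrC.
  have re : `|r - s| < eps / c.
    by near: r; apply/nbhs_ballP; exists (eps / c) => [|y]/=; rewrite ?divr_gt0// /ball/= distrC.
  have := Hd r rab rd; rewrite mul1r => H.
  rewrite distrC.
  have -> : g r - g s = (g r - g s - (r - s) * g1 s) + (r - s) * g1 s by ring.
  rewrite (le_trans (ler_normD _ _))// normrM.
  apply: (@le_trans _ _ (c * `|r - s|)); first by rewrite (mulrC `|r - s|) /c (mulrDl 1) mul1r lerD.
  by rewrite mulrC -ler_pdivlMr// ltW.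
have der x : x \in `]a, b[%R -> is_derive x 1 g (g1 x).
  move=> xab.
  have xab' : a <= x <= b by move: xab; rewrite in_itv/= => /andP[? ?]; rewrite !ltW.
  have cv : h^-1 *: (g (h *: 1 + x) - g x) @[h --> 0^'] --> g1 x.
    apply/cvgrPdist_le => eps eps0.
    have [del d0 Hd] := dg x xab' eps eps0.
    near=> h.
    have h0 : h != 0 by near: h; exact: nbhs_dnbhs_neq.
    have hd : `|h| < del by near: h; apply: dnbhs0_lt.
    have hin : a <= h + x <= b.
      have hh : `|h| < Num.min (x - a) (b - x).
        near: h; apply: dnbhs0_lt; move: xab; rewrite in_itv/= => /andP[? ?].
        by rewrite lt_min !subr_gt0; apply/andP.
      move: hh; rewrite lt_min !ltr_norml => /andP[/andP[? ?] /andP[? ?]].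
      by apply/andP; split; lra.
    have := Hd _ hin; rewrite addrK => /(_ hd) H.
    rewrite /GRing.scale/= mulr1 distrC.
    have -> : h^-1 * (g (h + x) - g x) - g1 x = h^-1 * (g (h + x) - g x - h * g1 x) by field.
    by rewrite normrM normfV ler_pdivrMl ?normr_gt0// (mulrC `|h|).
  constructor; first by apply: (cvgP (g1 x)); exact: cv.
  by apply: (cvg_lim (@Rhausdorff R)); exact: cv.
have [c cab ->] := MVT_segment ab der cont.
rewrite normrM (ger0_norm (_ : 0 <= b - a)) ?subr_ge0//.
by rewrite ler_wpM2r ?subr_ge0// Hk//; move: cab; rewrite in_itv.
Unshelve. all: by end_near. Qed.

Lemma mean_value_on a b g g1 K s r : diff_on a b g g1 ->
  (forall s, a <= s <= b -> `|g1 s| <= K) -> a <= s <= b -> a <= r <= b ->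
  `|g r - g s| <= K * `|r - s|.
Proof.
move=> dg Hk /andP[s1 s2] /andP[r1 r2].
wlog sr : s r s1 s2 r1 r2 / s <= r.
  move=> H; have [sr|/ltW sr] := leP s r; first exact: H.
  by rewrite distrC [X in _ * X]distrC; apply: H.
rewrite [X in _ * X]ger0_norm ?subr_ge0//.
apply: (@mean_value_le_endpoints _ _ _ g1) => //; first exact: diff_onW dg.
by move=> x /andP[? ?]; apply: Hk; apply/andP; split; lra.
Qed.

Lemma diff_on_lin a b g g1 c : diff_on a b g g1 ->
  diff_on a b (fun s => g s - c * s) (fun s => g1 s - c).
Proof.
move=> H s sab eps eps0; have [del d0 Hd] := H s sab eps eps0.
exists del => // r rab rs; have := Hd r rab rs.
by congr (`|_| <= _); ring.
Qed.

Lemma diff_on_sub a b f f1 g g1 : diff_on a b f f1 -> diff_on a b g g1 ->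
  diff_on a b (fun s => f s - g s) (fun s => f1 s - g1 s).
Proof.
move=> Hf Hg s sab eps eps0.
have e2 : 0 < eps / 2 by lra.
have [d1 d10 H1] := Hf s sab _ e2; have [d2 d20 H2] := Hg s sab _ e2.
exists (Num.min d1 d2) => [|r rab]; first by rewrite lt_min d10.
rewrite lt_min => /andP[r1 r2].
have := H1 r rab r1; have := H2 r rab r2.
have -> : f r - g r - (f s - g s) - (r - s) * (f1 s - g1 s) =
  (f r - f s - (r - s) * f1 s) - (g r - g s - (r - s) * g1 s) by ring.
move=> A B; apply: (le_trans (ler_normB _ _)); lra.
Qed.

Lemma diff_on_scale a b g g1 c : diff_on a b g g1 ->
  diff_on a b (fun s => c * g s) (fun s => c * g1 s).
Proof.
move=> H s sab eps eps0.
have c0 : 0 < `|c| + 1 by have := normr_ge0 c; lra.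
have [del d0 Hd] := H s sab _ (divr_gt0 eps0 c0).
exists del => // r rab rs; have := Hd r rab rs.
have -> : c * g r - c * g s - (r - s) * (c * g1 s) = c * (g r - g s - (r - s) * g1 s) by ring.
move=> A; rewrite normrM; apply: le_trans (ler_wpM2l (normr_ge0 c) A) _.
rewrite mulrA ler_wpM2r// mulrC mulrAC ler_pdivrMr// ler_wpM2l ?ltW//; lra.
Qed.

(** Mean value inequality for [g x - g1 s * x] on the segment between [s] and [r]; hence the
    oscillation of [g1] matters no farther from [s] than [r]. *)
Lemma taylor1_on a b g g1 K s r : diff_on a b g g1 ->
  a <= s <= b -> a <= r <= b ->
  (forall x, a <= x <= b -> `|x - s| <= `|r - s| -> `|g1 x - g1 s| <= K) ->
  `|g r - g s - (r - s) * g1 s| <= K * `|r - s|.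
Proof.
move=> dg /andP[s1 s2] /andP[r1 r2] Hk.
have -> : g r - g s - (r - s) * g1 s = (g r - g1 s * r) - (g s - g1 s * s) by ring.
have [sr|rs] := leP s r.
  apply: (@mean_value_on s r (fun x => g x - g1 s * x) (fun x => g1 x - g1 s)); rewrite ?lexx ?sr//.
    by apply: diff_on_lin; apply: diff_onW dg.
  move=> x /andP[? ?]; apply: Hk; first by apply/andP; split; lra.
  by rewrite !ger0_norm; lra.
have rs' := ltW rs.
apply: (@mean_value_on r s (fun x => g x - g1 s * x) (fun x => g1 x - g1 s)); rewrite ?lexx ?rs'//.
  by apply: diff_on_lin; apply: diff_onW dg.
move=> x /andP[? ?]; apply: Hk; first by apply/andP; split; lra.
by rewrite !ler0_norm; lra.
Qed.

(** A bound on [g2] makes [g1] Lipschitz, which is the oscillation bound of [taylor1_on]. The factor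
    1/2 of Taylor's formula is given up. *)
Lemma taylor2_on a b g g1 g2 K s r : diff_on a b g g1 -> diff_on a b g1 g2 ->
  (forall s, a <= s <= b -> `|g2 s| <= K) -> a <= s <= b -> a <= r <= b ->
  `|g r - g s - (r - s) * g1 s| <= K * (r - s) ^+ 2.
Proof.
move=> dg dg1 Hk sab rab.
have -> : K * (r - s) ^+ 2 = (K * `|r - s|) * `|r - s|.
  by rewrite -mulrA -normrM -expr2 (ger0_norm (sqr_ge0 _)).
apply: (taylor1_on dg sab rab) => x xab xs.
apply: le_trans (mean_value_on dg1 Hk sab xab) _.
by by rewrite ler_wpM2l// (le_trans _ (Hk s sab)).
Qed.

(** The mixed second difference is the increment in the first variable of [F x r - F x 0], whose
    derivative is an increment in the second variable: two mean value inequalities, after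
    subtraction of linear parts. *)
Lemma second_difference a1 b1 a2 b2 (F F1 F12 : R -> R -> R) c eps :
  a1 <= 0 <= b1 -> a2 <= 0 <= b2 ->
  (forall r, a2 <= r <= b2 -> diff_on a1 b1 (F^~ r) (F1^~ r)) ->
  (forall s, a1 <= s <= b1 -> diff_on a2 b2 (F1 s) (F12 s)) ->
  (forall s r, a1 <= s <= b1 -> a2 <= r <= b2 -> `|F12 s r - c| <= eps) ->
  forall s r, a1 <= s <= b1 -> a2 <= r <= b2 ->
  `|F s r - F s 0 - (F 0 r - F 0 0) - s * (r * c)| <= eps * `|r| * `|s|.
Proof.
move=> h1 h2 d1 d2 bd s r hs hr.
pose phi x := F x r - F x 0 - (r * c) * x.
pose phi1 x := F1 x r - F1 x 0 - r * c.
have dphi : diff_on a1 b1 phi phi1.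
  by apply: diff_on_lin; apply: diff_on_sub; exact: d1.
have bphi x : a1 <= x <= b1 -> `|phi1 x| <= eps * `|r|.
  move=> hx.
  have := mean_value_on (diff_on_lin c (d2 x hx)) (bd x ^~ hx) h2 hr.
  by rewrite subr0; congr (`|_| <= _); rewrite /phi1; ring.
have := mean_value_on dphi bphi h1 hs; rewrite subr0.
by congr (`|_| <= _); rewrite /phi; ring.
Qed.

(** Continuity at the origin alone, relative to the rectangle: [schwarz] is applied with the point
    of interest shifted to the origin. *)
Definition continuous_on2 a1 b1 a2 b2 (F : R -> R -> R) :=
  forall eps, 0 < eps -> exists2 del, 0 < del &
    forall s r, a1 <= s <= b1 -> a2 <= r <= b2 -> `|s| <= del -> `|r| <= del ->
      `|F s r - F 0 0| <= eps.

(** The mixed second difference is symmetric in the two variables, and close to [s * r] times either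
    mixed derivative at the origin. The origin may lie on the boundary of the rectangle, as happens
    for time at -T and T. *)
Lemma schwarz a1 b1 a2 b2 (F F1 F2 F12 F21 : R -> R -> R) :
  a1 <= 0 <= b1 -> a1 < b1 -> a2 <= 0 <= b2 -> a2 < b2 ->
  (forall r, a2 <= r <= b2 -> diff_on a1 b1 (F^~ r) (F1^~ r)) ->
  (forall s, a1 <= s <= b1 -> diff_on a2 b2 (F1 s) (F12 s)) ->
  (forall s, a1 <= s <= b1 -> diff_on a2 b2 (F s) (F2 s)) ->
  (forall r, a2 <= r <= b2 -> diff_on a1 b1 (F2^~ r) (F21^~ r)) ->
  continuous_on2 a1 b1 a2 b2 F12 -> continuous_on2 a1 b1 a2 b2 F21 ->
  F12 0 0 = F21 0 0.
Proof.
move=> h1 l1 h2 l2 dF dF1 dF' dF2 c12 c21.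
apply/eqP; rewrite -subr_eq0 -normr_eq0 eq_le normr_ge0 andbT.
apply/ler_addgt0Pr => eps eps0; rewrite add0r.
have e2 : 0 < eps / 2 by lra.
have [x x0 Hx] := c12 _ e2; have [y y0 Hy] := c21 _ e2.
pose del := Num.min x y; have d0 : 0 < del by rewrite lt_min x0.
have dx : del <= x by rewrite ge_min lexx.
have dy : del <= y by rewrite ge_min lexx orbT.
(* Shrinks an interval to [|u| <= del] and keeps a nonzero end point: the left one if there is room
   on that side, otherwise the right one. *)
have step a b : a <= 0 <= b -> a < b -> exists a' b' s,
   [/\ a <= a', b' <= b, a' <= 0 <= b', (a' <= s <= b') && (s != 0) &
    forall u, a' <= u <= b' -> (a <= u <= b) && (`|u| <= del)].
  move=> /andP[A B] ab; exists (Num.max a (- del)), (Num.min b del).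
  have P : forall u, Num.max a (- del) <= u <= Num.min b del ->
      (a <= u <= b) && (`|u| <= del).
    move=> u; rewrite ge_max le_min ler_norml.
    by move=> /andP[/andP[-> ->] /andP[-> ->]].
  have [a0|a0] := ltP a 0.
    exists (Num.max a (- del)); split => //; [| | |apply/andP; split].
    - by rewrite le_max lexx.
    - by rewrite ge_min lexx.
    - by rewrite ge_max A le_min B /= oppr_le0 (ltW d0).
    - by rewrite lexx /= ge_max !le_min; apply/andP; split; apply/andP; split; lra.
    - by rewrite lt_eqF// gt_max a0 oppr_lt0.
  have b0 : 0 < b by lra.
  exists (Num.min b del); split => //; [| | |apply/andP; split].
  - by rewrite le_max lexx.
  - by rewrite ge_min lexx.
  - by rewrite ge_max A le_min B /= oppr_le0 (ltW d0).
  - by rewrite lexx andbT /= ge_max !le_min; apply/andP; split; apply/andP; split; lra.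
  - by rewrite gt_eqF// lt_min b0.
have [u1 [v1 [s [p1 q1 z1 /andP[hs s0] P1]]]] := step _ _ h1 l1.
have [u2 [v2 [r [p2 q2 z2 /andP[hr r0] P2]]]] := step _ _ h2 l2.
have in1 w : u1 <= w <= v1 -> a1 <= w <= b1 by move=> /P1/andP[].
have in2 w : u2 <= w <= v2 -> a2 <= w <= b2 by move=> /P2/andP[].
have A := @second_difference u1 v1 u2 v2 F F1 F12 (F12 0 0) (eps / 2) z1 z2
  (fun w hw => diff_onW p1 q1 (dF w (in2 w hw)))
  (fun w hw => diff_onW p2 q2 (dF1 w (in1 w hw))) _ s r hs hr.
have B := @second_difference u2 v2 u1 v1 (fun a b => F b a) (fun a b => F2 b a)
  (fun a b => F21 b a) (F21 0 0) (eps / 2) z2 z1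
  (fun w hw => diff_onW p2 q2 (dF' w (in1 w hw)))
  (fun w hw => diff_onW p1 q1 (dF2 w (in2 w hw))) _ r s hr hs.
have {}A : `|F s r - F s 0 - (F 0 r - F 0 0) - s * (r * F12 0 0)| <= eps / 2 * `|r| * `|s|.
  apply: A => a b /P1/andP[? ?] /P2/andP[? ?].
  by apply: Hx => //; apply: le_trans dx.
have {}B : `|F s r - F 0 r - (F s 0 - F 0 0) - r * (s * F21 0 0)| <= eps / 2 * `|s| * `|r|.
  apply: B => a b /P2/andP[? ?] /P1/andP[? ?].
  by apply: Hy => //; apply: le_trans dy.
have sr : 0 < `|s| * `|r| by rewrite mulr_gt0 ?normr_gt0.
rewrite -(ler_pM2r sr) -!normrM.
have -> : (F12 0 0 - F21 0 0) * (s * r) =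
  (F s r - F 0 r - (F s 0 - F 0 0) - r * (s * F21 0 0)) -
  (F s r - F s 0 - (F 0 r - F 0 0) - s * (r * F12 0 0)) by ring.
apply: le_trans (ler_normB _ _) _; apply: le_trans (lerD B A) _.
by rewrite normrM; lra.
Qed.

End OneVariable.

(** * Moderate and negligible nets of reals *)

Section RealNets.
Context {R : realType}.
Implicit Types w : R -> R.

(** Nonnegative slow scale nets, with natural exponents only and no sign asked of [C]. Nonnegativity
    at every [e] lets bounds be multiplied. *)
Definition moderate w := (forall e, 0 <= w e) /\
  forall q : nat, exists C : R, \forall e \near 0^'+, w e ^+ q <= C * e^-1.

Definition negligible w := (forall e, 0 <= w e) /\
  forall q : nat, exists C : R, \forall e \near 0^'+, w e <= C * e ^+ q.

(** The flag lets the closure properties of symbols be stated once for moderate and negligible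
    nets. *)
Definition growth (b : bool) : set (R -> R) := if b then moderate else negligible.

Lemma growth_ge0 b w e : growth b w -> 0 <= w e.
Proof. by case: b => -[]. Qed.

Lemma near_unit : \forall e \near (0:R)^'+, 0 < e <= 1.
Proof.
near=> e; apply/andP; split; first by near: e; exact: nbhs_right_gt.
by apply: ltW; near: e; exact: nbhs_right_lt.
Unshelve. all: by end_near. Qed.

Lemma moderate_cst (c : R) : 0 <= c -> moderate (fun=> c).
Proof.
move=> c0; split=> // q; exists (c ^+ q); near=> e.
have /andP[e0 e1] : 0 < e <= 1 by near: e; exact: near_unit.
by rewrite ler_peMr ?exprn_ge0// invf_ge1.
Unshelve. all: by end_near. Qed.

Lemma growth0 b : growth b (fun=> 0).
Proof.
case: b; first exact: moderate_cst.
by split=> // q; exists 0; near=> e; rewrite mul0r.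
Unshelve. all: by end_near. Qed.

Lemma moderateD w w' : moderate w -> moderate w' -> moderate (fun e => w e + w' e).
Proof.
move=> [w0 H] [w0' H']; split=> [e|q]; first exact: addr_ge0.
have [C HC] := H q; have [C' HC'] := H' q.
exists (2 ^+ q * (C + C')); near=> e.
have A : w e ^+ q <= C * e^-1 by near: e.
have B : w' e ^+ q <= C' * e^-1 by near: e.
have P : (w e + w' e) ^+ q <= 2 ^+ q * (w e ^+ q + w' e ^+ q).
  have [h|h] := leP (w e) (w' e).
    apply: (@le_trans _ _ ((2 * w' e) ^+ q)).
      by rewrite lerXn2r ?nnegrE ?addr_ge0 ?mulr_ge0//; lra.
    by rewrite exprMn ler_pM2l ?exprn_gt0// lerDr exprn_ge0.
  apply: (@le_trans _ _ ((2 * w e) ^+ q)).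
    by rewrite lerXn2r ?nnegrE ?addr_ge0 ?mulr_ge0//; lra.
  by rewrite exprMn ler_pM2l ?exprn_gt0// lerDl exprn_ge0.
apply: le_trans P _; rewrite -mulrA ler_pM2l ?exprn_gt0// mulrDl; exact: lerD.
Unshelve. all: by end_near. Qed.

Lemma moderateM w w' : moderate w -> moderate w' -> moderate (fun e => w e * w' e).
Proof.
move=> [w0 H] [w0' H']; split=> [e|q]; first exact: mulr_ge0.
(* Doubled exponents, since [x * y <= x ^+ 2 + y ^+ 2] separates the two factors. *)
have [C HC] := H (q * 2)%N; have [C' HC'] := H' (q * 2)%N.
exists (C + C'); near=> e.
have A : w e ^+ (q * 2) <= C * e^-1 by near: e.
have B : w' e ^+ (q * 2) <= C' * e^-1 by near: e.
rewrite mulrDl (le_trans _ (lerD A B))// !exprM exprMn.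
set x := w e ^+ q; set y := w' e ^+ q; nra.
Unshelve. all: by end_near. Qed.

Lemma growthD b w w' : growth b w -> growth b w' -> growth b (fun e => w e + w' e).
Proof.
case: b; first exact: moderateD.
move=> [w0 H] [w0' H']; split=> [e|q]; first exact: addr_ge0.
have [C HC] := H q; have [C' HC'] := H' q.
exists (C + C'); near=> e; rewrite mulrDl.
by apply: lerD; near: e.
Unshelve. all: by end_near. Qed.

Lemma growthM b w w' : moderate w -> growth b w' -> growth b (fun e => w e * w' e).
Proof.
case: b; first exact: moderateM.
move=> [w0 H] [w0' H']; split=> [e|q]; first exact: mulr_ge0.
(* The moderate factor costs at most a multiple of 1/e, compensated by one more power of [e]. *)
have [C HC] := H 1%N; have [C' HC'] := H' q.+1.
exists (C * C'); near=> e.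
have /andP[e0 e1] : 0 < e <= 1 by near: e; exact: near_unit.
have A : w e ^+ 1 <= C * e^-1 by near: e.
have B : w' e <= C' * e ^+ q.+1 by near: e.
rewrite expr1 in A; apply: (le_trans (ler_pM (w0 e) (w0' e) A B)).
by rewrite exprS le_eqVlt; apply/orP; left; apply/eqP; field; rewrite gt_eqF.
Unshelve. all: by end_near. Qed.

Lemma growthZ b (c : R) w : 0 <= c -> growth b w -> growth b (fun e => c * w e).
Proof. by move=> c0; apply: growthM; exact: moderate_cst. Qed.

Lemma growth_le b w w' : growth b w -> (forall e, 0 <= w' e) ->
  (\forall e \near 0^'+, w' e <= w e) -> growth b w'.
Proof.
case: b => -[w0 H] w0' le; split=> // q; have [C HC] := H q; exists C; near=> e.
  have A : w e ^+ q <= C * e^-1 by near: e.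
  have B : w' e <= w e by near: e.
  by apply: le_trans A; rewrite lerXn2r ?nnegrE.
by apply: (@le_trans _ _ (w e)); near: e.
Unshelve. all: by end_near. Qed.

Lemma slow_scale_moderate (mu : R -> R[i]) :
  slow_scale mu -> moderate (fun e => normc (mu e)).
Proof.
move=> H; split=> [e|q]; first by case: (mu e) => ? ?; exact: sqrtr_ge0.
have [C C0 HC] := H q%:R (ler0n _ _); exists C; near=> e.
have : ((normc (mu e) `^ q%:R)%:E <= (C * e^-1)%:E)%E by near: e.
by rewrite lee_fin powR_mulrn//; case: (mu e) => ? ?; exact: sqrtr_ge0.
Unshelve. all: by end_near. Qed.

Lemma normc_real (x : R) : 0 <= x -> normc x%:C%C = x.
Proof. by move=> x0; rewrite /normc/= expr0n/= addr0 sqrtr_sqr ger0_norm. Qed.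

(** Where the net exceeds 1, a real exponent is replaced by a larger natural one; elsewhere the
    power is at most 1, whence the summand 1 in the constant. *)
Lemma moderate_powR w (q : R) : moderate w -> 0 <= q ->
  exists2 C : R, 0 <= C & \forall e \near 0^'+, w e `^ q <= C * e^-1.
Proof.
move=> [w0 H] q0; set N := (Num.truncn q).+1.
have qN : q <= N%:R by apply: ltW; exact: truncnS_gt.
have [C HC] := H N; exists (1 + `|C|) => [|]; first by have := normr_ge0 C; lra.
near=> e.
have /andP[e0 e1] : 0 < e <= 1 by near: e; exact: near_unit.
have e1' : 1 <= e^-1 by rewrite invf_ge1.
have A : w e ^+ N <= C * e^-1 by near: e.
have B : C * e^-1 <= `|C| * e^-1 by rewrite ler_wpM2r ?ler_norm// invr_ge0 ltW.
rewrite mulrDl mul1r.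
have [h|h] := leP (w e) 1.
  have : w e `^ q <= 1 by have := ge0_ler_powR q0 (_ : w e \in Num.nneg) (_ : 1 \in Num.nneg) h; rewrite powR1; apply; rewrite nnegrE.
  have : 0 <= w e ^+ N by exact: exprn_ge0.
  lra.
have : w e `^ q <= w e ^+ N by rewrite -powR_mulrn// ler_powR// ltW.
lra.
Unshelve. all: by end_near. Qed.

Lemma moderate_slow_scale w : moderate w -> slow_scale (fun e => (w e)%:C%C).
Proof.
move=> wm q q0; have [C C0 HC] := moderate_powR wm q0; exists C => //.
near=> e; rewrite normc_real; last by case: wm.
by rewrite lee_fin; near: e.
Unshelve. all: by end_near. Qed.

Lemma moderate_exp_log (mu : R -> R[i]) (L : R -> R) (C K : R) :
  slow_scale mu -> 0 <= C -> 0 <= K ->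
  (\forall e \near 0^'+, L e <= C * ln (normc (mu e))) ->
  moderate (fun e => expR (K * L e)).
Proof.
move=> /slow_scale_moderate mm C0 K0 HL; split=> [e|q]; first exact: expR_ge0.
have qKC : 0 <= q%:R * (K * C) by rewrite !mulr_ge0.
have [D D0 HD] := moderate_powR mm qKC.
exists (1 + D); near=> e.
have /andP[e0 e1] : 0 < e <= 1 by near: e; exact: near_unit.
have e1' : 1 <= e^-1 by rewrite invf_ge1.
have A : L e <= C * ln (normc (mu e)) by near: e.
have B : normc (mu e) `^ (q%:R * (K * C)) <= D * e^-1 by near: e.
have P : expR (K * L e) ^+ q <= expR (q%:R * (K * C) * ln (normc (mu e))).
  by rewrite -expRM_natl ler_expR mulrA -!mulrA !ler_wpM2l.
apply: le_trans P _; rewrite mulrDl mul1r.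
have m0 := mm.1 e.
(* By convention [ln 0 = 0], so a zero of [mu] gives the bound [expR 0 = 1]; this is the 1 in
   [1 + D]. *)
case: (eqVneq (normc (mu e)) 0) => [z|z].
  rewrite z ln0 ?lexx// mulr0 expR0.
  have : 0 <= D * e^-1 by rewrite mulr_ge0// invr_ge0 ltW.
  lra.
by move: B; rewrite /powR (negbTE z); lra.
Unshelve. all: by end_near. Qed.

End RealNets.

Lemma ler_normD_bound (R : realDomainType) (x y a b : R) :
  `|x| <= a -> `|y| <= b -> `|x + y| <= a + b.
Proof. by move=> ? ?; apply: le_trans (ler_normD _ _) _; exact: lerD. Qed.

Lemma ler_normM_bound (R : realDomainType) (x y a b : R) :
  `|x| <= a -> `|y| <= b -> `|x * y| <= a * b.
Proof. by move=> ? ?; rewrite normrM ler_pM. Qed.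

(** * Directional expansions with quadratic remainder *)

Section Derivatives.
Context {R : realType} {n : nat}.
Variable T : R.

Notation phase := ('rV[R]_n * 'rV[R]_n)%type.
Notation net := (R -> R -> phase -> R).
Notation axis := (option ('I_n + 'I_n)).
Implicit Types (u v : net) (d : axis) (e t h : R) (z : phase).

Definition shift_t d h t : R := if d is None then t + h else t.

Definition shift_z d h z : phase := if d is Some c then h *: dir c + z else z.

Lemma shift_t0 d t : shift_t d 0 t = t.
Proof. by case: d => //=; rewrite addr0. Qed.

Lemma shift_z0 d z : shift_z d 0 z = z.
Proof. by case: d => //= c; rewrite scale0r add0r. Qed.

(** The loss of symbol order caused by one derivative: only frequency directions lower it. *)
Definition weight d : R := if d is Some (inr _) then 1 else 0.

Definition eq_on (V : Type) (u v : R -> R -> phase -> V) :=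
  forall e t z, 0 < e <= 1 -> `|t| <= T -> u e t z = v e t z.

(* The direction None is time. The remainder is quadratic, so that sums,
   products and compositions need no limits. *)
Definition has_deriv d u v := forall e t z, 0 < e <= 1 -> `|t| <= T ->
  exists C, forall h, `|h| <= 1 -> `|shift_t d h t| <= T ->
    `|u e (shift_t d h t) (shift_z d h z) - u e t z - h * v e t z| <= C * h ^+ 2.

(** A named remainder [h ^+ 2 * rho h] with bounded [rho] reduces products and compositions to
    polynomial identities. At [h = 0] the division returns 0 and the identity still holds. *)
Lemma has_derivP d u v e t z : has_deriv d u v -> 0 < e <= 1 -> `|t| <= T ->
  exists rho C, 0 <= C /\ forall h, `|h| <= 1 -> `|shift_t d h t| <= T ->
    u e (shift_t d h t) (shift_z d h z) = u e t z + h * v e t z + h ^+ 2 * rho h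
    /\ `|rho h| <= C.
Proof.
move=> H he ht; have [C HC] := H e t z he ht.
exists (fun h => (u e (shift_t d h t) (shift_z d h z) - u e t z - h * v e t z) / h ^+ 2).
exists `|C|; split=> // h h1 hT.
have := HC h h1 hT; case: (eqVneq h 0) => [->|h0].
  by rewrite shift_t0 shift_z0 expr0n/= invr0 !mulr0 mul0r normr0; split=> //; ring.
have h2 : 0 < h ^+ 2 by rewrite exprn_even_gt0.
move=> A; split; first by field.
by rewrite normrM normfV (gtr0_norm h2) ler_pdivrMr// (le_trans A)// ler_pM2r// ler_norm.
Qed.

Lemma has_derivI d u v :
  (forall e t z, 0 < e <= 1 -> `|t| <= T ->
    exists rho C, forall h, `|h| <= 1 -> `|shift_t d h t| <= T ->
    u e (shift_t d h t) (shift_z d h z) = u e t z + h * v e t z + h ^+ 2 * rho h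
    /\ `|rho h| <= C) ->
  has_deriv d u v.
Proof.
move=> H e t z he ht; have [rho [C HC]] := H e t z he ht; exists C => h h1 hT.
have [-> B] := HC h h1 hT.
have -> : u e t z + h * v e t z + h ^+ 2 * rho h - u e t z - h * v e t z =
   rho h * h ^+ 2 by ring.
by rewrite normrM (ger0_norm (sqr_ge0 h)) ler_wpM2r// sqr_ge0.
Qed.

Lemma has_deriv_ext d u u' v v' : eq_on u u' -> eq_on v v' ->
  has_deriv d u v -> has_deriv d u' v'.
Proof.
move=> eu ev H e t z he ht; have [C HC] := H e t z he ht; exists C => h h1 hT.
by rewrite -!eu// -ev//; exact: HC.
Qed.

(** At the ends of [-T, T] only one sign of the increment is allowed; a step of length at most T,
    backward if [t >= 0] and forward otherwise, stays inside. Uniqueness of derivatives and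
    properness of [increments] rest on this. *)
Lemma small_increment d t (x : R) : 0 < T -> `|t| <= T -> 0 < x ->
  exists h, [/\ h != 0, `|h| <= 1, `|h| <= x & `|shift_t d h t| <= T].
Proof.
move=> T0; rewrite ler_norml => /andP[t1 t2] x0.
pose y := Num.min (Num.min 1 x) T.
have y0 : 0 < y by rewrite !lt_min x0 T0 ltr01.
have [y1 yx yT] : [/\ y <= 1, y <= x & y <= T].
  by split; rewrite !ge_min lexx ?orbT.
exists (if 0 <= t then - y else y); case: ifPn => ht.
  rewrite oppr_eq0 gt_eqF// normrN gtr0_norm//; split => //.
  by case: d => [c|] /=; rewrite ler_norml; apply/andP; split; lra.
rewrite gt_eqF// gtr0_norm//; split => //; rewrite -ltNge in ht.
by case: d => [c|] /=; rewrite ler_norml; apply/andP; split; lra.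
Qed.

Lemma has_deriv_unique d u v v' : 0 < T ->
  has_deriv d u v -> has_deriv d u v' -> eq_on v v'.
Proof.
move=> T0 H H' e t z he ht.
have [C HC] := H e t z he ht; have [C' HC'] := H' e t z he ht.
apply/eqP; rewrite -subr_eq0 -normr_eq0 eq_le normr_ge0 andbT.
apply/ler_addgt0Pr => eps eps0; rewrite add0r.
have K0 : 0 < `|C| + `|C'| + 1 by have := normr_ge0 C; have := normr_ge0 C'; lra.
have [h [h0 h1 hx hT]] := small_increment d T0 ht (divr_gt0 eps0 K0).
have A := HC h h1 hT; have B := HC' h h1 hT.
have hp : 0 < `|h| by rewrite normr_gt0.
rewrite -(ler_pM2r hp) -normrM.
set w := u e _ _ in A B.
have -> : (v e t z - v' e t z) * h =
  (w - u e t z - h * v' e t z) - (w - u e t z - h * v e t z) by ring.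
apply: le_trans (ler_normB _ _) _; apply: le_trans (lerD B A) _.
have -> : C' * h ^+ 2 + C * h ^+ 2 = ((C + C') * `|h|) * `|h|.
  by rewrite -mulrA -expr2 real_normK ?num_real//; ring.
rewrite ler_pM2r//; move: hx; rewrite ler_pdivlMr// => hx.
apply: le_trans hx; rewrite mulrC ler_wpM2l//.
by have := ler_norm C; have := ler_norm C'; lra.
Qed.

Lemma has_deriv_cst d (c : R) : has_deriv d (fun _ _ _ => c) (fun _ _ _ => 0).
Proof.
by move=> e t z _ _; exists 0 => h _ _; rewrite subrr mulr0 subr0 normr0 mul0r.
Qed.

Lemma has_derivD d u u' v v' : has_deriv d u v -> has_deriv d u' v' ->
  has_deriv d (fun e t z => u e t z + u' e t z) (fun e t z => v e t z + v' e t z).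
Proof.
move=> H H' e t z he ht.
have [C HC] := H e t z he ht; have [C' HC'] := H' e t z he ht.
exists (C + C') => h h1 hT; rewrite mulrDl.
apply: le_trans (lerD (HC h h1 hT) (HC' h h1 hT)).
by apply: le_trans (ler_normD _ _); rewrite le_eqVlt; apply/orP; left; apply/eqP; congr `|_|; ring.
Qed.

Lemma has_derivM d u u' v v' : has_deriv d u v -> has_deriv d u' v' ->
  has_deriv d (fun e t z => u e t z * u' e t z)
              (fun e t z => v e t z * u' e t z + u e t z * v' e t z).
Proof.
move=> H H'; apply: has_derivI => e t z he ht.
have [r [C [C0 HC]]] := has_derivP z H he ht.
have [r' [C' [C0' HC']]] := has_derivP z H' he ht.
(* All terms of the product of the two expansions that carry [h ^+ 2]; in the bound, the remaining
   powers of [h] are replaced by 1. *)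
exists (fun h => v e t z * v' e t z + u e t z * r' h + h * (v e t z * r' h) +
  r h * u' e t z + h * (r h * v' e t z) + (h * h) * (r h * r' h)).
exists (`|v e t z| * `|v' e t z| + `|u e t z| * C' + 1 * (`|v e t z| * C') +
  C * `|u' e t z| + 1 * (C * `|v' e t z|) + (1 * 1) * (C * C')) => h h1 hT.
have [-> Hr] := HC h h1 hT; have [-> Hr'] := HC' h h1 hT; split; first by ring.
by repeat first [apply: ler_normD_bound | apply: ler_normM_bound].
Qed.

Lemma has_deriv_comp d (f f1 : R -> R) u v :
  (forall y B, 0 <= B -> exists K, forall x, `|x - y| <= B ->
     `|f x - f y - (x - y) * f1 y| <= K * (x - y) ^+ 2) ->
  has_deriv d u v ->
  has_deriv d (fun e t z => f (u e t z)) (fun e t z => f1 (u e t z) * v e t z).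
Proof.
move=> Hf H e t z he ht.
have [r [C [C0 HC]]] := has_derivP z H he ht.
(* For [|h| <= 1] the inner increment is at most [|h| * B], so one neighbourhood of [u e t z] serves
   for all increments. *)
set B := `|v e t z| + C.
have B0 : 0 <= B by rewrite addr_ge0.
have [K HK] := Hf (u e t z) B B0.
exists (`|f1 (u e t z)| * C + `|K| * B ^+ 2) => h h1 hT.
have [-> Hr] := HC h h1 hT.
set y := u e t z in HK *; set x := y + _ + _.
have xyE : x - y = h * (v e t z + h * r h) by rewrite /x; ring.
have bB : `|v e t z + h * r h| <= B.
  apply: le_trans (ler_normD _ _) _; rewrite lerD// normrM.
  by rewrite -[leRHS]mul1r ler_pM.
have xyB : `|x - y| <= B by rewrite xyE normrM -[leRHS]mul1r ler_pM.
have {HK} := HK x xyB => HK.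
have -> : f x - f y - h * (f1 y * v e t z) =
  (f x - f y - (x - y) * f1 y) + h ^+ 2 * (f1 y * r h) by rewrite xyE; ring.
apply: le_trans (ler_normD _ _) _; rewrite [leRHS]mulrDl [leRHS]addrC lerD//; last first.
  rewrite mulrC normrM (ger0_norm (sqr_ge0 h)) ler_wpM2r ?sqr_ge0//.
  by rewrite normrM ler_wpM2l.
apply: le_trans HK _; apply: (@le_trans _ _ (`|K| * (x - y) ^+ 2)).
  by rewrite ler_wpM2r ?sqr_ge0// ler_norm.
rewrite -mulrA ler_wpM2l// xyE exprMn mulrC ler_wpM2r ?sqr_ge0//.
set q := _ + _ in bB *.
by rewrite -(ger0_norm (sqr_ge0 q)) normrX lerXn2r ?nnegrE.
Qed.

End Derivatives.

(** * Mean value and Taylor inequalities along coordinate lines *)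

Section Curves.
Context {R : realType} {n : nat}.
Variable T : R.

Notation phase := ('rV[R]_n * 'rV[R]_n)%type.
Notation net := (R -> R -> phase -> R).
Notation axis := (option ('I_n + 'I_n)).
Implicit Types (u v w : net) (d : axis) (e t h s : R) (z : phase).

Lemma shift_tD d h s t : shift_t d h (shift_t d s t) = shift_t d (s + h) t.
Proof. by case: d => //=; rewrite addrA. Qed.

Lemma shift_zD d h s z : shift_z d h (shift_z d s z) = shift_z d (s + h) z.
Proof. by case: d => //= c; rewrite addrA -scalerDl (addrC s). Qed.

Lemma has_deriv_curve d u v e t z a b : has_deriv T d u v -> 0 < e <= 1 ->
  (forall s, a <= s <= b -> `|shift_t d s t| <= T) ->
  diff_on a b (fun s => u e (shift_t d s t) (shift_z d s z))
              (fun s => v e (shift_t d s t) (shift_z d s z)).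
Proof.
move=> H he hT s sab eps eps0.
have [C HC] := H e _ (shift_z d s z) he (hT s sab).
have C0 : 0 < `|C| + 1 by have := normr_ge0 C; lra.
exists (Num.min 1 (eps / (`|C| + 1))) => [|r rab].
  by rewrite lt_min ltr01 divr_gt0.
rewrite lt_min ltr_pdivlMr// => /andP[r1 rC].
have := HC (r - s) (ltW r1); rewrite shift_tD shift_zD (addrC s) subrK => /(_ (hT r rab)) A.
apply: le_trans A _; rewrite -(real_normK (num_real (r - s))) expr2 mulrA ler_wpM2r//.
apply: le_trans (ltW rC); rewrite mulrC ler_wpM2l//.
by have := ler_norm C; lra.
Qed.

Lemma shift_t_between d h s t : `|t| <= T -> `|shift_t d h t| <= T ->
  Num.min 0 h <= s <= Num.max 0 h -> `|shift_t d s t| <= T /\ `|s| <= `|h|.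
Proof.
case: (lerP 0 h) => h0; rewrite !ler_norml => /andP[t1 t2] ht /andP[s1 s2].
  split; last by apply/andP; split; have := ger0_norm h0; lra.
  by case: d ht => [c|] /= /andP[? ?]; apply/andP; split; lra.
split; last by apply/andP; split; have := ltr0_norm h0; lra.
by case: d ht => [c|] /= /andP[? ?]; apply/andP; split; lra.
Qed.

Lemma min0max h : Num.min 0 h <= 0 <= Num.max 0 h.
Proof. by rewrite ge_min le_max !lexx. Qed.

Lemma minhmax h : Num.min 0 h <= h <= Num.max 0 h.
Proof. by rewrite ge_min le_max !lexx !orbT. Qed.

Lemma mean_value_le d u v e t z h K : has_deriv T d u v -> 0 < e <= 1 ->
  `|t| <= T -> `|shift_t d h t| <= T ->
  (forall s, `|s| <= `|h| -> `|shift_t d s t| <= T ->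
    `|v e (shift_t d s t) (shift_z d s z)| <= K) ->
  `|u e (shift_t d h t) (shift_z d h z) - u e t z| <= K * `|h|.
Proof.
move=> H he ht hh hK.
have B s (hs : Num.min 0 h <= s <= Num.max 0 h) := shift_t_between ht hh hs.
have D := has_deriv_curve z H he (fun s hs => (B s hs).1).
have := mean_value_on D (fun s hs => hK s (B s hs).2 (B s hs).1) (min0max h) (minhmax h).
by rewrite subr0 shift_t0 shift_z0.
Qed.

(** [has_deriv] leaves its constant uncontrolled; a bound on the second derivative makes it
    explicit, and so uniform in the remaining variables. *)
Lemma taylor2_le d u v w e t z h K : has_deriv T d u v -> has_deriv T d v w ->
  0 < e <= 1 -> `|t| <= T -> `|shift_t d h t| <= T ->
  (forall s, `|s| <= `|h| -> `|shift_t d s t| <= T ->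
    `|w e (shift_t d s t) (shift_z d s z)| <= K) ->
  `|u e (shift_t d h t) (shift_z d h z) - u e t z - h * v e t z| <= K * h ^+ 2.
Proof.
move=> H H' he ht hh hK.
have B s (hs : Num.min 0 h <= s <= Num.max 0 h) := shift_t_between ht hh hs.
have D := has_deriv_curve z H he (fun s hs => (B s hs).1).
have D' := has_deriv_curve z H' he (fun s hs => (B s hs).1).
have := taylor2_on D D' (fun s hs => hK s (B s hs).2 (B s hs).1) (min0max h) (minhmax h).
by rewrite subr0 shift_t0 shift_z0.
Qed.

Lemma japanese_ge1 (eta : 'rV[R]_n) : 1 <= japanese eta.
Proof.
rewrite /japanese -[leLHS]sqrtr1 ler_wsqrtr// lerDl sumr_ge0// => i _.
exact: sqr_ge0.
Qed.

Lemma japanese_gt0 (eta : 'rV[R]_n) : 0 < japanese eta.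
Proof. exact: lt_le_trans ltr01 (japanese_ge1 eta). Qed.

(** Only frequencies are constrained, since symbol bounds are uniform in [x]; the margin 2 leaves
    room for two successive shifts of length at most 1. *)
Definition freq_near z z' := forall i, `|z'.2 0 i| <= `|z.2 0 i| + 2.

Lemma shift_z_freq d s z i : `|s| <= 1 -> `|(shift_z d s z).2 0 i| <= `|z.2 0 i| + 1.
Proof.
move=> s1; case: d => [[j|j]|] /=; rewrite ?mxE; last by rewrite lerDl.
  by rewrite mulr0 add0r lerDl.
rewrite addrC; apply: ler_normD_bound => //; case: (_ && _);
by rewrite /= ?mulr1 ?mulr0 ?normr0 ?ler01.
Qed.

Lemma japanese_bounded z (m : R) : exists2 K, 0 <= K &
  forall z', freq_near z z' -> japanese z'.2 `^ m <= K.
Proof.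
pose J := Num.sqrt (1 + \sum_i (`|z.2 0 i| + 2) ^+ 2).
have H z' : freq_near z z' -> japanese z'.2 <= J.
  move=> zz'; rewrite /japanese /J ler_wsqrtr// lerD2l ler_sum// => i _.
  by rewrite -(real_normK (num_real _)) lerXn2r ?nnegrE ?addr_ge0.
(* As [japanese] is at least 1, [m] may be replaced by its absolute value, after which the power is
   monotone in the base. *)
exists (J `^ `|m|) => [|z' zz']; first exact: powR_ge0.
have J1 : 1 <= japanese z'.2 := japanese_ge1 _.
apply: (@le_trans _ _ (japanese z'.2 `^ `|m|)).
  by apply: ler_powR => //; exact: ler_norm.
apply: ge0_ler_powR; rewrite ?nnegrE// ?H//; first by apply: le_trans J1.
exact: sqrtr_ge0.
Qed.

End Curves.

(** * Symbol classes given by derivatives in any order *)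

Section SymbolClasses.
Context {R : realType} {n : nat}.
Variable T : R.
Hypothesis T_gt0 : 0 < T.

Notation phase := ('rV[R]_n * 'rV[R]_n)%type.
Notation net := (R -> R -> phase -> R).
Notation axis := (option ('I_n + 'I_n)).
Notation wt := (@weight R n).
Implicit Types (u v w : net) (d : axis) (e t h s m : R) (z : phase) (b : bool).

(** The bound is asked for every [e] in (0, 1], while [growth] limits the size of [w] only near
    0. *)
Definition symbol_bound b m u := exists2 w : R -> R, growth b w &
  forall e t z, 0 < e <= 1 -> `|t| <= T -> `|u e t z| <= w e * japanese z.2 `^ m.

(** Finite unfoldings of a coinductive notion. Derivatives are unique by [has_deriv_unique], so the
    witnesses at different depths [k] agree. *)
Fixpoint symbol_upto b k m u : Prop := symbol_bound b m u /\
  if k is k'.+1 then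
    forall d, exists v, has_deriv T d u v /\ symbol_upto b k' (m - wt d) v
  else True.

(* Nets of real symbols of order m on [-T, T], moderate (b = true) or
   negligible (b = false); derivatives are taken in any order. *)
Definition symbol b m u := forall k, symbol_upto b k m u.

Lemma symbol_upto_bound b k m u : symbol_upto b k m u -> symbol_bound b m u.
Proof. by case: k => [|k] []. Qed.

Lemma symbol_bound_ext b m u u' : eq_on T u u' -> symbol_bound b m u -> symbol_bound b m u'.
Proof.
by move=> uu [w wg H]; exists w => // e t z he ht; rewrite -uu//; exact: H.
Qed.

Lemma eq_on_refl (V : Type) (u : R -> R -> phase -> V) : eq_on T u u.
Proof. by []. Qed.

Lemma symbol_upto_ext b k m u u' : eq_on T u u' -> symbol_upto b k m u -> symbol_upto b k m u'.
Proof.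
case: k => [|k] uu [B H]; split => //; try exact: symbol_bound_ext B.
move=> d; have [v [Hv Sv]] := H d; exists v; split=> //.
exact: has_deriv_ext uu (@eq_on_refl _ v) Hv.
Qed.

Lemma symbol_ext b m u u' : eq_on T u u' -> symbol b m u -> symbol b m u'.
Proof. by move=> uu H k; exact: symbol_upto_ext uu (H k). Qed.

Lemma symbol_uptoW b k m u : symbol_upto b k.+1 m u -> symbol_upto b k m u.
Proof.
elim: k m u => [|k IH] m u [B H]; split=> // d.
by have [v [Hv Sv]] := H d; exists v; split=> //; exact: IH.
Qed.

Lemma symbol_upto_deriv b k m d u v :
  symbol_upto b k.+1 m u -> has_deriv T d u v -> symbol_upto b k (m - wt d) v.
Proof.
move=> [_ H] Hv; have [v' [Hv' S]] := H d.
by apply: symbol_upto_ext S; exact: has_deriv_unique Hv' Hv.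
Qed.

Lemma symbol_deriv b m d u v :
  symbol b m u -> has_deriv T d u v -> symbol b (m - wt d) v.
Proof. by move=> S H k; exact: symbol_upto_deriv (S k.+1) H. Qed.

Lemma symbol_has_deriv b m d u : symbol b m u ->
  exists v, has_deriv T d u v /\ symbol b (m - wt d) v.
Proof.
move=> S; have [_ /(_ d)[v [Hv _]]] := S 1%N.
by exists v; split=> //; exact: symbol_deriv Hv.
Qed.

Lemma symbol_symbol_bound b m u : symbol b m u -> symbol_bound b m u.
Proof. by move=> /(_ 0%N)/symbol_upto_bound. Qed.

Lemma symbol_upto0 b k m : symbol_upto b k m (fun _ _ _ => 0).
Proof.
have B m' : symbol_bound b m' (fun _ _ _ => 0).
  by exists (fun=> 0) => [|e t z _ _]; [exact: growth0|rewrite normr0 mul0r].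
elim: k m => [|k IH] m; split=> // d; exists (fun _ _ _ => 0).
by split => //; exact: has_deriv_cst.
Qed.

Lemma symbol0 b m : symbol b m (fun _ _ _ => 0).
Proof. by move=> k; exact: symbol_upto0. Qed.

Lemma symbol_cst (c : R) : symbol true 0 (fun _ _ _ => c).
Proof.
move=> k; have B : symbol_bound true 0 (fun _ _ _ => c).
  by exists (fun=> `|c|) => [|e t z _ _]; [exact: moderate_cst|rewrite powRr0 mulr1].
case: k => [|k]; split => // d; exists (fun _ _ _ => 0); split; first exact: has_deriv_cst.
exact: symbol_upto0.
Qed.

Lemma symbol_uptoD b k m u u' : symbol_upto b k m u -> symbol_upto b k m u' ->
  symbol_upto b k m (fun e t z => u e t z + u' e t z).
Proof.
elim: k m u u' => [|k IH] m u u' [B H] [B' H']; split=> //; last first.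
- move=> d; have [v [Hv Sv]] := H d; have [v' [Hv' Sv']] := H' d.
  exists (fun e t z => v e t z + v' e t z); split; last exact: IH.
  exact: has_derivD.
- have [w wg Hw] := B; have [w' wg' Hw'] := B'.
  exists (fun e => w e + w' e) => [|e t z he ht]; first exact: growthD.
  by rewrite mulrDl; apply: ler_normD_bound; [exact: Hw|exact: Hw'].
- have [w wg Hw] := B; have [w' wg' Hw'] := B'.
  exists (fun e => w e + w' e) => [|e t z he ht]; first exact: growthD.
  by rewrite mulrDl; apply: ler_normD_bound; [exact: Hw|exact: Hw'].
Qed.

Lemma symbolD b m u u' : symbol b m u -> symbol b m u' ->
  symbol b m (fun e t z => u e t z + u' e t z).
Proof. by move=> S S' k; exact: symbol_uptoD. Qed.

Lemma symbol_boundM b m m' u u' : symbol_bound true m u -> symbol_bound b m' u' ->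
  symbol_bound b (m + m') (fun e t z => u e t z * u' e t z).
Proof.
move=> [w wg Hw] [w' wg' Hw'].
exists (fun e => w e * w' e) => [|e t z he ht]; first exact: growthM.
rewrite powRD; last by rewrite (gt_eqF (japanese_gt0 _)) implybT.
by rewrite mulrACA; apply: ler_normM_bound; [exact: Hw|exact: Hw'].
Qed.

(** Leibniz rule: in either term exactly one factor loses the weight of the derivative, so the total
    order drops by that weight. *)
Lemma symbol_uptoM b k m m' u u' :
  symbol_upto true k m u -> symbol_upto b k m' u' ->
  symbol_upto b k (m + m') (fun e t z => u e t z * u' e t z).
Proof.
elim: k m m' u u' => [|k IH] m m' u u' S S'; split=> //;
  try exact: symbol_boundM (symbol_upto_bound S) (symbol_upto_bound S').
move=> d; have [v [Hv Sv]] := S.2 d; have [v' [Hv' Sv']] := S'.2 d.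
eexists; split; first exact: has_derivM Hv Hv'.
apply: symbol_uptoD; first by rewrite addrAC; apply: IH => //; exact: symbol_uptoW.
by rewrite -addrA; apply: IH => //; exact: symbol_uptoW.
Qed.

Lemma symbolM b m m' u u' : symbol true m u -> symbol b m' u' ->
  symbol b (m + m') (fun e t z => u e t z * u' e t z).
Proof. by move=> S S' k; exact: symbol_uptoM. Qed.

Lemma symbolZ b m (c : R) u : symbol b m u -> symbol b m (fun e t z => c * u e t z).
Proof. by move=> S; rewrite -[m]add0r; apply: symbolM => //; exact: symbol_cst. Qed.

Lemma symbolN b m u : symbol b m u -> symbol b m (fun e t z => - u e t z).
Proof.
by move=> S; apply: symbol_ext (symbolZ (-1) S) => e t z _ _; rewrite mulN1r.
Qed.

Lemma symbolB b m u u' : symbol b m u -> symbol b m u' ->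
  symbol b m (fun e t z => u e t z - u' e t z).
Proof. by move=> S S'; apply: symbolD => //; exact: symbolN. Qed.

Lemma symbol_upto_sum (I : Type) (r : seq I) (P : pred I) b k m (u : I -> net) :
  (forall i, P i -> symbol_upto b k m (u i)) ->
  symbol_upto b k m (fun e t z => \sum_(i <- r | P i) u i e t z).
Proof.
move=> H; elim: r => [|i r IH].
  by apply: symbol_upto_ext (symbol_upto0 b k m) => e t z _ _; rewrite big_nil.
case Pi : (P i); last by apply: symbol_upto_ext IH => e t z _ _; rewrite big_cons Pi.
by apply: symbol_upto_ext (symbol_uptoD (H i Pi) IH) => e t z _ _; rewrite big_cons Pi.
Qed.

Lemma symbol_bound_near b m u e z : symbol_bound b m u -> 0 < e <= 1 ->
  exists2 K, 0 <= K & forall t z', `|t| <= T -> freq_near z z' -> `|u e t z'| <= K.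
Proof.
move=> [w wg Hw] he; have [K K0 HK] := japanese_bounded z m.
exists (w e * K) => [|t z' ht hz]; first by rewrite mulr_ge0// (growth_ge0 _ wg).
apply: le_trans (Hw _ _ _ he ht) _; rewrite ler_wpM2l ?HK//.
exact: growth_ge0 wg.
Qed.

Lemma symbol_bound_loc b m d u e z : symbol_bound b m u -> 0 < e <= 1 ->
  exists2 K, 0 <= K & forall t s z', `|t| <= T -> `|s| <= 1 ->
    z'.2 = (shift_z d s z).2 -> `|u e t z'| <= K.
Proof.
move=> B he; have [K K0 HK] := symbol_bound_near z B he.
exists K => // t s z' ht hs hz; apply: HK => // i.
by rewrite hz (le_trans (shift_z_freq _ _ _ hs))// lerD2l; lra.
Qed.

End SymbolClasses.

(** * Exponential, cosine and sine of symbols of order 0 *)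

Section Exponentials.
Context {R : realType} {n : nat}.
Variable T : R.
Hypothesis T_gt0 : 0 < T.

Notation phase := ('rV[R]_n * 'rV[R]_n)%type.
Notation net := (R -> R -> phase -> R).
Notation axis := (option ('I_n + 'I_n)).
Notation wt := (@weight R n).
Implicit Types (u v w p : net) (d : axis) (e t h s m : R) (z : phase) (b : bool).

Lemma is_derive_diff_on (f f1 : R -> R) (a b : R) :
  (forall x : R, a <= x <= b -> is_derive x 1 f (f1 x)) -> diff_on a b f f1.
Proof.
move=> H s sab eps eps0.
have [/cvg_ex[l /= fl] f1s] := H s sab.
have cl : h^-1 *: (f (h *: 1 + s) - f s) @[h --> 0^'] --> f1 s.
  by rewrite -f1s /derive; apply/cvg_ex; exists l.
move/cvgrPdist_le : cl => /(_ eps eps0)/nbhs_ballP[del /= d0 Hd].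
exists del => // r _ rs.
case: (eqVneq r s) => [->|nrs]; first by rewrite !subrr mul0r subr0 normr0 mulr0.
have rs0 : r - s != 0 by rewrite subr_eq0.
have := Hd (r - s); rewrite /ball/= sub0r normrN => /(_ rs rs0).
rewrite /GRing.scale/= mulr1 subrK distrC.
have -> : (r - s)^-1 * (f r - f s) - f1 s = (r - s)^-1 * (f r - f s - (r - s) * f1 s) by field.
by rewrite normrM normfV ler_pdivrMl ?normr_gt0// (mulrC `|_ - _|).
Qed.

Lemma taylor2_fun (f f1 f2 : R -> R) (y B : R) :
  (forall x : R, is_derive x 1 f (f1 x)) -> (forall x : R, is_derive x 1 f1 (f2 x)) ->
  0 <= B -> (exists K, forall x, `|x - y| <= B -> `|f2 x| <= K) ->
  exists K, forall x, `|x - y| <= B ->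
     `|f x - f y - (x - y) * f1 y| <= K * (x - y) ^+ 2.
Proof.
move=> H H' B0 [K HK]; exists K => x xy.
apply: (@taylor2_on _ (y - B) (y + B) f f1 f2).
- exact: is_derive_diff_on.
- exact: is_derive_diff_on.
- by move=> s /andP[s1 s2]; apply: HK; rewrite ler_norml; apply/andP; split; lra.
- by apply/andP; split; lra.
- by move: xy; rewrite ler_norml => /andP[? ?]; apply/andP; split; lra.
Qed.

Lemma has_deriv_exp d u v : has_deriv T d u v ->
  has_deriv T d (fun e t z => expR (u e t z)) (fun e t z => expR (u e t z) * v e t z).
Proof.
apply: has_deriv_comp => y B B0; apply: taylor2_fun (B0) _ => //.
exists (expR (y + B)) => x; rewrite ler_norml (ger0_norm (expR_ge0 _)) ler_expR.
by move=> /andP[_ ?]; lra.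
Qed.

Lemma has_deriv_cos d u v : has_deriv T d u v ->
  has_deriv T d (fun e t z => cos (u e t z)) (fun e t z => - sin (u e t z) * v e t z).
Proof.
apply: (@has_deriv_comp _ _ _ _ _ (fun x => - sin x)) => y B B0.
refine (@taylor2_fun _ _ (fun x => - cos x) _ _ _ _ B0 _).
by exists 1 => x _; rewrite normrN ler_norml cos_geN1 cos_le1.
Qed.

Lemma has_deriv_sin d u v : has_deriv T d u v ->
  has_deriv T d (fun e t z => sin (u e t z)) (fun e t z => cos (u e t z) * v e t z).
Proof.
apply: (@has_deriv_comp _ _ _ _ _ cos) => y B B0.
refine (@taylor2_fun _ _ (fun x => - sin x) _ _ _ _ B0 _).
by exists 1 => x _; rewrite normrN ler_norml sin_geN1 sin_le1.
Qed.

(** Each derivative of the exponential is the exponential times a derivative of [p]. The bound of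
    order zero has to be supplied: it does not follow from moderateness of [p]. *)
Lemma symbol_exp p : symbol T true 0 p ->
  symbol_bound T true 0 (fun e t z => expR (p e t z)) ->
  symbol T true 0 (fun e t z => expR (p e t z)).
Proof.
move=> S B; elim=> [|k IH]; split=> // d.
have [v [Hv Sv]] := symbol_has_deriv T_gt0 d S.
eexists; split; first exact: has_deriv_exp Hv.
by rewrite -[X in symbol_upto _ _ _ X _]add0r; apply: symbol_uptoM.
Qed.

(** The two are treated together, as they differentiate into each other; since [p] is real, both are
    bounded by 1. *)
Lemma symbol_cos_sin p : symbol T true 0 p ->
  symbol T true 0 (fun e t z => cos (p e t z)) /\
  symbol T true 0 (fun e t z => sin (p e t z)).
Proof.
move=> S.
suff H k : symbol_upto T true k 0 (fun e t z => cos (p e t z)) /\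
  symbol_upto T true k 0 (fun e t z => sin (p e t z)) by split=> k; have [] := H k.
have Bc : symbol_bound T true 0 (fun e t z => cos (p e t z)).
  exists (fun=> 1) => [|e t z _ _]; first exact: moderate_cst.
  by rewrite powRr0 mulr1 ler_norml cos_geN1 cos_le1.
have Bs : symbol_bound T true 0 (fun e t z => sin (p e t z)).
  exists (fun=> 1) => [|e t z _ _]; first exact: moderate_cst.
  by rewrite powRr0 mulr1 ler_norml sin_geN1 sin_le1.
elim: k => [|k [IHc IHs]]; first by [].
have IHs' : symbol_upto T true k 0 (fun e t z => - sin (p e t z)).
  rewrite -[0]addr0; apply: symbol_upto_ext (symbol_uptoM (symbol_cst T (-1) k) IHs).
  by move=> e t z _ _; rewrite mulN1r.
split; split=> // d; have [v [Hv Sv]] := symbol_has_deriv T_gt0 d S.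
  eexists; split; first exact: has_deriv_cos Hv.
  by rewrite -[X in symbol_upto _ _ _ X _]add0r; apply: symbol_uptoM.
eexists; split; first exact: has_deriv_sin Hv.
by rewrite -[X in symbol_upto _ _ _ X _]add0r; apply: symbol_uptoM.
Qed.

End Exponentials.

(** * Translations in x *)

Section Translation.
Context {R : realType} {n : nat}.
Variable T : R.
Hypothesis T_gt0 : 0 < T.

Notation phase := ('rV[R]_n * 'rV[R]_n)%type.
Notation net := (R -> R -> phase -> R).
Notation axis := (option ('I_n + 'I_n)).
Notation wt := (@weight R n).
Notation axis_x k := (Some (inl k)).
Implicit Types (u v w : net) (d : axis) (e t h s m : R) (z : phase) (b : bool).

(** Shifting one coordinate at a time reduces a translation in [x] to one-dimensional mean value and
    Taylor inequalities. *)
Definition move_x (r : seq 'I_n) (xi : 'I_n -> R) z : phase :=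
  foldr (fun k => shift_z (axis_x k) (xi k)) z r.

Lemma move_x2 r xi z : (move_x r xi z).2 = z.2.
Proof. by elim: r => //= k r IH; rewrite IH scaler0 add0r. Qed.

Lemma move_x_enum xi z : move_x (enum 'I_n) xi z = (z.1 + \row_k xi k, z.2).
Proof.
have H r : (move_x r xi z).1 = z.1 + \sum_(k <- r) xi k *: delta_mx 0 k.
  elim: r => [|k r IH] /=; first by rewrite big_nil addr0.
  by rewrite big_cons IH addrCA.
rewrite [LHS]surjective_pairing move_x2 H big_enum/= [\row_k _]row_sum_delta.
by congr (_ + _, _); apply: eq_bigr => k _; rewrite mxE.
Qed.

Lemma move_x_lipschitz v (vx : 'I_n -> net) e t z M (r : seq 'I_n) (xi : 'I_n -> R) :
  0 < e <= 1 -> `|t| <= T -> (forall k, has_deriv T (axis_x k) v (vx k)) ->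
  (forall k z', z'.2 = z.2 -> `|vx k e t z'| <= M) ->
  `|v e t (move_x r xi z) - v e t z| <= M * \sum_(k <- r) `|xi k|.
Proof.
move=> he ht Hv HM; elim: r => [|k r IH]; first by rewrite big_nil subrr normr0 mulr0.
rewrite big_cons mulrDr /=.
rewrite -(subrKA (v e t (move_x r xi z))).
apply: ler_normD_bound IH.
apply: (@mean_value_le _ _ T (axis_x k) v (vx k) e t (move_x r xi z) (xi k) M
  (Hv k) he ht ht) => s _ _.
by apply: HM; rewrite /= scaler0 add0r move_x2.
Qed.

(** Each coordinate adds its own quadratic remainder and the error of evaluating [ux k] after the
    other shifts. With [S] the sum for the other coordinates, [M * (|xi k| + S) ^+ 2] dominates all
    three error terms. *)
Lemma move_x_taylor u (ux : 'I_n -> net) (uxx : 'I_n -> 'I_n -> net) e t z M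
    (r : seq 'I_n) (xi : 'I_n -> R) :
  0 < e <= 1 -> `|t| <= T -> (forall k, has_deriv T (axis_x k) u (ux k)) ->
  (forall k l, has_deriv T (axis_x l) (ux k) (uxx k l)) ->
  (forall k l z', z'.2 = z.2 -> `|uxx k l e t z'| <= M) -> 0 <= M ->
  `|u e t (move_x r xi z) - u e t z - \sum_(k <- r) xi k * ux k e t z| <=
    M * (\sum_(k <- r) `|xi k|) ^+ 2.
Proof.
move=> he ht Hu Hux HM M0; elim: r => [|k r IH].
  by rewrite !big_nil subrr subr0 normr0 expr0n mulr0.
have A : `|u e t (shift_z (axis_x k) (xi k) (move_x r xi z)) - u e t (move_x r xi z)
    - xi k * ux k e t (move_x r xi z)| <= M * `|xi k| ^+ 2.
  rewrite real_normK ?num_real//.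
  apply: (@taylor2_le _ _ T (axis_x k) u (ux k) (uxx k k) e t (move_x r xi z) (xi k) M
    (Hu k) (Hux k k) he ht ht) => s _ _.
  by apply: HM; rewrite /= scaler0 add0r move_x2.
have B := move_x_lipschitz r xi he ht (Hux k) (HM k).
rewrite !big_cons /= -/(shift_z (axis_x k) _ _).
set S := \sum_(j <- r) `|xi j| in IH B *.
set u1 := u e t _ in A IH *; set u2 := u e t _ in A IH *; set u3 := u e t _ in IH *.
set s1 := \sum_(j <- r) _ in IH *.
have -> : u1 - u3 - (xi k * ux k e t z + s1) = (u1 - u2 - xi k * ux k e t (move_x r xi z))
  + (u2 - u3 - s1) + xi k * (ux k e t (move_x r xi z) - ux k e t z) by ring.
apply: (@le_trans _ _ (M * `|xi k| ^+ 2 + M * S ^+ 2 + `|xi k| * (M * S))).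
  apply: ler_normD_bound; last exact: ler_normM_bound.
  exact: ler_normD_bound.
have S0 : 0 <= S by rewrite sumr_ge0.
have := mulr_ge0 (normr_ge0 (xi k)) (mulr_ge0 M0 S0).
by rewrite sqrrD; nra.
Qed.

Variable Phi : 'I_n -> net.

Definition translate e t z : phase := (z.1 + \row_k Phi k e t z, z.2).

Definition pull (V : Type) (u : R -> R -> phase -> V) e t z : V :=
  u e t (translate e t z).

(** Shifting [(t, z)] by [h] along [d] shifts the translated point likewise and moves it in [x] by
    the increment [xi] of [Phi]. Expansion in [xi] and then in [h] keeps the remainders quadratic,
    because [xi] is O(h). *)
Lemma has_deriv_pull b m d u ud (ux : 'I_n -> net) (Phid : 'I_n -> net) :
  symbol T b m u -> has_deriv T d u ud ->
  (forall k, has_deriv T (axis_x k) u (ux k)) ->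
  (forall k, has_deriv T d (Phi k) (Phid k)) ->
  has_deriv T d (pull u)
    (fun e t z => pull ud e t z + \sum_k Phid k e t z * pull (ux k) e t z).
Proof.
move=> Su Hud Hux HPhi.
have Sux k : symbol T b (m - wt (axis_x k)) (ux k) := symbol_deriv T_gt0 Su (Hux k).
have /choice[uxx Huxx] (p : 'I_n * 'I_n) : exists w, has_deriv T (axis_x p.2) (ux p.1) w /\
    symbol T b (m - wt (axis_x p.1) - wt (axis_x p.2)) w.
  exact: symbol_has_deriv.
have /choice[uxd Huxd] (k : 'I_n) : exists w, has_deriv T d (ux k) w /\
    symbol T b (m - wt (axis_x k) - wt d) w.
  exact: symbol_has_deriv.
move=> e t z he ht; pose y := translate e t z.
have [rho [C [C0 HC]]] := has_derivP y Hud he ht.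
have /choice[M HM] (p : 'I_n * 'I_n) : exists K, 0 <= K /\
    forall t s z', `|t| <= T -> `|s| <= 1 ->
    z'.2 = (shift_z d s y).2 -> `|uxx p e t z'| <= K.
  have [K K0 HK] := symbol_bound_loc d y (symbol_symbol_bound (Huxx p).2) he.
  by exists K.
have /choice[rx Hrx] (k : 'I_n) : exists rho, exists C, 0 <= C /\
    forall h, `|h| <= 1 -> `|shift_t d h t| <= T ->
    ux k e (shift_t d h t) (shift_z d h y) =
      ux k e t y + h * uxd k e t y + h ^+ 2 * rho h /\ `|rho h| <= C.
  exact: has_derivP (Huxd k).1 he ht.
have {Hrx}/choice[Cx Hrx] := Hrx.
have /choice[rp Hrp] (k : 'I_n) : exists rho, exists C, 0 <= C /\
    forall h, `|h| <= 1 -> `|shift_t d h t| <= T ->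
    Phi k e (shift_t d h t) (shift_z d h z) =
      Phi k e t z + h * Phid k e t z + h ^+ 2 * rho h /\ `|rho h| <= C.
  exact: has_derivP (HPhi k) he ht.
have {Hrp}/choice[Cp Hrp] := Hrp.
pose M0 := \sum_p M p.
have M0_ge0 : 0 <= M0 by rewrite sumr_ge0// => p _; have [] := HM p.
have M0_ge p : M p <= M0.
  by rewrite /M0 (bigD1 p)//= lerDl sumr_ge0// => q _; have [] := HM q.
pose L := \sum_k (`|Phid k e t z| + Cp k).
(* Three contributions: the Taylor remainder in [xi], the remainder of [u] along [d], and the
   second-order part of [xi k * ux k]. *)
exists (M0 * L ^+ 2 + C + \sum_k (`|Phid k e t z| * (`|uxd k e t y| + Cx k) +
   Cp k * (`|ux k e t y| + `|uxd k e t y| + Cx k))) => h h1 hT.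
set t' := shift_t d h t; set z' := shift_z d h z.
pose xi k := Phi k e t' z' - Phi k e t z.
have xiE k : xi k = h * (Phid k e t z + h * rp k h).
  by rewrite /xi; have [_ /(_ h h1 hT)[-> _]] := Hrp k; ring.
have xib k : `|xi k| <= `|h| * (`|Phid k e t z| + Cp k).
  rewrite xiE normrM ler_wpM2l//; apply: ler_normD_bound => //.
  by rewrite -[leRHS]mul1r; apply: ler_normM_bound => //; have [_ /(_ h h1 hT)[]] := Hrp k.
pose q := shift_z d h y.
have trE : translate e t' z' = move_x (enum 'I_n) xi q.
  rewrite move_x_enum /translate /q /y /translate /z'; congr (_, _).
  - rewrite (_ : \row_k xi k = \row_k Phi k e t' z' - \row_k Phi k e t z); last first.
      by apply/rowP => k; rewrite !mxE.
    rewrite -/z'; move: (\row_k Phi k e t' z') (\row_k Phi k e t z) => X Y.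
    by rewrite /z'; case: (d) => [c|] /=; rewrite -!addrA subrKC.
  - by case: (d).
have tay := @move_x_taylor u ux (fun k l => uxx (k, l)) e t' q M0 (enum 'I_n) xi
  he hT Hux (fun k l => (Huxx (k, l)).1)
  (fun k l z0 hz => le_trans ((HM (k, l)).2 t' h z0 hT h1 hz) (M0_ge (k, l))) M0_ge0.
have sumb : (\sum_(k <- enum 'I_n) `|xi k|) ^+ 2 <= L ^+ 2 * h ^+ 2.
  rewrite -[h ^+ 2]real_normK ?num_real// -exprMn.
  rewrite lerXn2r ?nnegrE ?sumr_ge0//.
    by rewrite mulr_ge0// sumr_ge0// => k _; rewrite addr_ge0//; have [] := Hrp k.
  by rewrite big_enum/= mulrC mulr_sumr ler_sum.
have [uE rhob] := HC h h1 hT.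
rewrite -/q -/t' in uE.
rewrite {1}/pull trE.
set U := u e t' _ in tay *.
have -> : U - pull u e t z - h * (pull ud e t z + \sum_k Phid k e t z * pull (ux k) e t z) =
  (U - u e t' q - \sum_(k <- enum 'I_n) xi k * ux k e t' q) + h ^+ 2 * rho h +
  h ^+ 2 * (\sum_k (Phid k e t z * (uxd k e t y + h * rx k h) +
     rp k h * (ux k e t y + h * uxd k e t y + h ^+ 2 * rx k h))).
  rewrite uE /pull -/y big_enum/=.
  have -> : \sum_k xi k * ux k e t' q = h * \sum_k Phid k e t z * ux k e t y +
     h ^+ 2 * (\sum_k (Phid k e t z * (uxd k e t y + h * rx k h) +
     rp k h * (ux k e t y + h * uxd k e t y + h ^+ 2 * rx k h))).
    rewrite !mulr_sumr -big_split/=; apply: eq_bigr => k _.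
    by rewrite xiE; have [_ /(_ h h1 hT)[-> _]] := Hrx k; ring.
  ring.
rewrite mulrDl mulrDl; apply: ler_normD_bound; first apply: ler_normD_bound.
- by apply: le_trans tay _; rewrite -mulrA ler_wpM2l.
- by rewrite mulrC normrM (ger0_norm (sqr_ge0 h)) ler_wpM2r// sqr_ge0.
- rewrite mulrC normrM (ger0_norm (sqr_ge0 h)) ler_wpM2r ?sqr_ge0//.
  apply: le_trans (ler_norm_sum _ _ _) _; apply: ler_sum => k _.
  have [Cx0 /(_ h h1 hT)[_ rxb]] := Hrx k.
  have [Cp0 /(_ h h1 hT)[_ rpb]] := Hrp k.
  have A : `|h * rx k h| <= Cx k.
    by rewrite -[leRHS]mul1r; apply: ler_normM_bound.
  have B : `|h ^+ 2 * rx k h| <= Cx k.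
    by rewrite expr2 -mulrA -[leRHS]mul1r; apply: ler_normM_bound.
  have D : `|h * uxd k e t y| <= `|uxd k e t y|.
    by rewrite -[leRHS]mul1r; apply: ler_normM_bound.
  by repeat first [assumption | apply: lexx | apply: ler_normD_bound | apply: ler_normM_bound].
Qed.

(** The translation leaves the frequency, hence the weight, unchanged. In the chain rule [Phid]
    already has order [- wt d], and an [x] derivative of [u] costs no order. *)
Lemma symbol_pull b m u : (forall k, symbol T true 0 (Phi k)) ->
  symbol T b m u -> symbol T b m (pull u).
Proof.
move=> SPhi Su k; elim: k m u Su => [|k IH] m u Su.
  split=> //; have [w wg Hw] := symbol_symbol_bound Su.
  by exists w => // e t z he ht; exact: (Hw e t (translate e t z)).
split=> [|d].
  have [w wg Hw] := symbol_symbol_bound Su.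
  by exists w => // e t z he ht; exact: (Hw e t (translate e t z)).
have [ud [Hud Sud]] := symbol_has_deriv T_gt0 d Su.
have /choice[ux Hux] (j : 'I_n) := symbol_has_deriv T_gt0 (axis_x j) Su.
have /choice[Phid HPhid] (j : 'I_n) := symbol_has_deriv T_gt0 d (SPhi j).
eexists; split.
  by apply: (has_deriv_pull Su Hud) => j; [exact: (Hux j).1|exact: (HPhid j).1].
apply: symbol_uptoD; first exact: IH.
apply: symbol_upto_sum => j _.
have -> : m - wt d = (0 - wt d) + (m - wt (axis_x j)) by rewrite /=; ring.
by apply: symbol_uptoM; [exact: (HPhid j).2|apply: IH; exact: (Hux j).2].
Qed.

End Translation.

(** * Primitives in time *)

Section Primitive.
Context {R : realType} {n : nat}.
Variable T : R.
Hypothesis T_gt0 : 0 < T.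

Notation phase := ('rV[R]_n * 'rV[R]_n)%type.
Notation net := (R -> R -> phase -> R).
Notation axis := (option ('I_n + 'I_n)).
Notation wt := (@weight R n).
Implicit Types (u v w : net) (d : axis) (e t h s m : R) (z : phase) (b : bool).

(** Gives a constant continuation outside [-T, T], so that the fundamental theorem of calculus can
    treat the end points as interior points. *)
Definition clamp s : R := Num.max (- T) (Num.min s T).

Lemma clamp_bound s : - T <= clamp s <= T.
Proof.
rewrite /clamp le_max lexx /= ge_max ge_min lexx orbT andbT.
by have := T_gt0; lra.
Qed.

Lemma clampE s : - T <= s <= T -> clamp s = s.
Proof. by move=> /andP[s1 s2]; rewrite /clamp min_l// max_r. Qed.

Lemma clamp_lipschitz s s' : `|clamp s - clamp s'| <= `|s - s'|.
Proof.
wlog ss : s s' / s <= s'.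
  move=> H; have [|/ltW] := leP s s'; first exact: H.
  by rewrite distrC (distrC s); exact: H.
rewrite distrC (distrC s) (ger0_norm (_ : 0 <= s' - s)) ?subr_ge0//.
have := T_gt0; rewrite /clamp.
case: (lerP s T) => ?; case: (lerP s' T) => ? ?.
- case: (lerP (- T) s) => ?; case: (lerP (- T) s') => ?; rewrite ger0_norm; lra.
- case: (lerP (- T) s) => ?; case: (lerP (- T) T) => ?; rewrite ger0_norm; lra.
- by exfalso; lra.
- by rewrite subrr normr0; lra.
Qed.

(** The integral from 0 to [t] for both signs of [t]: a common lower limit is used because an
    interval with reversed ends is empty, and it lies left of -T so that -T becomes interior. *)
Definition primitive (f : R -> R) t : R :=
  (\int[lebesgue_measure]_(x in `[- T - 1, t]) f (clamp x) -
   \int[lebesgue_measure]_(x in `[- T - 1, 0]) f (clamp x))%R.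

Lemma primitive0 f : primitive f 0 = 0.
Proof. by rewrite /primitive subrr. Qed.

Lemma eq_primitive f g t : (forall s, - T <= s <= T -> f s = g s) ->
  primitive f t = primitive g t.
Proof.
move=> fg; rewrite /primitive; have -> : (fun x => f (clamp x)) = (fun x => g (clamp x)).
  by apply/funext => x; exact: fg (clamp_bound x).
by [].
Qed.

Lemma primitive_diff_on f K :
  (forall s s', - T <= s <= T -> - T <= s' <= T -> `|f s - f s'| <= K * `|s - s'|) ->
  diff_on (- T) T (primitive f) f.
Proof.
move=> fK.
have K0 : 0 <= `|K| by [].
have fK' x y : `|f (clamp x) - f (clamp y)| <= `|K| * `|x - y|.
  apply: le_trans (fK _ _ (clamp_bound x) (clamp_bound y)) _.
  apply: (@le_trans _ _ (`|K| * `|clamp x - clamp y|)).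
    by rewrite ler_wpM2r// ler_norm.
  by rewrite ler_wpM2l// clamp_lipschitz.
have cf : continuous (f \o clamp).
  move=> x; apply/cvgrPdist_le => eps eps0.
  near=> y => /=; apply: le_trans (fK' x y) _.
  apply: (@le_trans _ _ ((`|K| + 1) * `|x - y|)); first by rewrite ler_wpM2r//; lra.
  rewrite mulrC -ler_pdivlMr; last by lra.
  near: y; apply/nbhs_ballP; exists (eps / (`|K| + 1)) => [|y]/=.
    by rewrite divr_gt0//; lra.
  by rewrite /ball/= => /ltW.
apply: is_derive_diff_on => s sT; have /andP[s1 s2] := sT.
pose F y := (\int[lebesgue_measure]_(x in `[- T - 1, y]) f (clamp x))%R.
have [Fd Fs] : derivable F s 1 /\ derive1 F s = f (clamp s).
  apply: (@continuous_FTC1_closed _ (f \o clamp) (- T - 1) s (T + 1)).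
  - by lra.
  - apply: continuous_compact_integrable; first exact: segment_compact.
    exact: continuous_subspaceT.
  - by lra.
  - exact: cf.
have {}Fs : derive1 F s = f s by rewrite Fs; congr f; exact: clampE.
have -> : primitive f = F - cst (F 0) by [].
move: F Fd Fs => F Fd Fs.
have := @is_deriveB _ _ _ F (cst (F 0)) s 1 (f s) 0.
rewrite subr0; apply.
by constructor; [exact: Fd|rewrite -derive1E; exact: Fs].
Unshelve. all: by end_near. Qed.

Definition prim u e t z : R := primitive (fun s => u e s z) t.

Lemma has_deriv_time u v e z : has_deriv T None u v -> 0 < e <= 1 ->
  diff_on (- T) T (fun s => u e s z) (fun s => v e s z).
Proof.
move=> H he.
have := @has_deriv_curve _ _ T None u v e 0 z (- T) T H he.
have E w : (fun s => w e (shift_t (None : axis) s 0) (shift_z None s z)) = (fun s => w e s z).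
  by apply/funext => s; rewrite /shift_t/= add0r.
by rewrite !E; apply=> s sT; rewrite /shift_t add0r ler_norml.
Qed.

Lemma norm_itv t : (`|t| <= T) = (- T <= t <= T).
Proof. by rewrite ler_norml. Qed.

Lemma symbol_bound_loc0 b m u e z : symbol_bound T b m u -> 0 < e <= 1 ->
  exists2 K, 0 <= K & forall s, - T <= s <= T -> `|u e s z| <= K.
Proof.
move=> B he; have [K K0 HK] := symbol_bound_loc None z B he; exists K => // s sT.
by apply: (HK s 0); rewrite ?norm_itv ?normr0.
Qed.

(** For fixed [e] and [z] the time derivative of [u] is bounded, so the integrand is Lipschitz in
    time. *)
Lemma prim_diff_on b m u e z : symbol T b m u -> 0 < e <= 1 ->
  diff_on (- T) T (fun s => prim u e s z) (fun s => u e s z).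
Proof.
move=> Su he; have [v [Hv Sv]] := symbol_has_deriv T_gt0 None Su.
have [K K0 HK] := symbol_bound_loc0 z (symbol_symbol_bound Sv) he.
apply: (@primitive_diff_on _ K) => s s' hs hs'.
exact: mean_value_on (has_deriv_time z Hv he) HK hs' hs.
Qed.

Lemma prim0 u e z : prim u e 0 z = 0.
Proof. exact: primitive0. Qed.

Lemma itv0 : - T <= 0 <= T.
Proof. by have := T_gt0; move=> ?; apply/andP; split; lra. Qed.

Lemma has_deriv_prim_time b m u : symbol T b m u -> has_deriv T None (prim u) u.
Proof.
move=> Su e t z he ht; have [v [Hv Sv]] := symbol_has_deriv T_gt0 None Su.
have [K K0 HK] := symbol_bound_loc0 z (symbol_symbol_bound Sv) he.
exists K => h h1 hT; have := @taylor2_on _ _ _ _ _ _ K t (t + h)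
  (prim_diff_on z Su he) (has_deriv_time z Hv he) HK.
by rewrite -!norm_itv (addrC t) addrK addrC; apply.
Qed.

Lemma prim_le b m u e z K t : symbol T b m u -> 0 < e <= 1 -> `|t| <= T ->
  (forall s, `|s| <= T -> `|u e s z| <= K) -> `|prim u e t z| <= K * T.
Proof.
move=> Su he ht HK.
have HK' s : - T <= s <= T -> `|u e s z| <= K by rewrite -norm_itv; exact: HK.
have tT : - T <= t <= T by rewrite -norm_itv.
have := mean_value_on (prim_diff_on z Su he) HK' itv0 tT; rewrite prim0 !subr0 => A; apply: le_trans A _; rewrite ler_wpM2l//.
exact: le_trans (HK t ht).
Qed.

(** Differentiation under the integral: the remainder for the primitives vanishes at time 0, and its
    time derivative is the remainder for [u], at most [K * h ^+ 2] at all times. *)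
Lemma has_deriv_prim_space b m c u v : symbol T b m u -> has_deriv T (Some c) u v ->
  has_deriv T (Some c) (prim u) (prim v).
Proof.
move=> Su Hv e t z he ht.
have Sv := symbol_deriv T_gt0 Su Hv.
have [w [Hw Sw]] := symbol_has_deriv T_gt0 (Some c) Sv.
have [K K0 HK] := symbol_bound_loc (Some c) z (symbol_symbol_bound Sw) he.
exists (K * T) => h h1 _ /=; set z' := h *: dir c + z.
have D := diff_on_sub (diff_on_sub (prim_diff_on z' Su he) (prim_diff_on z Su he))
  (diff_on_scale h (prim_diff_on z Sv he)).
have B s : - T <= s <= T -> `|u e s z' - u e s z - h * v e s z| <= K * h ^+ 2.
  rewrite -norm_itv => sT.
  apply: (@taylor2_le _ _ T (Some c) u v w e s z h K Hv Hw he sT sT) => r rh _.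
  exact: (HK s r) (le_trans rh h1) _.
have tT : - T <= t <= T by rewrite -norm_itv.
have := mean_value_on D B itv0 tT; rewrite !prim0 mulr0 !subr0 => A; apply: le_trans A _.
by rewrite [leRHS]mulrAC ler_wpM2l// mulr_ge0// sqr_ge0.
Qed.

Lemma symbol_prim b m u : symbol T b m u -> symbol T b m (prim u).
Proof.
move=> Su k; elim: k m u Su => [|k IH] m u Su.
  split=> //; have [w wg Hw] := symbol_symbol_bound Su.
  exists (fun e => T * w e) => [|e t z he ht]; first by apply: growthZ => //; exact: ltW.
  by rewrite -mulrA [leRHS]mulrC; apply: (prim_le Su he ht) => s hs; exact: Hw.
split=> [|[c|]].
- have [w wg Hw] := symbol_symbol_bound Su.
  exists (fun e => T * w e) => [|e t z he ht]; first by apply: growthZ => //; exact: ltW.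
  by rewrite -mulrA [leRHS]mulrC; apply: (prim_le Su he ht) => s hs; exact: Hw.
- have [v [Hv Sv]] := symbol_has_deriv T_gt0 (Some c) Su.
  by exists (prim v); split; [exact: has_deriv_prim_space Hv|exact: IH].
- by exists u; split; [exact: has_deriv_prim_time Su|rewrite subr0; exact: Su].
Qed.

End Primitive.

(** * Symmetry of second derivatives of symbols *)

Section Commutation.
Context {R : realType} {n : nat}.
Variable T : R.
Hypothesis T_gt0 : 0 < T.

Notation phase := ('rV[R]_n * 'rV[R]_n)%type.
Notation net := (R -> R -> phase -> R).
Notation axis := (option ('I_n + 'I_n)).
Notation wt := (@weight R n).
Implicit Types (u v w : net) (c d : axis) (e t h s r m : R) (z : phase) (b : bool).

Lemma shift_tC c d r s t :
  shift_t c r (shift_t d s t) = shift_t d s (shift_t c r t) :> R.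
Proof. by case: c => [c|]; case: d => [d|] //=; rewrite addrAC. Qed.

Lemma shift_zC c d r s z : shift_z c r (shift_z d s z) = shift_z d s (shift_z c r z).
Proof. by case: c => [c|]; case: d => [d|] //=; rewrite addrCA. Qed.

(** The interval from [lower] to [upper] consists of increments admissible at [t]; for directions in
    phase space, -1 and 1 are an arbitrary choice. *)
Definition lower d t : R := if d is None then - T - t else -1.
Definition upper d t : R := if d is None then T - t else 1.

Lemma lower_le0 d t : `|t| <= T -> lower d t <= 0 <= upper d t.
Proof.
by case: d => [d|]; rewrite /lower /upper ler_norml => /andP[? ?]; apply/andP; split; lra.
Qed.

Lemma lower_lt d t : lower d t < upper d t.
Proof. by have := T_gt0; case: d => [d|]; rewrite /lower /upper; lra. Qed.

Lemma shift_t_le2 c d t s r : c != d -> `|t| <= T -> lower c t <= s <= upper c t ->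
  lower d t <= r <= upper d t -> `|shift_t c s (shift_t d r t)| <= T.
Proof.
case: c => [c|]; case: d => [d|] //=.
- by rewrite addrC !ler_norml => _ _ _ /andP[? ?]; apply/andP; split; lra.
- by rewrite addrC !ler_norml => _ _ /andP[? ?] _; apply/andP; split; lra.
Qed.

(** [schwarz] on the rectangle of shifts along [c] and [d]; the mixed derivatives are continuous
    because their own derivatives are locally bounded. *)
Lemma has_deriv_commute b m u c d uc ud ucd udc : symbol T b m u ->
  has_deriv T c u uc -> has_deriv T d u ud ->
  has_deriv T d uc ucd -> has_deriv T c ud udc -> eq_on T ucd udc.
Proof.
move=> Su Hc Hd Hcd Hdc.
(* Two admissible time shifts may add up to one leaving [-T, T], so equal directions are settled
   apart, by uniqueness. *)
have [cd|cd] := eqVneq c d.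
  rewrite {}cd in Hc Hdc; have E := has_deriv_unique T_gt0 Hc Hd.
  exact: has_deriv_unique T_gt0 (has_deriv_ext E (@eq_on_refl _ _ _ _ _) Hcd) Hdc.
move=> e t z he ht.
pose P w s r := w e (shift_t c s (shift_t d r t)) (shift_z c s (shift_z d r z)).
have cont v m' : symbol T b m' v ->
    continuous_on2 (lower c t) (upper c t) (lower d t) (upper d t) (P v).
  move=> Sv eps eps0.
  have [vc [Hvc Svc]] := symbol_has_deriv T_gt0 c Sv.
  have [vd [Hvd Svd]] := symbol_has_deriv T_gt0 d Sv.
  have [K K0 HK] := symbol_bound_near z (symbol_symbol_bound Svc) he.
  have [K' K'0 HK'] := symbol_bound_near z (symbol_symbol_bound Svd) he.
  have k0 : 0 < K + K' + 1 by lra.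
  exists (Num.min 1 (eps / (K + K' + 1))) => [|s r hs hr].
    by rewrite lt_min ltr01 divr_gt0.
  rewrite !le_min !ler_pdivlMr// => /andP[s1 se] /andP[r1 re].
  have tr : `|shift_t d r t| <= T.
    by have := shift_t_le2 cd ht (lower_le0 c ht) hr; rewrite shift_t0.
  have tsr := shift_t_le2 cd ht hs hr.
  have A : `|v e (shift_t c s (shift_t d r t)) (shift_z c s (shift_z d r z)) -
      v e (shift_t d r t) (shift_z d r z)| <= K * `|s|.
    apply: mean_value_le Hvc he tr tsr _ => x xs tx; apply: HK => // i.
    apply: le_trans (shift_z_freq _ _ _ (le_trans xs s1)) _.
    by have := shift_z_freq d z i r1; lra.
  have B : `|v e (shift_t d r t) (shift_z d r z) - v e t z| <= K' * `|r|.
    apply: mean_value_le Hvd he ht tr _ => x xr tx; apply: HK' => // i.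
    by have := shift_z_freq d z i (le_trans xr r1); lra.
  rewrite /P !shift_t0 !shift_z0 -(subrKA (v e (shift_t d r t) (shift_z d r z))).
  apply: le_trans (ler_normD_bound A B) _.
  have := normr_ge0 s; have := normr_ge0 r; nra.
have Sc := symbol_deriv T_gt0 Su Hc; have Sd := symbol_deriv T_gt0 Su Hd.
have Scd := symbol_deriv T_gt0 Sc Hcd; have Sdc := symbol_deriv T_gt0 Sd Hdc.
have along1 v v' (H : has_deriv T c v v') r : lower d t <= r <= upper d t ->
    diff_on (lower c t) (upper c t) ((P v)^~ r) ((P v')^~ r).
  by move=> hr; apply: has_deriv_curve H he _ => s hs; exact: shift_t_le2.
have along2 v v' (H : has_deriv T d v v') s : lower c t <= s <= upper c t ->
    diff_on (lower d t) (upper d t) (P v s) (P v' s).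
  move=> hs; have E w : P w s = fun r =>
      w e (shift_t d r (shift_t c s t)) (shift_z d r (shift_z c s z)).
    by apply/funext => r; rewrite /P shift_tC shift_zC.
  rewrite !E; apply: has_deriv_curve H he _ => r hr.
  by rewrite shift_tC; exact: shift_t_le2.
have := @schwarz _ _ _ _ _ (P u) (P uc) (P ud) (P ucd) (P udc) (lower_le0 c ht)
  (lower_lt c t) (lower_le0 d ht) (lower_lt d t) (along1 _ _ Hc) (along2 _ _ Hcd)
  (along2 _ _ Hd) (along1 _ _ Hdc) (cont _ _ Scd) (cont _ _ Sdc).
by rewrite /P !shift_t0 !shift_z0.
Qed.

End Commutation.

(** * Complex nets *)

Section ComplexNets.
Context {R : realType} {n : nat}.
Variable T : R.
Hypothesis T_gt0 : 0 < T.

Notation phase := ('rV[R]_n * 'rV[R]_n)%type.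
Notation net := (R -> R -> phase -> R).
Notation cnet := (R -> R -> phase -> R[i]).
Notation axis := (option ('I_n + 'I_n)).
Notation wt := (@weight R n).
Implicit Types (u v w : cnet) (c d : axis) (e t h s r m : R) (z : phase) (b : bool).

Definition re_net u : net := fun e t z => Re (u e t z).
Definition im_net u : net := fun e t z => Im (u e t z).

Definition c_has_deriv d u v :=
  has_deriv T d (re_net u) (re_net v) /\ has_deriv T d (im_net u) (im_net v).

Definition csymbol b m u := symbol T b m (re_net u) /\ symbol T b m (im_net u).

Lemma csymbol_ext b m u v : eq_on T u v -> csymbol b m u -> csymbol b m v.
Proof.
move=> uv [Sr Si]; split; [apply: symbol_ext Sr|apply: symbol_ext Si];
by move=> e t z he ht; rewrite /re_net /im_net uv.
Qed.

Lemma Re_addc (x y : R[i]) : Re (x + y) = Re x + Re y. Proof. by case: x; case: y. Qed.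
Lemma Im_addc (x y : R[i]) : Im (x + y) = Im x + Im y. Proof. by case: x; case: y. Qed.
Lemma Re_oppc (x : R[i]) : Re (- x) = - Re x. Proof. by case: x. Qed.
Lemma Im_oppc (x : R[i]) : Im (- x) = - Im x. Proof. by case: x. Qed.
Lemma Re_mulc (x y : R[i]) : Re (x * y) = Re x * Re y - Im x * Im y.
Proof. by case: x; case: y. Qed.
Lemma Im_mulc (x y : R[i]) : Im (x * y) = Re x * Im y + Im x * Re y.
Proof. by case: x; case: y. Qed.
Lemma eq_complexP (x y : R[i]) : Re x = Re y -> Im x = Im y -> x = y.
Proof. by case: x => a b; case: y => a' b' /= -> ->. Qed.

Lemma csymbolD b m u v : csymbol b m u -> csymbol b m v ->
  csymbol b m (fun e t z => u e t z + v e t z).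
Proof.
move=> [ur ui] [vr vi]; split; [apply: symbol_ext (symbolD ur vr)|apply: symbol_ext (symbolD ui vi)];
by move=> e t z _ _; rewrite /re_net /im_net ?Re_addc ?Im_addc.
Qed.

Lemma csymbolN b m u : csymbol b m u -> csymbol b m (fun e t z => - u e t z).
Proof.
move=> [ur ui]; split; [apply: symbol_ext (symbolN ur)|apply: symbol_ext (symbolN ui)];
by move=> e t z _ _; rewrite /re_net /im_net ?Re_oppc ?Im_oppc.
Qed.

Lemma csymbolB b m u v : csymbol b m u -> csymbol b m v ->
  csymbol b m (fun e t z => u e t z - v e t z).
Proof. by move=> Su Sv; apply: csymbolD => //; exact: csymbolN. Qed.

Lemma csymbolM b m m' u v : csymbol true m u -> csymbol b m' v ->
  csymbol b (m + m') (fun e t z => u e t z * v e t z).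
Proof.
move=> [ur ui] [vr vi]; split.
  apply: symbol_ext (symbolB (symbolM ur vr) (symbolM ui vi)) => e t z _ _.
  by rewrite /re_net Re_mulc.
apply: symbol_ext (symbolD (symbolM ur vi) (symbolM ui vr)) => e t z _ _.
by rewrite /im_net Im_mulc.
Qed.

Lemma csymbol0 b m : csymbol b m (fun _ _ _ => 0).
Proof. by split; exact: symbol0. Qed.

Lemma csymbol_cst (k : R[i]) : csymbol true 0 (fun _ _ _ => k).
Proof. by split; exact: symbol_cst. Qed.

Lemma csymbol_sum (I : Type) (r : seq I) (P : pred I) b m (u : I -> cnet) :
  (forall i, P i -> csymbol b m (u i)) ->
  csymbol b m (fun e t z => \sum_(i <- r | P i) u i e t z).
Proof.
move=> H; elim: r => [|i r IH].
  by apply: csymbol_ext (csymbol0 b m) => e t z _ _; rewrite big_nil.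
case Pi : (P i); last by apply: csymbol_ext IH => e t z _ _; rewrite big_cons Pi.
by apply: csymbol_ext (csymbolD (H i Pi) IH) => e t z _ _; rewrite big_cons Pi.
Qed.

Lemma csymbol_has_deriv b m d u : csymbol b m u ->
  exists v, c_has_deriv d u v /\ csymbol b (m - wt d) v.
Proof.
move=> [ur ui].
have [vr [Hr Sr]] := symbol_has_deriv T_gt0 d ur.
have [vi [Hi Si]] := symbol_has_deriv T_gt0 d ui.
by exists (fun e t z => (vr e t z +i* vi e t z)%C).
Qed.

Lemma csymbol_deriv b m d u v : csymbol b m u -> c_has_deriv d u v ->
  csymbol b (m - wt d) v.
Proof. by move=> [ur ui] [hr hi]; split; [exact: symbol_deriv hr|exact: symbol_deriv hi]. Qed.

Lemma c_has_deriv_ext d u u' v v' : eq_on T u u' -> eq_on T v v' ->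
  c_has_deriv d u v -> c_has_deriv d u' v'.
Proof.
move=> uu vv [hr hi]; split; [apply: has_deriv_ext hr|apply: has_deriv_ext hi];
by move=> e t z he ht; rewrite /re_net /im_net ?uu ?vv.
Qed.

Lemma c_has_derivD d u u' v v' : c_has_deriv d u v -> c_has_deriv d u' v' ->
  c_has_deriv d (fun e t z => u e t z + u' e t z) (fun e t z => v e t z + v' e t z).
Proof.
move=> [hr hi] [hr' hi']; split; [apply: has_deriv_ext (has_derivD hr hr')|
  apply: has_deriv_ext (has_derivD hi hi')];
by move=> e t z he ht; rewrite /re_net /im_net ?Re_addc ?Im_addc.
Qed.

Lemma has_derivN d (u v : net) : has_deriv T d u v ->
  has_deriv T d (fun e t z => - u e t z) (fun e t z => - v e t z).
Proof.
move=> H; apply: has_deriv_ext (has_derivM (has_deriv_cst d (-1)) H) => e t z _ _;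
by rewrite ?mul0r ?add0r mulN1r.
Qed.

Lemma c_has_derivN d u v : c_has_deriv d u v ->
  c_has_deriv d (fun e t z => - u e t z) (fun e t z => - v e t z).
Proof.
move=> [hr hi]; split; [apply: has_deriv_ext (has_derivN hr)|
  apply: has_deriv_ext (has_derivN hi)];
by move=> e t z he ht; rewrite /re_net /im_net ?Re_oppc ?Im_oppc.
Qed.

Lemma c_has_derivM d u u' v v' : c_has_deriv d u v -> c_has_deriv d u' v' ->
  c_has_deriv d (fun e t z => u e t z * u' e t z)
                (fun e t z => v e t z * u' e t z + u e t z * v' e t z).
Proof.
move=> [hr hi] [hr' hi']; split.
  apply: has_deriv_ext (has_derivD (has_derivM hr hr') (has_derivN (has_derivM hi hi')));
  by move=> e t z he ht; rewrite /re_net /im_net ?Re_addc ?Re_mulc //; ring.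
apply: has_deriv_ext (has_derivD (has_derivM hr hi') (has_derivM hi hr'));
by move=> e t z he ht; rewrite /re_net /im_net ?Im_addc ?Im_mulc //; ring.
Qed.

Lemma c_has_deriv_commute b m u c d uc ud ucd udc : csymbol b m u ->
  c_has_deriv c u uc -> c_has_deriv d u ud ->
  c_has_deriv d uc ucd -> c_has_deriv c ud udc -> eq_on T ucd udc.
Proof.
move=> [Sr Si] [? ?] [? ?] [? ?] [? ?] e t z he ht; apply: eq_complexP.
  by apply: (@has_deriv_commute _ _ _ T_gt0 _ _ (re_net u) c d (re_net uc) (re_net ud)
    (re_net ucd) (re_net udc)) => //; exact: Sr.
by apply: (@has_deriv_commute _ _ _ T_gt0 _ _ (im_net u) c d (im_net uc) (im_net ud)
    (im_net ucd) (im_net udc)) => //; exact: Si.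
Qed.

(** The limits that define [time_deriv] can be identified only along a proper filter: there must be
    arbitrarily small nonzero admissible increments. *)
Lemma increments_proper t : `|t| <= T -> ProperFilter (increments T t).
Proof.
move=> ht; split; last by rewrite /increments; exact: within_filter.
rewrite /increments /within /= => /nbhs_ballP[x /= x0 H].
have [h [h0 h1 hx hT]] := small_increment (None : axis) T_gt0 ht (divr_gt0 x0 (ltr0n _ 2)).
have := H h; rewrite /ball/= sub0r normrN; apply => //.
  by apply: le_lt_trans hx _; lra.
by rewrite /= in_itv/= -ler_norml.
Qed.

Lemma near_increments t (x : R) : 0 < x ->
  \forall h \near increments T t, [/\ `|h| <= x, h != 0 & `|t + h| <= T].
Proof.
move=> x0; rewrite /increments near_withinE; near=> h.
rewrite /= in_itv/= -ler_norml => hT; split => //.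
  by near: h; apply: dnbhs0_le.
by near: h; exact: nbhs_dnbhs_neq.
Unshelve. all: by end_near. Qed.

Lemma quotient_le (a h x C eps : R) : h != 0 -> `|h| <= eps / (`|C| + 1) -> 0 < eps ->
  `|a - h * x| <= C * h ^+ 2 -> `|x - h^-1 * a| <= eps.
Proof.
move=> h0 hh eps0 A.
have C0 : 0 < `|C| + 1 by have := normr_ge0 C; lra.
have -> : x - h^-1 * a = - (h^-1 * (a - h * x)) by field.
rewrite normrN normrM normfV ler_pdivrMl ?normr_gt0//.
apply: le_trans A _; rewrite -(real_normK (num_real h)) expr2 mulrA mulrC.
rewrite ler_wpM2l//; move: hh; rewrite ler_pdivlMr// => hh; apply: le_trans hh.
by rewrite mulrC ler_wpM2l//; have := ler_norm C; lra.
Qed.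

Lemma has_deriv_cvg_time (u v : net) e t z : has_deriv T None u v -> 0 < e <= 1 ->
  `|t| <= T ->
  (h^-1 * (u e (t + h) z - u e t z)) @[h --> increments T t] --> v e t z.
Proof.
move=> H he ht; have [C HC] := H e t z he ht.
have C0 : 0 < `|C| + 1 by have := normr_ge0 C; lra.
have F := increments_proper ht.
apply/cvgrPdist_le => eps eps0.
have x0 : 0 < Num.min 1 (eps / (`|C| + 1)) by rewrite lt_min ltr01 divr_gt0.
have := near_increments t x0; apply: filterS => h.
rewrite le_min => -[/andP[h1 hx] h0 hT].
exact: quotient_le h0 hx eps0 (HC h h1 hT).
Qed.

Lemma has_deriv_is_derive (u v : net) (c : 'I_n + 'I_n) e t z : has_deriv T (Some c) u v -> 0 < e <= 1 ->
  `|t| <= T -> is_derive z (dir c) (u e t) (v e t z).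
Proof.
move=> H he ht; have [C HC] := H e t z he ht.
have C0 : 0 < `|C| + 1 by have := normr_ge0 C; lra.
have cv : h^-1 *: (u e t (h *: dir c + z) - u e t z) @[h --> (0:R)^'] --> v e t z.
  apply/cvgrPdist_le => eps eps0.
  have x0 : 0 < Num.min 1 (eps / (`|C| + 1)) by rewrite lt_min ltr01 divr_gt0.
  near=> h.
  have h0 : h != 0 by near: h; exact: nbhs_dnbhs_neq.
  have : `|h| <= Num.min 1 (eps / (`|C| + 1)) by near: h; apply: dnbhs0_le.
  rewrite le_min => /andP[h1 hx].
  exact: quotient_le h0 hx eps0 (HC h h1 ht).
constructor; first by apply: (cvgP (v e t z)); exact: cv.
by apply: (cvg_lim (@Rhausdorff R)); exact: cv.
Unshelve. all: by end_near. Qed.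

(** The pointwise derivatives of the definitions, as total operators on nets; [c_has_deriv_pderiv]
    shows that on symbols they are derivatives. *)
Definition pderiv d u : cnet := if d is Some c
  then fun e t => deriv_along (dir c) (u e t) else fun e => time_deriv T (u e).

Lemma c_has_deriv_pderivE d u v : c_has_deriv d u v -> eq_on T v (pderiv d u).
Proof.
case: d => [c|] [hr hi] e t z he ht; apply: eq_complexP => /=.
- by have [_ E] := has_deriv_is_derive z hr he ht; exact: esym E.
- by have [_ E] := has_deriv_is_derive z hi he ht; exact: esym E.
- have F := increments_proper ht; rewrite /time_deriv /=; apply/esym.
  have C := @has_deriv_cvg_time _ _ e t z hr he ht.
  have X := cvg_lim (@Rhausdorff R) C; exact: X.
- have F := increments_proper ht; rewrite /time_deriv /=; apply/esym.
  have C := @has_deriv_cvg_time _ _ e t z hi he ht.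
  have X := cvg_lim (@Rhausdorff R) C; exact: X.
Qed.

Lemma c_has_deriv_pderiv b m d u : csymbol b m u -> c_has_deriv d u (pderiv d u).
Proof.
move=> Su; have [v [Hv _]] := csymbol_has_deriv d Su.
exact: c_has_deriv_ext (@eq_on_refl _ _ _ _ _) (c_has_deriv_pderivE Hv) Hv.
Qed.

Lemma csymbol_pderiv b m d u : csymbol b m u -> csymbol b (m - wt d) (pderiv d u).
Proof. by move=> Su; exact: csymbol_deriv (c_has_deriv_pderiv d Su). Qed.

Lemma pderivC b m c d u : csymbol b m u ->
  eq_on T (pderiv d (pderiv c u)) (pderiv c (pderiv d u)).
Proof.
move=> Su; apply: (c_has_deriv_commute Su (c_has_deriv_pderiv c Su) (c_has_deriv_pderiv d Su)).
  exact: c_has_deriv_pderiv (csymbol_pderiv c Su).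
exact: c_has_deriv_pderiv (csymbol_pderiv d Su).
Qed.

Lemma pderiv_ext b m d u u' : csymbol b m u -> eq_on T u u' ->
  eq_on T (pderiv d u) (pderiv d u').
Proof.
move=> Su uu; have H := c_has_deriv_pderiv d Su.
exact: c_has_deriv_pderivE (c_has_deriv_ext uu (@eq_on_refl _ _ _ _ _) H).
Qed.

End ComplexNets.

(** * Iterated derivatives as words of coordinate directions *)

Section Words.
Context {R : realType} {n : nat}.

Notation phase := ('rV[R]_n * 'rV[R]_n)%type.
Implicit Types (s : seq ('I_n + 'I_n)) (a : phase -> R[i]).

Definition cderiv s a : phase -> R[i] := foldr (fun c => deriv_along (dir c)) a s.

Definition nfreq s : nat := count (fun c => if c is inr _ then true else false) s.

(** The eta letters stand first because [foldr] applies the last letter first. *)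
Definition word_of (alpha beta : 'I_n -> nat) : seq ('I_n + 'I_n) :=
  flatten [seq nseq (alpha i) (inr i) | i <- enum 'I_n] ++
  flatten [seq nseq (beta i) (inl i) | i <- enum 'I_n].

Lemma foldr_flatten_nseq (A B I : Type) (G : B -> A -> A) (k : I -> nat) (f : I -> B)
    (x : A) (l : seq I) :
  foldr (fun i => iter (k i) (G (f i))) x l =
  foldr G x (flatten [seq nseq (k i) (f i) | i <- l]).
Proof.
elim: l => //= i l ->; rewrite foldr_cat; set y := foldr _ _ _.
by elim: (k i) => //= j ->.
Qed.

Lemma partial_cderiv alpha beta a :
  partial_eta alpha (partial_x beta a) = cderiv (word_of alpha beta) a.
Proof.
rewrite /cderiv /word_of foldr_cat /partial_eta /partial_x.
rewrite -(foldr_flatten_nseq (fun c => deriv_along (dir c)) beta inl).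
by rewrite -(foldr_flatten_nseq (fun c => deriv_along (dir c)) alpha inr).
Qed.

Lemma nfreq_word_of alpha beta : nfreq (word_of alpha beta) = mabs alpha.
Proof.
rewrite /nfreq /word_of count_cat.
have -> : count (fun c => if c is inr _ then true else false)
    (flatten [seq nseq (beta i) (inl i : 'I_n + 'I_n) | i <- enum 'I_n]) = 0%N.
  by elim: (enum 'I_n) => //= i l IH; rewrite count_cat IH count_nseq.
rewrite addn0 /mabs -big_enum/=.
elim: (enum 'I_n) => [|i l IH]; first by rewrite big_nil.
by rewrite big_cons /= count_cat IH count_nseq /= mul1n.
Qed.

Lemma Re_deriv_along v a z : Re (deriv_along v a z) = 'D_v (fun w => Re (a w)) z.
Proof. by []. Qed.

Lemma Im_deriv_along v a z : Im (deriv_along v a z) = 'D_v (fun w => Im (a w)) z.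
Proof. by []. Qed.

Lemma smooth_derivable a s c z : smooth a ->
  derivable (fun w => Re (cderiv s a w)) z (dir c) /\
  derivable (fun w => Im (cderiv s a w)) z (dir c).
Proof. by move=> /(_ s)[_ _]; exact. Qed.

Lemma derive_lin (f g k : phase -> R) (x : R) z v :
  derivable f z v -> derivable g z v -> derivable k z v ->
  'D_v (fun w => x * (f w - g w) - k w) z = x * ('D_v f z - 'D_v g z) - 'D_v k z.
Proof.
move=> df dg dk.
have -> : (fun w => x * (f w - g w) - k w) = x *: (f - g) - k by [].
have dfg := derivableB df dg; have dx := derivableZ (k := x) dfg.
by rewrite (deriveB dx dk) (deriveZ _ dfg) (deriveB df dg).
Qed.

Lemma Re_rmulc (x : R) (y : R[i]) : Re (x%:C%C * y) = x * Re y.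
Proof. by case: y => a b /=; rewrite mul0r subr0. Qed.

Lemma Im_rmulc (x : R) (y : R[i]) : Im (x%:C%C * y) = x * Im y.
Proof. by case: y => a b /=; rewrite mul0r addr0. Qed.

(** This combination is a difference quotient minus the time derivative, whose seminorms define
    convergence in C^oo([-T, T], S^m). *)
Lemma cderiv_lin a a' k (x : R) s : smooth a -> smooth a' -> smooth k ->
  cderiv s (fun w => x%:C%C * (a w - a' w) - k w) =
  (fun w => x%:C%C * (cderiv s a w - cderiv s a' w) - cderiv s k w).
Proof.
move=> Sa Sa' Sk; elim: s => [//|c s IH] /=.
rewrite -/(cderiv s _) IH; apply/funext => z.
have [ra ia] := smooth_derivable s c z Sa.
have [ra' ia'] := smooth_derivable s c z Sa'.
have [rk ik] := smooth_derivable s c z Sk.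
apply: eq_complexP.
  rewrite Re_addc Re_oppc Re_rmulc Re_addc Re_oppc !Re_deriv_along.
  rewrite -derive_lin//; congr ('D_(dir c) _ z).
  by apply/funext => w; rewrite Re_addc Re_oppc Re_rmulc Re_addc Re_oppc.
rewrite Im_addc Im_oppc Im_rmulc Im_addc Im_oppc !Im_deriv_along.
rewrite -derive_lin//; congr ('D_(dir c) _ z).
by apply/funext => w; rewrite Im_addc Im_oppc Im_rmulc Im_addc Im_oppc.
Qed.

Lemma normc_le (x : R[i]) : normc x <= `|Re x| + `|Im x|.
Proof.
case: x => a b /=.
rewrite -[leRHS]ger0_norm ?addr_ge0// -sqrtr_sqr ler_wsqrtr//.
rewrite sqrrD !real_normK ?num_real// addrAC lerDl.
by rewrite mulrn_wge0// mulr_ge0.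
Qed.

Lemma normc_ge0 (x : R[i]) : 0 <= normc x.
Proof. by case: x => a b; exact: sqrtr_ge0. Qed.

Lemma normc_ge_ReIm (x : R[i]) : `|Re x| <= normc x /\ `|Im x| <= normc x.
Proof.
case: x => a b /=; split.
  by rewrite -sqrtr_sqr ler_wsqrtr// lerDl sqr_ge0.
by rewrite -sqrtr_sqr ler_wsqrtr// lerDr sqr_ge0.
Qed.

End Words.

(** * Comparison with the seminorms of C^oo([-T, T], S^m) *)

Section SymbolsToSpace.
Context {R : realType} {n : nat}.
Variable T : R.
Hypothesis T_gt0 : 0 < T.

Notation phase := ('rV[R]_n * 'rV[R]_n)%type.
Notation net := (R -> R -> phase -> R).
Notation cnet := (R -> R -> phase -> R[i]).
Notation wt := (@weight R n).
Implicit Types (u v w : cnet) (c : 'I_n + 'I_n) (e t h r m : R) (z : phase) (b : bool)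
  (s : seq ('I_n + 'I_n)).

Definition wderiv s u : cnet := fun e t => cderiv s (u e t).

Lemma csymbol_wderiv b m s u : csymbol T b m u ->
  csymbol T b (m - (nfreq s)%:R) (wderiv s u).
Proof.
move=> Su; elim: s => [|c s IH]; first by rewrite subr0.
have := csymbol_pderiv T_gt0 (Some c) IH.
rewrite -addrA -opprD; congr (csymbol _ _ (_ - _) _).
by case: c => i /=; rewrite ?addr0// natrD addrC.
Qed.

(** The time derivative stands inside the word in the seminorms but outside in Taylor's formula in
    time; [pderivC] moves it past one letter at a time. *)
Lemma wderiv_time b m s u : csymbol T b m u ->
  eq_on T (wderiv s (pderiv T None u)) (pderiv T None (wderiv s u)).
Proof.
move=> Su; elim: s => [|c s IH]; first by [].
move=> e t z he ht.
rewrite -[LHS]/(pderiv T (Some c) (wderiv s (pderiv T None u)) e t z).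
rewrite (pderiv_ext T_gt0 (Some c) (csymbol_wderiv s (csymbol_pderiv T_gt0 None Su)) IH z he ht).
exact: (pderivC T_gt0 _ _ (csymbol_wderiv s Su) z he ht).
Qed.

Definition move (l : seq ('I_n + 'I_n)) (xi : 'I_n + 'I_n -> R) z : phase :=
  foldr (fun c => shift_z (Some c) (xi c)) z l.

Lemma move_freq l xi z i : `|(move l xi z).2 0 i| <= `|z.2 0 i| + \sum_(c <- l) `|xi c|.
Proof.
elim: l => [|c l IH] /=; first by rewrite big_nil addr0.
rewrite big_cons mxE addrCA; apply: ler_normD_bound IH.
case: c => j /=; rewrite !mxE ?mulr0 ?normr0//.
by case: (_ && _); rewrite ?mulr0 ?normr0// mulr1.
Qed.

Lemma move_lipschitz (u : net) (uc : 'I_n + 'I_n -> net) e t z K l xi :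
  0 < e <= 1 -> `|t| <= T -> (forall c, has_deriv T (Some c) u (uc c)) ->
  (forall c z', freq_near z z' -> `|uc c e t z'| <= K) ->
  \sum_(c <- l) `|xi c| <= 1 ->
  `|u e t (move l xi z) - u e t z| <= K * \sum_(c <- l) `|xi c|.
Proof.
move=> he ht Hu HK; elim: l => [|c l IH]; first by rewrite big_nil subrr normr0 mulr0.
rewrite big_cons mulrDr /= => l1.
have l0 : 0 <= \sum_(j <- l) `|xi j| by rewrite sumr_ge0.
rewrite -(subrKA (u e t (move l xi z))).
have c0 := normr_ge0 (xi c).
apply: ler_normD_bound; last by apply: IH; lra.
apply: (@mean_value_le _ _ T (Some c) u (uc c) e t (move l xi z) (xi c) K
  (Hu c) he ht ht) => s sc _.
apply: HK => i; have := move_freq l xi z i.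
have := @shift_z_freq _ _ (Some c) s (move l xi z) i.
by move=> /(_ (le_trans sc _)) A; lra.
Qed.

Lemma move_enum z z' : z' = move (enum {: 'I_n + 'I_n})
  (fun c => match c with inl i => z'.1 0 i - z.1 0 i | inr i => z'.2 0 i - z.2 0 i end) z.
Proof.
set xi := fun _ => _.
have H1 l : (move l xi z).1 = z.1 + \sum_(c <- l) xi c *: (dir c).1.
  elim: l => [|c l IH] /=; first by rewrite big_nil addr0.
  by rewrite big_cons IH addrCA.
have H2 l : (move l xi z).2 = z.2 + \sum_(c <- l) xi c *: (dir c).2.
  elim: l => [|c l IH] /=; first by rewrite big_nil addr0.
  by rewrite big_cons IH addrCA.
rewrite [LHS]surjective_pairing [RHS]surjective_pairing H1 H2 !big_enum/= !big_sumType/=.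
congr (_, _).
  rewrite [X in _ + (_ + X)]big1 ?addr0; last by move=> i _; rewrite scaler0.
  rewrite -[LHS](subrKC z.1); congr (_ + _); rewrite [LHS]row_sum_delta.
  by apply: eq_bigr => i _; rewrite !mxE.
rewrite big1 ?add0r; last by move=> i _; rewrite scaler0.
rewrite -[LHS](subrKC z.2); congr (_ + _); rewrite [LHS]row_sum_delta.
by apply: eq_bigr => i _; rewrite !mxE.
Qed.

(** [smooth] asks for joint continuity, while symbols are differentiable along coordinates: the
    increment is split into coordinate shifts, and the derivatives are bounded near [z]. *)
Lemma symbol_continuous b m (u : net) e t : symbol T b m u -> 0 < e <= 1 -> `|t| <= T ->
  continuous (u e t).
Proof.
move=> Su he ht z.
have /choice[uc Huc] (c : 'I_n + 'I_n) := symbol_has_deriv T_gt0 (Some c) Su.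
have /choice[K HK] (c : 'I_n + 'I_n) : exists K, 0 <= K /\
    forall t z', `|t| <= T -> freq_near z z' -> `|uc c e t z'| <= K.
  by have [K K0 HK] := symbol_bound_near z (symbol_symbol_bound (Huc c).2) he; exists K.
(* The summand 1 keeps [K0] positive, and [N] exceeds the number of coordinates, so that coordinate
   shifts of length at most [del] add up to at most [Num.min 1 (eps / K0)]. *)
pose K0 := \sum_c K c + 1; pose N := (n + n).+1%:R : R.
have S0 : 0 <= \sum_c K c by rewrite sumr_ge0// => c _; have [] := HK c.
have K0_gt0 : 0 < K0 by rewrite /K0; lra.
have KK0 c : K c <= K0.
  rewrite /K0 (bigD1 c)//= -addrA lerDl addr_ge0// sumr_ge0// => j _.
  by have [] := HK j.
have N0 : 0 < N by rewrite ltr0n.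
apply/cvgrPdist_le => eps eps0.
pose del := Num.min 1 (eps / K0) / N.
have d0 : 0 < del by rewrite divr_gt0// lt_min ltr01 divr_gt0.
have nb : \forall z' \near z, ball z del z' by apply/nbhs_ballP; exists del.
near=> z'.
pose xi (c : 'I_n + 'I_n) : R :=
  match c with inl i => z'.1 0 i - z.1 0 i | inr i => z'.2 0 i - z.2 0 i end.
have xid c : `|xi c| <= del.
  have : ball z del z' by near: z'; exact: nb.
  by move=> [/= b1 b2]; case: c => i; apply: ltW; rewrite distrC; [exact: (b1.2 0 i)|exact: (b2.2 0 i)].
have sxi : \sum_(c <- enum {: 'I_n + 'I_n}) `|xi c| <= Num.min 1 (eps / K0).
  rewrite big_enum/=; apply: (@le_trans _ _ (\sum_(c : 'I_n + 'I_n) del)).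
    by apply: ler_sum => c _; exact: xid.
  rewrite sumr_const card_sum !card_ord -mulr_natl /del mulrCA ler_piMr//.
    by rewrite le_min ler01 divr_ge0 ?ltW.
  by rewrite ler_pdivrMr// mul1r ler_nat leqnSn.
rewrite distrC (move_enum z z') -/xi.
have := @move_lipschitz u uc e t z K0 (enum {: 'I_n + 'I_n}) xi he ht
  (fun c => (Huc c).1)
  (fun c z' hz => le_trans ((HK c).2 t z' ht hz) (KK0 c)) _.
move: sxi; rewrite le_min ler_pdivlMr// => /andP[s1 s2] /(_ s1) A.
by apply: le_trans A _; rewrite mulrC.
Unshelve. all: by end_near. Qed.

Lemma csymbol_smooth b m u e t : csymbol T b m u -> 0 < e <= 1 -> `|t| <= T ->
  smooth (u e t).
Proof.
move=> Su he ht s /=.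
have [Sr Si] := csymbol_wderiv s Su.
split; [exact: symbol_continuous Sr he ht|exact: symbol_continuous Si he ht|].
move=> c z; split.
  have [v [Hv _]] := symbol_has_deriv T_gt0 (Some c) Sr.
  by have [D _] := has_deriv_is_derive z Hv he ht; exact: D.
have [v [Hv _]] := symbol_has_deriv T_gt0 (Some c) Si.
by have [D _] := has_deriv_is_derive z Hv he ht; exact: D.
Qed.

Lemma japaneseD (eta : 'rV[R]_n) (p q : R) :
  japanese eta `^ p * japanese eta `^ q = japanese eta `^ (p + q).
Proof. by rewrite powRD// (gt_eqF (japanese_gt0 _)) implybT. Qed.

Lemma csymbol_bound b m u : csymbol T b m u -> exists2 w, growth b w &
  forall e t z, 0 < e <= 1 -> `|t| <= T -> normc (u e t z) <= w e * japanese z.2 `^ m.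
Proof.
move=> [/symbol_symbol_bound[w wg Hw] /symbol_symbol_bound[w' wg' Hw']].
exists (fun e => w e + w' e) => [|e t z he ht]; first exact: growthD.
apply: le_trans (normc_le _) _; rewrite mulrDl.
by apply: lerD; [exact: Hw|exact: Hw'].
Qed.

Lemma seminorm_csymbol b m u i : csymbol T b m u -> exists2 W, growth b W &
  forall e t, 0 < e <= 1 -> `|t| <= T -> (symbol_seminorm m i (u e t) <= (W e)%:E)%E.
Proof.
move=> Su; have [w wg Hw] := csymbol_bound (csymbol_wderiv (word_of i.1 i.2) Su).
exists w => // e t he ht; apply: ge_ereal_sup => _ [z _ <-].
rewrite lee_fin partial_cderiv.
apply: le_trans (ler_wpM2l (powR_ge0 _ _) (Hw e t z he ht)) _.
by rewrite mulrCA japaneseD nfreq_word_of [X in _ `^ X](_ : _ = 0) ?powRr0 ?mulr1//; ring.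
Qed.

Lemma csymbol_carrier b m u e t : csymbol T b m u -> 0 < e <= 1 -> `|t| <= T ->
  carrier (Sym m) (u e t).
Proof.
move=> Su he ht; split; first exact: csymbol_smooth Su he ht.
move=> i; have [W _ HW] := seminorm_csymbol i Su.
by apply: le_lt_trans (HW e t he ht) _; rewrite ltry.
Qed.

(** Second-order Taylor formula in time for [wderiv s u]: its second time derivative obeys the same
    weight, so the weighted error of the quotient is at most [|h| * W], uniformly in [z]. *)
Lemma csymbol_quotient b m u e t i : csymbol T b m u -> 0 < e <= 1 -> `|t| <= T ->
  symbol_seminorm m i (fun z =>
    (h^-1)%:C%C * (u e (t + h) z - u e t z) - time_deriv T (u e) t z)
  @[h --> increments T t] --> 0%E.
Proof.
move=> Su he ht; set s := word_of i.1 i.2.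
have F := increments_proper T_gt0 ht.
have Sv := csymbol_pderiv T_gt0 None Su.
have Sus := csymbol_wderiv s Su.
have Svs := csymbol_pderiv T_gt0 None Sus.
have [Hr Hi] := c_has_deriv_pderiv T_gt0 None Sus.
have [Hr' Hi'] := c_has_deriv_pderiv T_gt0 None Svs.
have [w wg Hw] := csymbol_bound (csymbol_pderiv T_gt0 None Svs).
pose W := w e + w e.
have w0 := growth_ge0 e wg.
apply: (@squeeze_cvge _ _ _ _ (fun=> 0%E) _ (fun h => (`|h| * W)%:E)).
- have := near_increments T t ltr01; apply: filterS => h [h1 h0 hT].
  apply/andP; split.
    apply: le_trans (ereal_sup_ubound _); last by exists (0 : phase); first exact: I.
    by rewrite lee_fin mulr_ge0 ?powR_ge0 ?normc_ge0.
  apply: ge_ereal_sup => _ [z _ <-]; rewrite lee_fin partial_cderiv -/s.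
  rewrite cderiv_lin; [|exact: csymbol_smooth Su he hT|exact: csymbol_smooth Su he ht|
    exact: csymbol_smooth Sv he ht].
  rewrite -[cderiv s (time_deriv T (u e) t) z]/(wderiv s (pderiv T None u) e t z).
  rewrite (wderiv_time s Su z he ht).
  rewrite -[cderiv s (u e (t + h)) z]/(wderiv s u e (t + h) z).
  rewrite -[cderiv s (u e t) z]/(wderiv s u e t z).
  set J := japanese z.2; pose k := m - (nfreq s)%:R - wt None - wt None.
  have bnd r : `|r| <= T ->
      normc (pderiv T None (pderiv T None (wderiv s u)) e r z) <= w e * J `^ k.
    by move=> hr; exact: Hw.
  have tr := @taylor2_le _ _ T None _ _ _ e t z h (w e * J `^ k) Hr Hr' he ht hT
    (fun r _ hr => le_trans (normc_ge_ReIm _).1 (bnd _ hr)).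
  have ti := @taylor2_le _ _ T None _ _ _ e t z h (w e * J `^ k) Hi Hi' he ht hT
    (fun r _ hr => le_trans (normc_ge_ReIm _).2 (bnd _ hr)).
  have div (x y B : R) : `|x - h * y| <= B * h ^+ 2 -> `|h^-1 * x - y| <= B * `|h|.
    move=> A; have -> : h^-1 * x - y = h^-1 * (x - h * y) by field.
    rewrite normrM normfV ler_pdivrMl ?normr_gt0//; apply: le_trans A _.
    by rewrite [leRHS]mulrCA -expr2 real_normK ?num_real.
  have E : J `^ (- m + (mabs i.1)%:R) * J `^ k = 1.
    by rewrite japaneseD [X in _ `^ X](_ : _ = 0) ?powRr0// /k nfreq_word_of /=; ring.
  apply: (@le_trans _ _ (J `^ (- m + (mabs i.1)%:R) * ((w e * J `^ k) * `|h| + (w e * J `^ k) * `|h|))).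
    rewrite ler_wpM2l ?powR_ge0//; apply: le_trans (normc_le _) _; apply: lerD.
      by rewrite Re_addc Re_oppc Re_rmulc Re_addc Re_oppc; exact: div.
    by rewrite Im_addc Im_oppc Im_rmulc Im_addc Im_oppc; exact: div.
  rewrite le_eqVlt; apply/orP; left; apply/eqP.
  transitivity ((J `^ (- m + (mabs i.1)%:R) * J `^ k) * (`|h| * W)); first by rewrite /W; ring.
  by rewrite E mul1r.
- exact: cvg_cst.
- apply/fine_cvgP; split; first exact: nearW.
  apply/cvgrPdist_le => eps eps0 /=.
  have W0 : 0 < W + 1 by rewrite /W; lra.
  have := near_increments T t (divr_gt0 eps0 W0); apply: filterS => h [h1 _ _].
  rewrite sub0r normrN ger0_norm ?mulr_ge0// /W ?addr_ge0//.
  move: h1; rewrite ler_pdivlMr// => h1; apply: le_trans h1.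
  by rewrite ler_wpM2l// /W; lra.
Qed.

Lemma csymbol_iter_time b m l u : csymbol T b m u ->
  csymbol T b m (fun e => iter l (time_deriv T) (u e)).
Proof.
by move=> Su; elim: l => //= l IH; have := csymbol_pderiv T_gt0 None IH; rewrite subr0.
Qed.

Lemma csymbol_net_in b m u : csymbol T b m u -> net_in (CSym T m) u.
Proof.
move=> Su e he l t; rewrite in_itv/= -ler_norml => ht.
split; first exact: csymbol_carrier (csymbol_iter_time l Su) he ht.
by move=> i; exact: csymbol_quotient (csymbol_iter_time l Su) he ht.
Qed.

Lemma csymbol_seminorm b m u i : csymbol T b m u -> exists2 W, growth b W &
  forall e, 0 < e <= 1 -> (@seminorm R _ (CSym T m) i (u e) <= (W e)%:E)%E.
Proof.
move=> Su; have [W Wg HW] := seminorm_csymbol i.2 (csymbol_iter_time i.1 Su).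
exists W => // e he; apply: ge_ereal_sup => _ [t /= + <-].
by rewrite in_itv/= -ler_norml => ht; exact: HW.
Qed.

Lemma csymbol_Msc m u : csymbol T true m u -> Msc (CSym T m) u.
Proof.
move=> Su; split; first exact: csymbol_net_in Su.
move=> i; have [W Wg HW] := csymbol_seminorm i Su.
exists (fun e => (W e)%:C%C); first exact: moderate_slow_scale.
exists 1 => //; near=> e; rewrite mul1r normc_real ?(growth_ge0 e Wg)//.
by apply: HW; near: e; exact: near_unit.
Unshelve. all: by end_near. Qed.

Lemma csymbol_Neg m u : csymbol T false m u -> Neg (CSym T m) u.
Proof.
move=> Su; split; first exact: csymbol_net_in Su.
move=> i q; have [W [W0 Wg] HW] := csymbol_seminorm i Su.
have [C HC] := Wg q; exists `|C| => //; near=> e.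
have he : 0 < e <= 1 by near: e; exact: near_unit.
apply: le_trans (HW e he) _; rewrite lee_fin.
have A : W e <= C * e ^+ q by near: e.
apply: le_trans A _; by rewrite ler_wpM2r ?ler_norm// exprn_ge0// ltW//; case/andP: he.
Unshelve. all: by end_near. Qed.

Lemma csymbol_Neg_at m u t : `|t| <= T -> csymbol T false m u ->
  Neg (Sym m) (fun e => u e t).
Proof.
move=> ht Su; split; first by move=> e he; exact: csymbol_carrier Su he ht.
move=> i q; have [W [W0 Wg] HW] := seminorm_csymbol i Su.
have [C HC] := Wg q; exists `|C| => //; near=> e.
have he : 0 < e <= 1 by near: e; exact: near_unit.
apply: le_trans (HW e t he ht) _; rewrite lee_fin.
have A : W e <= C * e ^+ q by near: e.
apply: le_trans A _; by rewrite ler_wpM2r ?ler_norm// exprn_ge0// ltW//; case/andP: he.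
Unshelve. all: by end_near. Qed.

End SymbolsToSpace.

(** * Symmetry of second derivatives of smooth functions *)

Section SmoothSchwarz.
Context {R : realType} {n : nat}.

Notation phase := ('rV[R]_n * 'rV[R]_n)%type.
Implicit Types (s : seq ('I_n + 'I_n)) (a : phase -> R[i]) (c d : 'I_n + 'I_n) (z : phase).

Lemma derivable_diff_on (f : phase -> R) (v z : phase) (x y : R) :
  (forall w, derivable f w v) ->
  diff_on x y (fun r => f (r *: v + z)) (fun r => 'D_v f (r *: v + z)).
Proof.
move=> df p _ eps eps0.
have /cvgrPdist_le /(_ eps eps0)/nbhs_ballP[del /= d0 Hd] :
  h^-1 *: (f (h *: v + (p *: v + z)) - f (p *: v + z)) @[h --> 0^'] --> 'D_v f (p *: v + z).
  exact: df.
exists del => // r _ rs.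
case: (eqVneq r p) => [->|nrs]; first by rewrite !subrr mul0r subr0 normr0 mulr0.
have rs0 : r - p != 0 by rewrite subr_eq0.
have := Hd (r - p); rewrite /ball/= sub0r normrN => /(_ rs rs0).
rewrite addrA -scalerDl subrK /GRing.scale/= distrC.
set A := f _; set B := f _; set D := 'D_v f _.
have -> : (r - p)^-1 * (A - B) - D = (r - p)^-1 * (A - B - (r - p) * D) by field.
by rewrite normrM normfV ler_pdivrMl ?normr_gt0// (mulrC `|_ - _|).
Qed.

Lemma dir_le1 c i : `|(dir c).1 0 i| <= (1 : R) /\ `|(dir c).2 0 i| <= (1 : R).
Proof.
by case: c => j /=; rewrite !mxE; split; rewrite ?normr0//; case: (_ && _);
  rewrite ?normr0 ?normr1.
Qed.

Lemma ball_shift2 c d z (x p r : R) : 0 < x -> `|p| <= x -> `|r| <= x ->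
  ball z (3 * x) (p *: dir c + (r *: dir d + z)).
Proof.
move=> x0 px rx.
have A (k q y : R) : `|k| <= 1 -> `|q| <= 1 -> `|y - (p * k + (r * q + y))| < 3 * x.
  move=> k1 q1; have -> : y - (p * k + (r * q + y)) = - (p * k + r * q) by ring.
  rewrite normrN; apply: le_lt_trans (_ : x * 1 + x * 1 < _); last by lra.
  by apply: ler_normD_bound; apply: ler_normM_bound.
by split; (split; first by lra) => i j; rewrite (ord1 i) /ball/= !mxE;
  apply: A; have [] := dir_le1 c j; have [] := dir_le1 d j.
Qed.

Section Part.
(* P is the real or the imaginary part. *)
Variable P : R[i] -> R.
Hypothesis P_deriv : forall v a z, P (deriv_along v a z) = 'D_v (P \o a) z.
Hypothesis P_smooth : forall a, smooth a -> forall s,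
  continuous (P \o cderiv s a) /\ forall c z, derivable (P \o cderiv s a) z (dir c).

Lemma P_cderiv_diff_on a s c z (x y : R) : smooth a ->
  diff_on x y (fun r => P (cderiv s a (r *: dir c + z)))
              (fun r => P (cderiv (c :: s) a (r *: dir c + z))).
Proof.
move=> Sa; have := @derivable_diff_on (P \o cderiv s a) (dir c) z x y
  (fun w => (P_smooth Sa s).2 c w).
set f := (fun r => 'D_(dir c) _ _); set g := (fun r => P (cderiv (_ :: _) _ _)).
by have -> : g = f by apply/funext => r; rewrite /g /f /= P_deriv.
Qed.

(** At this stage nothing but plain directional derivatives is available; the continuity that
    [schwarz] needs is part of [smooth]. *)
Lemma P_cderiv_swap a s c d z : smooth a ->
  P (cderiv (c :: d :: s) a z) = P (cderiv (d :: c :: s) a z).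
Proof.
move=> Sa.
pose F w (p r : R) := P (cderiv w a (p *: dir c + (r *: dir d + z))).
have I0 (o : R) : 0 < o -> (- o <= 0 <= o) /\ - o < o by move=> ?; split; [apply/andP; split|]; lra.
have [I1 L1] := I0 1 ltr01.
have cont w : continuous_on2 (-1) 1 (-1) 1 (F w).
  move=> eps eps0; have /cvgrPdist_le /(_ eps eps0)/nbhs_ballP[del /= d0 Hd] :=
    (P_smooth Sa w).1 z.
  exists (del / 3) => [|p r _ _ pd rd]; first by rewrite divr_gt0.
  rewrite /F !scale0r !add0r distrC; apply: Hd.
  have := @ball_shift2 c d z (del / 3) p r _ pd rd.
  by rewrite (_ : 3 * (del / 3) = del); [apply; rewrite divr_gt0|field].
have along1 w r : diff_on (-1) 1 ((F w)^~ r) ((F (c :: w))^~ r).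
  exact: P_cderiv_diff_on.
have along2 w p : diff_on (-1) 1 (F w p) (F (d :: w) p).
  have E x : F x p = fun r => P (cderiv x a (r *: dir d + (p *: dir c + z))).
    by apply/funext => r; rewrite /F addrCA.
  by rewrite !E; exact: P_cderiv_diff_on.
have := @schwarz _ (-1) 1 (-1) 1 (F s) (F (c :: s)) (F (d :: s)) (F (d :: c :: s))
  (F (c :: d :: s)) I1 L1 I1 L1 (fun r _ => along1 s r) (fun p _ => along2 _ p)
  (fun p _ => along2 _ p) (fun r _ => along1 _ r) (cont _) (cont _).
rewrite /F !scale0r !add0r => E; exact: esym E.
Qed.

End Part.

Lemma P_smooth_Re a : smooth a -> forall s, continuous (@Re R \o cderiv s a) /\
  forall c z, derivable (@Re R \o cderiv s a) z (dir c).
Proof.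
by move=> Sa s; have [? _ H] := Sa s; split=> // c z; have [] := H c z.
Qed.

Lemma P_smooth_Im a : smooth a -> forall s, continuous (@Im R \o cderiv s a) /\
  forall c z, derivable (@Im R \o cderiv s a) z (dir c).
Proof.
by move=> Sa s; have [_ ? H] := Sa s; split=> // c z; have [] := H c z.
Qed.

Lemma cderiv_swap a s c d : smooth a ->
  cderiv (c :: d :: s) a = cderiv (d :: c :: s) a.
Proof.
move=> Sa; apply/funext => z; apply: eq_complexP.
  exact: (P_cderiv_swap (P := @Re R) (fun _ _ _ => erefl) P_smooth_Re).
exact: (P_cderiv_swap (P := @Im R) (fun _ _ _ => erefl) P_smooth_Im).
Qed.

Lemma cderiv_perm a s s' : smooth a -> perm_eq s s' -> cderiv s a = cderiv s' a.
Proof.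
move=> Sa; elim: s s' => [|c s IH] s' ps.
  by move: ps; rewrite perm_sym => /perm_nilP ->.
have cs' : c \in s' by rewrite -(perm_mem ps) mem_head.
case/splitPr: cs' ps => s1 s2; rewrite perm_sym -cat1s perm_catCA /= perm_cons perm_sym.
move=> /IH; rewrite /= -!/(cderiv _ _) => ->.
elim: s1 {IH} => [//|x s1 IH].
rewrite /= -!/(cderiv _ _) -IH.
exact: cderiv_swap.
Qed.

(** Letters commute on smooth functions, so counting them yields multi-indices: a derivative in any
    order is controlled by one of the given seminorms, with the same frequency weight. *)
Lemma smooth_word_of s : exists2 i : multi_index * multi_index,
  (forall a, smooth a -> cderiv s a = cderiv (word_of i.1 i.2) a) & mabs i.1 = nfreq s.
Proof.
exists (fun i => count_mem (inr i) s, fun i => count_mem (inl i) s) => /=.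
- move=> a Sa; apply: cderiv_perm => //.
  apply/allP => c _ /=; apply/eqP; rewrite /word_of count_cat.
  have H c0 (k : 'I_n -> nat) (f : 'I_n -> 'I_n + 'I_n) l :
    count_mem c0 (flatten [seq nseq (k i) (f i) | i <- l]) =
    (\sum_(i <- l) (f i == c0) * k i)%N.
    elim: l => [|i l IH] /=; first by rewrite big_nil.
    by rewrite big_cons count_cat count_nseq IH.
  rewrite !H {H} !big_enum/=; case: c => j.
    rewrite big1 ?add0n; last by move=> i _; rewrite mul0n.
    rewrite (bigD1 j)//= eqxx mul1n big1 ?addn0// => i ij.
    by rewrite (inj_eq inl_inj) (negbTE ij).
  rewrite [X in (_ + X)%N]big1 ?addn0; last by move=> i _; rewrite mul0n.
  rewrite (bigD1 j)//= eqxx mul1n big1 ?addn0// => i ij.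
  by rewrite (inj_eq inr_inj) (negbTE ij).
- rewrite /mabs /nfreq; elim: s => [|c s IH] /=; first by rewrite big1.
  rewrite big_split/= IH; congr (_ + _)%N; case: c => j /=; first by rewrite big1.
  by rewrite (bigD1 j)//= eqxx big1 ?addn0// => i ij; rewrite (inj_eq inr_inj) eq_sym (negbTE ij).
Qed.

End SmoothSchwarz.

(** * From the seminorms back to symbol classes *)

Section SpaceToSymbols.
Context {R : realType} {n : nat}.
Variable T : R.
Hypothesis T_gt0 : 0 < T.

Notation phase := ('rV[R]_n * 'rV[R]_n)%type.
Notation net := (R -> R -> phase -> R).
Notation cnet := (R -> R -> phase -> R[i]).
Notation axis := (option ('I_n + 'I_n)).
Notation wt := (@weight R n).
Implicit Types (e t h x y : R) (z : phase) (b : bool)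
  (s : seq ('I_n + 'I_n)) (l : nat).

Lemma near_incrementsP t (Q : R -> Prop) : (\forall h \near increments T t, Q h) ->
  exists2 del, 0 < del & forall h, h != 0 -> `|h| < del -> `|t + h| <= T -> Q h.
Proof.
rewrite /increments near_withinE => /nbhs_ballP[del /= d0 Hd].
exists del => // h h0 hd hT; apply: (Hd h) => //.
  by rewrite /ball/= sub0r normrN.
by rewrite /= in_itv/= -ler_norml.
Qed.

Lemma seminorm_bound (m : R) i (a : phase -> R[i]) x z : (symbol_seminorm m i a <= x%:E)%E ->
  japanese z.2 `^ (- m + (mabs i.1)%:R) * normc (cderiv (word_of i.1 i.2) a z) <= x.
Proof.
move=> H; rewrite -lee_fin; apply: le_trans H.
by apply: ereal_sup_ubound; exists z => //; rewrite partial_cderiv.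
Qed.

Lemma seminorm_le_bound (m : R) i (a : phase -> R[i]) x :
  (forall z, japanese z.2 `^ (- m + (mabs i.1)%:R) * normc (cderiv (word_of i.1 i.2) a z) <= x) ->
  (symbol_seminorm m i a <= x%:E)%E.
Proof.
by move=> H; apply: ge_ereal_sup => _ [z _ <-]; rewrite lee_fin partial_cderiv.
Qed.

Lemma seminorm_ge0 (m : R) i (a : phase -> R[i]) : (0 <= symbol_seminorm m i a)%E.
Proof.
apply: le_trans (ereal_sup_ubound _); last by exists (0 : phase); first exact: I.
by rewrite lee_fin mulr_ge0 ?powR_ge0 ?normc_ge0.
Qed.

Lemma seminorm_fineK (m : R) i (a : phase -> R[i]) : carrier (Sym m) a ->
  symbol_seminorm m i a = (fine (symbol_seminorm m i a))%:E.
Proof. by move=> [_ /(_ i) H]; rewrite fineK// ge0_fin_numE// seminorm_ge0. Qed.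

Variables (m : R) (u : cnet).
Hypothesis u_in : net_in (CSym T m) u.

Let U l : cnet := fun e => iter l (time_deriv T) (u e).

Lemma iter_time_carrier l e t : 0 < e <= 1 -> `|t| <= T -> carrier (Sym m) (U l e t).
Proof.
by move=> he ht; have [|H _] := @u_in e he l t => //; rewrite in_itv/= -ler_norml.
Qed.

Lemma iter_time_smooth l e t : 0 < e <= 1 -> `|t| <= T -> smooth (U l e t).
Proof. by move=> he ht; have [] := iter_time_carrier l he ht. Qed.

Lemma iter_time_quotient l i e t eps : 0 < e <= 1 -> `|t| <= T -> 0 < eps ->
  exists2 del, 0 < del & forall h, h != 0 -> `|h| < del -> `|t + h| <= T -> forall z,
   japanese z.2 `^ (- m + (mabs i.1)%:R) *
    normc ((h^-1)%:C%C * (cderiv (word_of i.1 i.2) (U l e (t + h)) z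
      - cderiv (word_of i.1 i.2) (U l e t) z) - cderiv (word_of i.1 i.2) (U l.+1 e t) z) <= eps.
Proof.
move=> he ht eps0.
have tI : t \in `[- T, T] by rewrite in_itv/= -ler_norml.
have [_ /(_ i)] := @u_in e he l t tI.
have F := increments_proper T_gt0 ht.
move/fine_cvgP => [fin /cvgrPdist_le /(_ eps eps0) H].
have [del d0 Hd] := near_incrementsP (filterI fin H).
exists del => // h h0 hd hT z.
have [/= fh] := Hd h h0 hd hT; rewrite sub0r normrN => leh.
have -> : (h^-1)%:C%C * (cderiv (word_of i.1 i.2) (U l e (t + h)) z
      - cderiv (word_of i.1 i.2) (U l e t) z) - cderiv (word_of i.1 i.2) (U l.+1 e t) z =
  cderiv (word_of i.1 i.2) (fun z => (h^-1)%:C%C * (U l e (t + h) z - U l e t z) - U l.+1 e t z) z.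
  by rewrite (cderiv_lin h^-1 _ (iter_time_smooth l he hT) (iter_time_smooth l he ht) (iter_time_smooth l.+1 he ht)).
by apply: seminorm_bound; rewrite -(fineK fh) lee_fin; apply: le_trans leh; exact: ler_norm.
Qed.

Lemma word_quotient l s e t eps : 0 < e <= 1 -> `|t| <= T -> 0 < eps ->
  exists2 del, 0 < del & forall h, h != 0 -> `|h| < del -> `|t + h| <= T -> forall z,
   japanese z.2 `^ (- m + (nfreq s)%:R) *
    normc ((h^-1)%:C%C * (wderiv s (U l) e (t + h) z
      - wderiv s (U l) e t z) - wderiv s (U l.+1) e t z) <= eps.
Proof.
move=> he ht eps0; have [i Hi <-] := smooth_word_of (R := R) s.
have [del d0 Hd] := iter_time_quotient l i he ht eps0; exists del => // h h0 hd hT z.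
rewrite /wderiv !Hi; [exact: Hd|exact: iter_time_smooth|exact: iter_time_smooth|exact: iter_time_smooth].
Qed.

(** With tolerance 1 in the difference quotient, [U l] at [t'] is [U l] at [t] plus [t' - t] times
    the sum of [U l.+1] at [t] and an error of weighted size at most 1. *)
Lemma seminorm_locally_bounded l i e t : 0 < e <= 1 -> `|t| <= T ->
  exists M, exists2 del, 0 < del & forall t', `|t'| <= T -> `|t' - t| < del ->
    (symbol_seminorm m i (U l e t') <= M%:E)%E.
Proof.
move=> he ht; have [del d0 Hd] := iter_time_quotient l i he ht ltr01.
pose S k := fine (symbol_seminorm m i (U k e t)).
have HS k : (symbol_seminorm m i (U k e t) <= (S k)%:E)%E.
  by rewrite (seminorm_fineK _ (iter_time_carrier k he ht)).
have S0 k : 0 <= S k by rewrite fine_ge0// seminorm_ge0.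
exists (S l + (S l.+1 + 1)), (Num.min 1 del) => [|t' ht']; first by rewrite lt_min ltr01.
rewrite lt_min => /andP[h1 hd].
have [E|h0] := eqVneq (t' - t) 0.
  move/eqP: E; rewrite subr_eq0 => /eqP ->; apply: le_trans (HS l) _.
  by rewrite lee_fin lerDl; have := S0 l.+1; lra.
apply: seminorm_le_bound => z.
have := Hd _ h0 hd; rewrite (addrC t) subrK => /(_ ht' z).
have := seminorm_bound z (HS l); have := seminorm_bound z (HS l.+1).
set J := japanese _ `^ _; set X' := cderiv _ (U l e t') z; set X := cderiv _ (U l e t) z.
set Y := cderiv _ (U l.+1 e t) z; set h := t' - t in h0 h1 *; set Q := _ - Y => A B C.
have J0 : 0 <= J by exact: powR_ge0.
have hC : (h%:C * (h^-1)%:C = 1)%C by rewrite -rmorphM mulfV.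
have -> : X' = X + h%:C%C * (Y + Q).
  by rewrite /Q addrCA subrr addr0 mulrA hC mul1r addrCA subrr addr0.
apply: le_trans (ler_wpM2l J0 (le_normcD _ _)) _; rewrite mulrDr normcM lerD//.
have -> : normc h%:C%C = `|h| by rewrite /normc /= expr0n addr0 sqrtr_sqr.
rewrite mulrCA; apply: (@le_trans _ _ (1 * (J * normc (Y + Q)))).
  by rewrite ler_wpM2r ?mulr_ge0 ?normc_ge0// ltW.
rewrite mul1r; apply: le_trans (ler_wpM2l J0 (le_normcD _ _)) _.
by rewrite mulrDr lerD.
Qed.

(** Local bounds become uniform because [-T, T] is compact. *)
Lemma seminorm_bounded l i e : 0 < e <= 1 ->
  exists M : R, forall t, `|t| <= T -> (symbol_seminorm m i (U l e t) <= M%:E)%E.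
Proof.
move=> he.
have /compact_near_coveringP cov := @segment_compact R (- T) T.
pose P (M t : R) := `|t| <= T -> (symbol_seminorm m i (U l e t) <= M%:E)%E.
have : \forall M \near +oo, `[- T, T]%classic `<=` P M.
  apply: cov => t; rewrite /= in_itv/= -ler_norml => ht.
  have [M [del d0 HM]] := seminorm_locally_bounded l i he ht.
  have nb : \forall t' \near t, `|t' - t| < del.
    by apply/nbhs_ballP; exists del => //= t'; rewrite /ball/= distrC.
  near=> t' M' => /= ht'.
  have : (symbol_seminorm m i (U l e t') <= M%:E)%E.
    by apply: HM => //; near: t'; exact: nb.
  move=> A; apply: le_trans A _; rewrite lee_fin; near: M'.
  by apply: nbhs_pinfty_ge; exact: num_real.
move=> H; near (+oo : set_system R) => M.
exists M => t ht.
have : `[- T, T]%classic `<=` P M by near: M.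
by apply => //; rewrite /= in_itv/= -ler_norml.
Unshelve. all: by end_near. Qed.

Let N i e := @seminorm R _ (CSym T m) i (u e).

Lemma CSym_seminorm_fineK i e : 0 < e <= 1 -> N i e = (fine (N i e))%:E.
Proof.
move=> he; have [M HM] := seminorm_bounded i.1 i.2 he.
have N0 : (0 <= N i e)%E.
  apply: le_trans (seminorm_ge0 m i.2 (U i.1 e 0)) _.
  apply: ereal_sup_ubound; exists 0 => //=.
  by rewrite in_itv/= -ler_norml normr0 ltW.
rewrite fineK// ge0_fin_numE//; apply: (@le_lt_trans _ _ M%:E); last exact: ltry.
apply: ge_ereal_sup => _ [t /= + <-]; rewrite in_itv/= -ler_norml; exact: HM.
Qed.

Lemma word_le_seminorm l s : exists i, forall e t z, 0 < e <= 1 -> `|t| <= T ->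
  normc (wderiv s (U l) e t z) <= fine (N i e) * japanese z.2 `^ (m - (nfreq s)%:R).
Proof.
have [i Hi <-] := smooth_word_of (R := R) s; exists (l, i) => e t z he ht.
have A : (symbol_seminorm m i (U l e t) <= (fine (N (l, i) e))%:E)%E.
  rewrite -CSym_seminorm_fineK//; apply: ereal_sup_ubound; exists t => //=.
  by rewrite in_itv/= -ler_norml.
have := seminorm_bound z A; rewrite /wderiv (Hi _ (iter_time_smooth l he ht)).
set J := japanese _ => B.
have J0 p : 0 < J `^ p by apply: powR_gt0; exact: japanese_gt0.
rewrite -(ler_pM2l (J0 (- m + (mabs i.1)%:R))); apply: le_trans B _.
by rewrite mulrCA japaneseD [X in _ `^ X](_ : _ = 0) ?powRr0 ?mulr1//; ring.
Qed.

Variable b : bool.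
(** The value 0 outside (0, 1] secures the nonnegativity that [growth] asks at every [e]. *)
Hypothesis seminorm_growth : forall i,
  growth b (fun e => if 0 < e <= 1 then fine (N i e) else 0).

Section Part.
(* P is the real or the imaginary part. *)
Variable P : R[i] -> R.
Hypothesis P_deriv : forall (v : phase) a z, P (deriv_along v a z) = 'D_v (P \o a) z.
Hypothesis P_smooth : forall a, @smooth R n a -> forall s,
  continuous (P \o cderiv s a) /\ forall c z, derivable (P \o cderiv s a) z (dir c).
Hypothesis P_lin : forall x a a' k, P (x%:C%C * (a - a') - k) = x * (P a - P a') - P k.
Hypothesis P_norm : forall a, `|P a| <= normc a.

Let G l s : net := fun e t z => P (wderiv s (U l) e t z).

Lemma part_bound l s : symbol_bound T b (m - (nfreq s)%:R) (G l s).
Proof.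
have [i Hi] := word_le_seminorm l s.
exists (fun e => if 0 < e <= 1 then fine (N i e) else 0); first exact: seminorm_growth.
by move=> e t z he ht; rewrite he; apply: le_trans (P_norm _) _; exact: Hi.
Qed.

Lemma part_time_diff_on l s e z : 0 < e <= 1 ->
  diff_on (- T) T (fun t => G l s e t z) (fun t => G l.+1 s e t z).
Proof.
move=> he t tT eps eps0; have ht : `|t| <= T by rewrite ler_norml.
set J := japanese z.2 `^ (- m + (nfreq s)%:R).
have J0 : 0 < J by apply: powR_gt0; exact: japanese_gt0.
(* The weight at the fixed point [z] is absorbed in the tolerance. *)
have [del d0 Hd] := word_quotient l s he ht (mulr_gt0 J0 eps0).
exists del => // r rT rt; have [->|nrt] := eqVneq r t.
  by rewrite !subrr mul0r subr0 normr0 mulr0.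
have h0 : r - t != 0 by rewrite subr_eq0.
have := Hd _ h0 rt; rewrite (addrC t) subrK ler_norml => /(_ rT z).
rewrite -/J ler_pM2l// => A.
have := le_trans (P_norm _) A; rewrite P_lin -/(G _ _ _ _ _) -/(G l s e t z) -/(G l.+1 s e t z).
set a := G _ _ _ _ _; set a' := G _ _ _ _ _; set k := G _ _ _ _ _ => B.
have -> : a - a' - (r - t) * k = ((r - t)^-1 * (a - a') - k) * (r - t) by field.
by rewrite normrM ler_wpM2r.
Qed.

(** Convergence of quotients gives no rate; the quadratic remainder comes from the bound on the
    second time derivative [G l.+2 s]. *)
Lemma part_has_deriv_time l s : has_deriv T None (G l s) (G l.+1 s).
Proof.
move=> e t z he ht.
have [K K0 HK] := symbol_bound_loc0 z (part_bound l.+2 s) he.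
exists K => h h1 hT; have := @taylor2_on _ _ _ _ _ _ K t (t + h)
  (@part_time_diff_on l s e z he) (@part_time_diff_on l.+1 s e z he) HK.
by rewrite -!norm_itv (addrC t) addrK addrC; apply.
Qed.

Lemma part_has_deriv_space l s c : has_deriv T (Some c) (G l s) (G l (c :: s)).
Proof.
move=> e t z he ht.
have [K K0 HK] := symbol_bound_loc (Some c) z (part_bound l (c :: c :: s)) he.
exists K => h h1 _.
have I0 (o : R) : `|h| <= o -> (- o <= 0 <= o) /\ (- o <= h <= o).
  by move=> ho; split; rewrite -ler_norml// normr0; apply: le_trans ho.
have [z0 zh] := I0 1 h1.
have Sm := iter_time_smooth l he ht.
have D w := @P_cderiv_diff_on _ _ P P_deriv P_smooth (U l e t) w c z (- 1) 1 Sm.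
have := @taylor2_on _ _ _ _ _ _ K 0 h (D s) (D (c :: s)) _ z0 zh.
rewrite subr0 !scale0r !add0r; apply => r; rewrite -ler_norml => r1.
exact: (HK t r).
Qed.

(** The family [G l s] is closed under derivatives: time raises [l], other directions add a letter.
    No letter has to pass a time derivative, since convergence in the topology holds for each
    word. *)
Lemma part_symbol l s : symbol T b (m - (nfreq s)%:R) (G l s).
Proof.
move=> k; elim: k l s => [|k IH] l s; first by split=> //; exact: part_bound.
split=> [|[c|]]; first exact: part_bound.
  exists (G l (c :: s)); split; first exact: part_has_deriv_space.
  have := IH l (c :: s); congr (symbol_upto _ _ _ _ _).
  by case: c => i /=; rewrite ?subr0// natrD opprD addrA addrAC.
exists (G l.+1 s); split; first exact: part_has_deriv_time.
by rewrite subr0; exact: IH.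
Qed.

End Part.

Lemma net_in_csymbol : csymbol T b m u.
Proof.
split; rewrite -[m]subr0.
  apply: (@part_symbol (@Re R) (fun _ _ _ => erefl) (@P_smooth_Re R n) _ _ 0%N [::]).
    by move=> x a a' k; rewrite Re_addc Re_oppc Re_rmulc Re_addc Re_oppc.
  by move=> a; exact: (normc_ge_ReIm a).1.
apply: (@part_symbol (@Im R) (fun _ _ _ => erefl) (@P_smooth_Im R n) _ _ 0%N [::]).
  by move=> x a a' k; rewrite Im_addc Im_oppc Im_rmulc Im_addc Im_oppc.
by move=> a; exact: (normc_ge_ReIm a).2.
Qed.

End SpaceToSymbols.

Section SpaceToSymbolClasses.
Context {R : realType} {n : nat}.
Variable T : R.
Hypothesis T_gt0 : 0 < T.
Notation cnet := (R -> R -> 'rV[R]_n * 'rV[R]_n -> R[i]).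
Implicit Types (u : cnet) (m : R).

Lemma fine_seminorm_ge0 m u i e : net_in (CSym T m) u -> 0 < e <= 1 ->
  0 <= fine (@seminorm R _ (CSym T m) i (u e)).
Proof.
move=> Hu he; have := CSym_seminorm_fineK T_gt0 Hu i he => E.
rewrite -lee_fin -E; apply: le_trans (seminorm_ge0 m i.2 (iter i.1 (time_deriv T) (u e) 0)) _.
by apply: ereal_sup_ubound; exists 0 => //=; rewrite in_itv/= -ler_norml normr0 ltW.
Qed.

Lemma Msc_csymbol m u : Msc (CSym T m) u -> csymbol T true m u.
Proof.
move=> [Hu H]; apply: (net_in_csymbol T_gt0 Hu) => i.
have [w ws [C C0 HC]] := H i.
apply: (@growth_le _ true (fun e => C * normc (w e))).
- by apply: growthZ => //; exact: slow_scale_moderate.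
- by move=> e; case: ifPn => // he; exact: fine_seminorm_ge0.
near=> e; have he : 0 < e <= 1 by near: e; exact: near_unit.
by rewrite he -lee_fin -(CSym_seminorm_fineK T_gt0 Hu)//; near: e.
Unshelve. all: by end_near. Qed.

Lemma Neg_csymbol m u : Neg (CSym T m) u -> csymbol T false m u.
Proof.
move=> [Hu H]; apply: (net_in_csymbol T_gt0 Hu) => i; split.
  by move=> e; case: ifPn => // he; exact: fine_seminorm_ge0.
move=> q; have [C C0 HC] := H i q; exists C; near=> e.
have he : 0 < e <= 1 by near: e; exact: near_unit.
by rewrite he -lee_fin -(CSym_seminorm_fineK T_gt0 Hu)//; near: e.
Unshelve. all: by end_near. Qed.

End SpaceToSymbolClasses.

(** * The transport equation *)

Section Transport.
Context {R : realType} {n : nat}.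
Variable T : R.
Hypothesis T_gt0 : 0 < T.

Notation phase := ('rV[R]_n * 'rV[R]_n)%type.
Notation net := (R -> R -> phase -> R).
Notation cnet := (R -> R -> phase -> R[i]).
Notation axis := (option ('I_n + 'I_n)).
Notation wt := (@weight R n).
Notation axis_x k := (Some (inl k)).
Notation axis_eta k := (Some (inr k)).
Implicit Types (u v w : cnet) (e t h m : R) (z : phase).

Definition cprim u : cnet := fun e t z =>
  (prim T (re_net u) e t z +i* prim T (im_net u) e t z)%C.

Lemma csymbol_cprim b m u : csymbol T b m u -> csymbol T b m (cprim u).
Proof. by move=> [? ?]; split; exact: symbol_prim. Qed.

Lemma c_has_deriv_cprim b m u : csymbol T b m u -> c_has_deriv T None (cprim u) u.
Proof. by move=> [? ?]; split; apply: has_deriv_prim_time; eassumption. Qed.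

Lemma cprim0 u e z : cprim u e 0 z = 0.
Proof. by rewrite /cprim !prim0. Qed.

Lemma csymbol_pull b m u (Phi : 'I_n -> net) : (forall k, symbol T true 0 (Phi k)) ->
  csymbol T b m u -> csymbol T b m (pull Phi u).
Proof. by move=> SPhi [Sr Si]; split; [exact: symbol_pull Sr|exact: symbol_pull Si]. Qed.

Lemma c_has_deriv_pull b m d u ud (ux : 'I_n -> cnet) (Phi Phid : 'I_n -> net) :
  csymbol T b m u -> c_has_deriv T d u ud ->
  (forall k, c_has_deriv T (axis_x k) u (ux k)) ->
  (forall k, has_deriv T d (Phi k) (Phid k)) ->
  c_has_deriv T d (pull Phi u) (fun e t z =>
    pull Phi ud e t z + \sum_k (Phid k e t z)%:C%C * pull Phi (ux k) e t z).
Proof.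
move=> [Sr Si] [Hr Hi] Hx HPhi; split.
  apply: has_deriv_ext (has_deriv_pull T_gt0 Sr Hr (fun k => (Hx k).1) HPhi) => // e t z _ _.
  rewrite /re_net Re_addc; congr (_ + _).
  rewrite (big_morph (@Re R) (@Re_addc R) (erefl _)); apply: eq_bigr => k _.
  by rewrite Re_rmulc.
apply: has_deriv_ext (has_deriv_pull T_gt0 Si Hi (fun k => (Hx k).2) HPhi) => // e t z _ _.
rewrite /im_net Im_addc; congr (_ + _).
rewrite (big_morph (@Im R) (@Im_addc R) (erefl _)); apply: eq_bigr => k _.
by rewrite Im_rmulc.
Qed.

Definition cexp u : cnet := fun e t z =>
  (expR (Re (u e t z)) * cos (Im (u e t z)) +i* (expR (Re (u e t z)) * sin (Im (u e t z))))%C.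

Lemma csymbol_cexp u : csymbol T true 0 u ->
  symbol_bound T true 0 (fun e t z => expR (Re (u e t z))) -> csymbol T true 0 (cexp u).
Proof.
move=> [Sr Si] B; have Se := symbol_exp T_gt0 Sr B.
have [Sc Ss] := symbol_cos_sin T_gt0 Si.
by split; [have := symbolM Se Sc|have := symbolM Se Ss]; rewrite addr0.
Qed.

Lemma c_has_deriv_cexp d u v : c_has_deriv T d u v ->
  c_has_deriv T d (cexp u) (fun e t z => v e t z * cexp u e t z).
Proof.
move=> [Hr Hi]; split.
  apply: has_deriv_ext (has_derivM (has_deriv_exp Hr) (has_deriv_cos Hi)) => // e t z _ _.
  by rewrite /re_net Re_mulc /cexp /= /im_net; ring.
apply: has_deriv_ext (has_derivM (has_deriv_exp Hr) (has_deriv_sin Hi)) => // e t z _ _.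
by rewrite /im_net Im_mulc /cexp /= /re_net; ring.
Qed.

Lemma cexpN u e t z : cexp u e t z * cexp (fun e t z => - u e t z) e t z = 1.
Proof.
have E : expR (Re (u e t z)) * expR (- Re (u e t z)) = 1 by rewrite -expRD subrr expR0.
have C := cos2Dsin2 (Im (u e t z)).
apply: eq_complexP; last first.
  by rewrite Im_mulc -[RHS]/(0 : R) /cexp /= Re_oppc Im_oppc cosN sinN; ring.
rewrite Re_mulc -[RHS]/(1 : R) /cexp /= Re_oppc Im_oppc cosN sinN -[RHS]E.
set p := expR _; set q := expR _; set c := cos _; set s := sin _.
by rewrite -[p * q]mulr1 -C -/c -/s; ring.
Qed.

(* Variation of constants: c = E * (c0 + int E^-1 F), with E the exponential of
   the primitive of A. *)
Lemma linear_ode m (A F : cnet) (L : R -> R) (c0 : R[i]) :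
  csymbol T true 0 A -> csymbol T true m F -> csymbol T true m (fun _ _ (_ : phase) => c0) ->
  (forall e t z, 0 < e <= 1 -> `|t| <= T -> `|Re (A e t z)| <= L e) ->
  moderate (fun e => expR (T * L e)) ->
  exists c, [/\ csymbol T true m c, forall e z, c e 0 z = c0 &
    c_has_deriv T None c (fun e t z => A e t z * c e t z + F e t z)].
Proof.
move=> SA SF Sc0 AL LM.
(* The modulus of a complex exponential depends on the real part only; the factor [T] comes from
   integrating over a time of length at most [T]. *)
have Bd (u : cnet) : (forall e t z, 0 < e <= 1 -> `|t| <= T -> `|Re (u e t z)| <= L e * T) ->
    symbol_bound T true 0 (fun e t z => expR (Re (u e t z))).
  move=> H; exists (fun e => expR (T * L e)) => // e t z he ht.
  rewrite powRr0 mulr1 ger0_norm ?expR_ge0// ler_expR mulrC.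
  exact: le_trans (ler_norm _) (H e t z he ht).
have Pb e t z : 0 < e <= 1 -> `|t| <= T -> `|Re (cprim A e t z)| <= L e * T.
  by move=> he ht; apply: (prim_le T_gt0 SA.1 he ht) => r hr; exact: AL.
have SP := csymbol_cprim SA.
have SE : csymbol T true 0 (cexp (cprim A)) by apply: csymbol_cexp => //; exact: Bd.
have SNP := csymbolN SP.
have SE' : csymbol T true 0 (cexp (fun e t z => - cprim A e t z)).
  by apply: csymbol_cexp => //; apply: Bd => e t z he ht; rewrite Re_oppc normrN; exact: Pb.
set E := cexp (cprim A) in SE *; set E' := cexp _ in SE' *.
have SQ : csymbol T true m (fun e t z => E' e t z * F e t z).
  by have := csymbolM SE' SF; rewrite add0r.
set Q := fun e t z => _ in SQ.
have SQp := csymbol_cprim SQ.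
exists (fun e t z => E e t z * (c0 + cprim Q e t z)); split.
- by have := csymbolM SE (csymbolD Sc0 SQp); rewrite add0r.
- move=> e z; rewrite cprim0 addr0 /E /cexp cprim0 expR0 cos0 sin0 mulr1 mulr0.
  exact: mul1r.
have HE := c_has_deriv_cexp (c_has_deriv_cprim SA).
have HQ := c_has_deriv_cprim SQ.
have Hc : c_has_deriv T None (fun _ _ (_ : phase) => c0) (fun _ _ _ => 0).
  by split; exact: has_deriv_cst.
apply: c_has_deriv_ext (c_has_derivM HE (c_has_derivD Hc HQ)) => // e t z _ _.
rewrite add0r -/E mulrA; congr (_ + _).
by rewrite /Q mulrA cexpN mul1r.
Qed.

(** A directional derivative sees the values on one line only. This carries independence of [x] over
    to the eta derivatives of [a1]. *)
Lemma derive_eq (f : phase -> R) (v z z' : phase) :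
  (forall h, f (h *: v + z) = f (h *: v + z')) -> f z = f z' -> 'D_v f z = 'D_v f z'.
Proof.
move=> H H0; rewrite /derive; set F := fun h => _; set F' := fun h => _.
suff -> : F = F' by [].
by apply/funext => h; rewrite /F /F' /= H H0.
Qed.

Lemma deriv_along_eq (a : phase -> R[i]) (v z z' : phase) :
  (forall h, a (h *: v + z) = a (h *: v + z')) -> a z = a z' ->
  deriv_along v a z = deriv_along v a z'.
Proof.
by move=> H H0; apply: eq_complexP; apply: derive_eq => [h|]; rewrite ?H ?H0.
Qed.

Lemma transport_exists m (a1 A F : cnet) (L : R -> R) (c0 : R[i]) :
  csymbol T true 1 a1 -> real_valued T a1 -> x_independent T a1 ->
  csymbol T true 0 A -> csymbol T true m F -> csymbol T true m (fun _ _ (_ : phase) => c0) ->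
  (forall e t z, 0 < e <= 1 -> `|t| <= T -> `|Re (A e t z)| <= L e) ->
  moderate (fun e => expR (T * L e)) ->
  exists b, [/\ csymbol T true m b, forall e z, b e 0 z = c0 &
    eq_on T (pderiv T None b) (fun e t z =>
      \sum_k pderiv T (axis_eta k) a1 e t z * pderiv T (axis_x k) b e t z
      + A e t z * b e t z + F e t z)].
Proof.
move=> Sa1 a1real a1indep SA SF Sc0 AL LM.
have itvT t : (t \in `[- T, T]) = (`|t| <= T) by rewrite in_itv/= ler_norml.
pose g k := re_net (pderiv T (axis_eta k) a1).
have Sg k : symbol T true 0 (g k).
  by have [+ _] := csymbol_pderiv T_gt0 (axis_eta k) Sa1; rewrite /= subrr.
have gindep k e t x y eta : 0 < e <= 1 -> `|t| <= T -> g k e t (x, eta) = g k e t (y, eta).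
  move=> he ht; rewrite /g /re_net /pderiv; congr (Re _).
  have E h x' : h *: dir (inr k) + (x', eta) = (x', h *: delta_mx 0 k + eta) :> phase.
    by rewrite [LHS]surjective_pairing/= ; congr (_, _); rewrite scaler0 add0r.
  by apply: deriv_along_eq => [h|]; rewrite ?E; apply: a1indep; rewrite ?itvT.
have greal k e t z : 0 < e <= 1 -> `|t| <= T ->
    pderiv T (axis_eta k) a1 e t z = (g k e t z)%:C%C.
  move=> he ht; apply: eq_complexP => //=.
  have -> : (fun y => Im (a1 e t y)) = cst 0.
    by apply/funext => y; apply: a1real; rewrite ?itvT.
  by rewrite derive_cst.
(* The solution will be [pull Phi c], where [c] solves the equation without transport term, its data
   pulled back by [Phi']. *)
pose Phi k := prim T (g k); pose Phi' k : net := fun e t z => - Phi k e t z.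
have SPhi k : symbol T true 0 (Phi k) by exact: symbol_prim.
have SPhi' k : symbol T true 0 (Phi' k) by exact: symbolN.
have Phiindep k e t x y eta : 0 < e <= 1 -> Phi k e t (x, eta) = Phi k e t (y, eta).
  by move=> he; apply: eq_primitive => // r rT; apply: gindep; rewrite // ler_norml.
(* The translations are inverse to each other because [Phi] takes the same value at a point and at
   its translate in [x]. *)
have trK e t z : 0 < e <= 1 -> translate Phi' e t (translate Phi e t z) = z.
  move=> he; rewrite /translate /=; case: z => x eta /=; congr (_, _).
  rewrite -addrA -[RHS]addr0; congr (_ + _); apply/rowP => k.
  by rewrite !mxE /Phi' (Phiindep k e t _ x) ?subrr.
have pullK (V : Type) (u : R -> R -> phase -> V) e t z : 0 < e <= 1 ->
    pull Phi (pull Phi' u) e t z = u e t z.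
  by move=> he; rewrite /pull trK.
(* The bound [L] is uniform in [z], so the translation does not affect it. *)
have [c [Sc c_0 Hc]] := @linear_ode m (pull Phi' A) (pull Phi' F) L c0
  (csymbol_pull SPhi' SA) (csymbol_pull SPhi' SF) Sc0 (fun e t z => AL e t _) LM.
have Sb := csymbol_pull SPhi Sc.
exists (pull Phi c); split => //.
  by move=> e z; rewrite /pull c_0.
have Hx k := c_has_deriv_pderiv T_gt0 (axis_x k) Sc.
have HPt k : has_deriv T None (Phi k) (g k) by exact: has_deriv_prim_time.
have HPx j k : has_deriv T (axis_x j) (Phi k) (fun _ _ _ => 0).
  move=> e t z he ht; exists 0 => h _ _ /=; case: z => x eta.
  have -> : h *: (delta_mx 0 j, 0) + (x, eta) = (h *: delta_mx 0 j + x, eta) :> phase.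
    by rewrite [LHS]surjective_pairing/=; congr (_, _); rewrite scaler0 add0r.
  by rewrite (Phiindep k e t _ x)// subrr mulr0 subr0 normr0 mul0r.
have bx j : eq_on T (pull Phi (pderiv T (axis_x j) c)) (pderiv T (axis_x j) (pull Phi c)).
  move=> e t z he ht.
  rewrite -(c_has_deriv_pderivE T_gt0 (c_has_deriv_pull Sc (Hx j) Hx (HPx j)) z he ht).
  by rewrite big1 ?addr0// => k _; exact: mul0r.
move=> e t z he ht.
(* The chain rule in time produces the transport term, the time derivative of [Phi k] being
   [g k]. *)
rewrite -(c_has_deriv_pderivE T_gt0 (c_has_deriv_pull Sc Hc Hx HPt) z he ht).
rewrite [LHS]addrC -[RHS]addrA; apply: (f_equal2 +%R).
  by apply: eq_bigr => k _; rewrite bx// greal.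
by rewrite -(pullK _ A e t z he) -(pullK _ F e t z he).
Qed.

End Transport.

(** * Independence of representatives, and the form of the Taylor terms *)

Section Congruence.
Context {R : realType} {n : nat}.
Variable T : R.
Hypothesis T_gt0 : 0 < T.

Notation phase := ('rV[R]_n * 'rV[R]_n)%type.
Notation cnet := (R -> R -> phase -> R[i]).
Implicit Types (u v w : cnet) (e t m : R) (z : phase).

(** Equality in the quotient, with moderateness of both sides kept along because products need
    it. *)
Definition equiv m u v := [/\ csymbol T true m u, csymbol T true m v &
  csymbol T false m (fun e t z => u e t z - v e t z)].

Lemma equiv_refl m u : csymbol T true m u -> equiv m u u.
Proof.
move=> Su; split=> //; apply: csymbol_ext (csymbol0 T false m) => e t z _ _.
by rewrite subrr.
Qed.

Lemma equiv_ext m u u' v v' : eq_on T u u' -> eq_on T v v' -> equiv m u v -> equiv m u' v'.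
Proof.
move=> uu vv [Su Sv D]; split; [exact: csymbol_ext Su|exact: csymbol_ext Sv|].
by apply: csymbol_ext D => e t z he ht; rewrite uu// vv.
Qed.

Lemma equivD m u u' v v' : equiv m u u' -> equiv m v v' ->
  equiv m (fun e t z => u e t z + v e t z) (fun e t z => u' e t z + v' e t z).
Proof.
move=> [Su Su' Du] [Sv Sv' Dv]; split; try exact: csymbolD.
by apply: csymbol_ext (csymbolD Du Dv) => e t z _ _; ring.
Qed.

Lemma equivM m m' u u' v v' : equiv m u u' -> equiv m' v v' ->
  equiv (m + m') (fun e t z => u e t z * v e t z) (fun e t z => u' e t z * v' e t z).
Proof.
move=> [Su Su' Du] [Sv Sv' Dv]; split; try exact: csymbolM.
(* The difference of the products is [v (u - u') + u' (v - v')], each term a moderate factor times a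
   negligible one. *)
have := csymbolM Sv Du; rewrite addrC => A.
by apply: csymbol_ext (csymbolD A (csymbolM Su' Dv)) => e t z _ _; ring.
Qed.

Lemma equivZ m (k : R[i]) u v : equiv m u v ->
  equiv m (fun e t z => k * u e t z) (fun e t z => k * v e t z).
Proof.
by move=> H; have := equivM (equiv_refl (csymbol_cst T k)) H; rewrite add0r.
Qed.

Lemma equiv_sum (I : Type) (r : seq I) (P : pred I) m (u v : I -> cnet) :
  (forall i, P i -> equiv m (u i) (v i)) ->
  equiv m (fun e t z => \sum_(i <- r | P i) u i e t z)
          (fun e t z => \sum_(i <- r | P i) v i e t z).
Proof.
move=> H; split; try by apply: csymbol_sum => i /H[].
have D : csymbol T false m (fun e t z => \sum_(i <- r | P i) (u i e t z - v i e t z)).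
  by apply: csymbol_sum => i /H[].
by apply: csymbol_ext D => e t z _ _; rewrite sumrB.
Qed.

Lemma equiv_pderiv m d u v : equiv m u v ->
  equiv (m - @weight R n d) (pderiv T d u) (pderiv T d v).
Proof.
move=> [Su Sv D]; split; [exact: csymbol_pderiv|exact: csymbol_pderiv|].
have HD := c_has_derivD (c_has_deriv_pderiv T_gt0 d Su)
  (c_has_derivN (c_has_deriv_pderiv T_gt0 d Sv)).
exact: (csymbol_deriv T_gt0 D HD).
Qed.

Lemma equiv_wderiv m s u v : equiv m u v ->
  equiv (m - (nfreq s)%:R) (wderiv s u) (wderiv s v).
Proof.
move=> E; elim: s => [|c s IH]; first by rewrite subr0.
have := equiv_pderiv (Some c) IH.
rewrite -addrA -opprD; congr (equiv (_ - _) _ _).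
by case: c => i /=; rewrite ?addr0// natrD addrC.
Qed.

Lemma partial_x0 (a : phase -> R[i]) : partial_x (fun=> 0%N) a = a.
Proof. by rewrite /partial_x; elim: (enum 'I_n) => //= i l ->. Qed.

Lemma partial_eta0 (a : phase -> R[i]) : partial_eta (fun=> 0%N) a = a.
Proof. by rewrite /partial_eta; elim: (enum 'I_n) => //= i l ->. Qed.

Lemma equiv_taylor m m' d u u' v v' : equiv m u u' -> equiv m' v v' ->
  equiv (m - d%:R + m') (fun e t z => taylor_term d (u e t) (v e t) z)
    (fun e t z => taylor_term d (u' e t) (v' e t) z).
Proof.
move=> Eu Ev; rewrite /taylor_term; apply: equiv_sum => al /eqP ald.
apply: equivM.
  have := equivZ ((mfact (fun i => al i))%:R^-1)
    (equiv_wderiv (word_of (fun i => al i) (fun=> 0%N)) Eu).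
  rewrite nfreq_word_of ald; apply: equiv_ext => e t z _ _;
  by rewrite mulrC /wderiv -partial_cderiv partial_x0.
have := equivZ ((- 'i%C) ^+ d) (equiv_wderiv (word_of (fun=> 0%N) (fun i => al i)) Ev).
rewrite nfreq_word_of {1}/mabs big1// subr0; apply: equiv_ext => e t z _ _;
by rewrite /D_x ald /wderiv -partial_cderiv partial_eta0.
Qed.

(** In both sums the orders add up to -k: [-(k - j) - j] for [a0] and [1 - (k + 1 - j) - j] for
    [a1]. The restriction to [j < k] permits use inside the recursion. *)
Lemma equiv_source k u1 u1' u0 u0' (v v' : nat -> cnet) :
  equiv 1 u1 u1' -> equiv 0 u0 u0' ->
  (forall j, (j < k)%N -> equiv (- j%:R) (v j) (v' j)) ->
  equiv (- k%:R) (fun e => transport_source (u1 e) (u0 e) (fun j => v j e) k)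
    (fun e => transport_source (u1' e) (u0' e) (fun j => v' j e) k).
Proof.
move=> E1 E0 Ev; rewrite /transport_source; apply: equiv_sum => j _.
have kj : k%:R = (k - j)%:R + j%:R :> R by rewrite -natrD subnK// ltnW.
have kj1 : (k + 1 - j)%:R = (k - j)%:R + 1 :> R by rewrite natr1 addn1 subSn// ltnW.
have Ej := Ev j (ltn_ord j).
apply: equivD.
  by have := equiv_taylor (k - j) E0 Ej; congr (equiv _ _ _); rewrite kj; ring.
by have := equiv_taylor (k + 1 - j) E1 Ej; congr (equiv _ _ _); rewrite kj1 kj; ring.
Qed.

Lemma equiv_rhs k u1 u1' u0 u0' (v v' : nat -> cnet) :
  equiv 1 u1 u1' -> equiv 0 u0 u0' -> (forall j, equiv (- j%:R) (v j) (v' j)) ->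
  equiv (- k%:R) (fun e => transport_rhs (u1 e) (u0 e) (fun j => v j e) k)
    (fun e => transport_rhs (u1' e) (u0' e) (fun j => v' j e) k).
Proof.
move=> E1 E0 Ev; apply: equivD; first apply: equivD.
- by have := equiv_taylor 1 E1 (Ev k); rewrite subrr add0r.
- by have := equivM E0 (Ev k); rewrite add0r.
- by apply: equiv_source => // j _.
Qed.

Lemma Gsc_equiv m (A : set cnet) u v : Gsc (CSym T m) A -> A u -> A v -> equiv m u v.
Proof.
move=> [w Mw ->] [Mu Nu] [Mv Nv]; split; try exact: Msc_csymbol.
have := csymbolB (Neg_csymbol T_gt0 Nu) (Neg_csymbol T_gt0 Nv).
apply: csymbol_ext => e t z _ _.
have E (x y k : R[i]) : x - k - (y - k) = x - y by ring.
exact: E.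
Qed.

Lemma Gsc_csymbol m (A : set cnet) u : Gsc (CSym T m) A -> A u -> csymbol T true m u.
Proof. by move=> HA Au; have [] := Gsc_equiv HA Au Au. Qed.

Definition unit_index (j : 'I_n) : {ffun 'I_n -> 'I_2} :=
  [ffun i => if i == j then 1 else 0].

Lemma unit_indexE j i : unit_index j i = (i == j) :> nat.
Proof. by rewrite ffunE; case: eqP. Qed.

Lemma unit_index_inj : injective unit_index.
Proof.
move=> j k E; have := unit_indexE k j; rewrite -E unit_indexE eqxx.
by case: eqP.
Qed.

Lemma unit_index_exists (al : {ffun 'I_n -> 'I_2}) :
  mabs (fun i => al i) = 1%N -> exists j, al = unit_index j.
Proof.
move=> H; have [j aj] : exists j, (0 < al j)%N.
  apply: contrapT => nex; move: H; rewrite /mabs big1// => i _; apply/eqP.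
  by rewrite -leqn0 leqNgt; apply/negP => ai; apply: nex; exists i.
exists j; apply/ffunP => i; apply/val_inj; rewrite /= unit_indexE.
move: H; rewrite /mabs (bigD1 j)//=.
have aj1 : al j = 1%N :> nat by apply/eqP; rewrite eqn_leq aj -ltnS ltn_ord.
rewrite aj1; case: eqP => [->//|/eqP ij].
by rewrite (bigD1 i)//=; case: (al i : nat).
Qed.

Lemma mfact_unit j : mfact (fun i => unit_index j i) = 1%N.
Proof. by rewrite /mfact big1// => i _; rewrite unit_indexE; case: eqP. Qed.

Lemma mabs_unit j : mabs (fun i => unit_index j i) = 1%N.
Proof.
rewrite /mabs (bigD1 j)//= unit_indexE eqxx big1// => i ij.
by rewrite unit_indexE (negbTE ij).
Qed.

Lemma flatten_unit (B : Type) (f : 'I_n -> B) j :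
  flatten [seq nseq (unit_index j i) (f i) | i <- enum 'I_n] = [:: f j].
Proof.
have H l : flatten [seq nseq (unit_index j i) (f i) | i <- l] =
    map f [seq i <- l | i == j].
  elim: l => //= i l ->; rewrite unit_indexE; case: eqP => //=.
by rewrite H (filter_pred1_uniq (enum_uniq _)) ?mem_enum.
Qed.

Lemma partial_eta_unit j (a : phase -> R[i]) :
  partial_eta (fun i => unit_index j i) a = deriv_along (dir (inr j)) a.
Proof.
rewrite /partial_eta.
by rewrite (foldr_flatten_nseq (fun c => deriv_along (dir c)) _ inr) flatten_unit.
Qed.

Lemma partial_x_unit j (a : phase -> R[i]) :
  partial_x (fun i => unit_index j i) a = deriv_along (dir (inl j)) a.
Proof.
rewrite /partial_x.
by rewrite (foldr_flatten_nseq (fun c => deriv_along (dir c)) _ inl) flatten_unit.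
Qed.

(** The multi-indices of length one are the [unit_index j]; this gives the coordinate form in which
    [transport_exists] states the equation. *)
Lemma taylor_term1 (a c : phase -> R[i]) z : taylor_term 1 a c z =
  \sum_j deriv_along (dir (inr j)) a z * (- 'i%C * deriv_along (dir (inl j)) c z).
Proof.
pose F (al : {ffun 'I_n -> 'I_2}) := partial_eta (fun i => al i) a z /
  (mfact (fun i => al i))%:R * D_x (fun i => al i) c z.
rewrite -[LHS]/(\sum_(al : {ffun 'I_n -> 'I_2} | mabs (fun i => al i) == 1%N) F al).
transitivity (\sum_j F (unit_index j)); last first.
  apply: eq_bigr => j _; rewrite /F partial_eta_unit /D_x partial_x_unit mfact_unit.
  by rewrite mabs_unit divr1 expr1.
(* A sum with a single term is inserted, so that exchanging the sums reindexes by coordinates. *)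
transitivity (\sum_(al : {ffun 'I_n -> 'I_2} | mabs (fun i => al i) == 1%N)
    \sum_(j | al == unit_index j) F al).
  apply: eq_bigr => al /eqP/unit_index_exists[j ->].
  rewrite (eq_bigl (pred1 j)); first by rewrite big_pred1_eq.
  by move=> i /=; rewrite (inj_eq unit_index_inj) eq_sym.
rewrite (exchange_big_dep xpredT)//=; apply: eq_bigr => j _.
rewrite (eq_bigl (pred1 (unit_index j))); first by rewrite big_pred1_eq.
by move=> al /=; case: (al =P unit_index j) => [->|]; rewrite ?andbF// mabs_unit.
Qed.

Lemma slow_scale_log_bound k h u : csymbol T true 0 u ->
  slow_scale_log_type T 0 k h u -> exists L : R -> R,
  (forall e t z, 0 < e <= 1 -> `|t| <= T -> normc (u e t z) <= L e) /\
  forall K, 0 <= K -> moderate (fun e => expR (K * L e)).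
Proof.
move=> Su [mu smu /(_ (fun=> 0%N) (fun=> 0%N))].
have mabs0 : mabs (fun _ : 'I_n => 0%N) = 0%N by rewrite /mabs big1.
rewrite mabs0 => /(_ isT isT)[C C0 HC].
have [w wg Hw] := csymbol_bound Su.
pose good e := forall t z, `|t| <= T -> normc (u e t z) <= C * ln (normc (mu e)).
(* The logarithmic bound is known only for small [e]; elsewhere [w e] keeps [L] an upper bound,
   without effect on the growth near 0. *)
exists (fun e => if `[< good e >] then C * ln (normc (mu e)) else w e); split.
  move=> e t z he ht; case: asboolP => [|_]; first exact.
  by have := Hw e t z he ht; rewrite powRr0 mulr1.
move=> K K0; apply: (moderate_exp_log smu C0 K0); near=> e.
have H : (@seminorm R _ (CSym T 0) (0%N, ((fun=> 0%N), (fun=> 0%N))) (u e)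
  <= (C * ln (normc (mu e)))%:E)%E by near: e.
case: asboolP => // -[] t z ht; rewrite -lee_fin; apply: le_trans H.
apply: le_trans (ereal_sup_ubound _); last first.
  by exists t => //=; rewrite in_itv/= -ler_norml.
apply: le_trans (ereal_sup_ubound _); last by exists z.
by rewrite /= mabs0 partial_x0 partial_eta0 addr0 oppr0 powRr0 mul1r.
Unshelve. all: by end_near. Qed.

End Congruence.

(** The list [s k] collects the first [k] values. As [g k] reads only values below [k], the default
    [x0] returned beyond the end of the list has no influence. *)
Lemma strong_recursion (X : Type) (x0 : X) (g : nat -> (nat -> X) -> X) :
  (forall k f f', (forall j, (j < k)%N -> f j = f' j) -> g k f = g k f') ->
  exists f, forall k, f k = g k f.
Proof.
move=> gP; pose s := fix s k := if k is k'.+1 then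
  rcons (s k') (g k' (nth x0 (s k'))) else [::].
have ss k : size (s k) = k by elim: k => //= k IH; rewrite size_rcons IH.
have snth j k : (j < k)%N -> nth x0 (s k) j = nth x0 (s j.+1) j.
  elim: k => // k IH; rewrite ltnS leq_eqVlt => /predU1P[->//|jk].
  by rewrite [LHS]nth_rcons ss jk IH.
exists (fun k => nth x0 (s k.+1) k) => k.
rewrite [LHS]nth_rcons ss ltnn eqxx; apply: gP => j jk; exact: snth.
Qed.

Theorem proposition3p5 (R : realType) (n : nat) (T : R)
  (n_ge1 : (1 <= n)%N) (T_gt0 : 0 < T)
  (a1 a0 : set (R -> R -> 'rV[R]_n * 'rV[R]_n -> R[i]))
  (a1_symbol : Gsc (CSym T 1) a1)
  (a0_symbol : Gsc (CSym T 0) a0)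
  (a1_real_indep : exists2 u, a1 u & real_valued T u /\ x_independent T u)
  (a1_log : exists2 u, a1 u &
     slow_scale_log_type T 1 (3 * (n./2 + 1)) (2 * (n + 2) + 1) u)
  (a0_log : exists2 u, a0 u &
     slow_scale_log_type T 0 (n./2 + 1) (n./2 + 1) u) :
  exists b : nat -> set (R -> R -> 'rV[R]_n * 'rV[R]_n -> R[i]),
    [/\ forall j : nat, Gsc (CSym T (- j%:R)) (b j),
        forall k : nat, solves_transport T a1 a0 b k,
        initial_value 0 1 (b 0%N) &
        forall j : nat, (0 < j)%N -> initial_value (- j%:R) 0 (b j)].
Proof.
pose cnet := R -> R -> 'rV[R]_n * 'rV[R]_n -> R[i].
have [u1 a1u1 [u1real u1indep]] := a1_real_indep.
have [u0 a0u0 u0log] := a0_log.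
have S1 := Gsc_csymbol T_gt0 a1_symbol a1u1.
have S0 := Gsc_csymbol T_gt0 a0_symbol a0u0.
have [L [HL LM]] := slow_scale_log_bound S0 u0log.
pose A : cnet := fun e t z => 'i%C * u0 e t z.
have SA : csymbol T true 0 A.
  by have := csymbolM (csymbol_cst T 'i%C) S0; rewrite addr0.
have AL e t z : 0 < e <= 1 -> `|t| <= T -> `|Re (A e t z)| <= L e.
  move=> he ht; apply: le_trans (HL e t z he ht).
  by rewrite Re_mulc /= mul0r mul1r sub0r normrN; exact: (normc_ge_ReIm _).2.
pose c0 k : R[i] := if k == 0%N then 1 else 0.
have Sc0 k : csymbol T true (- k%:R) (fun _ _ (_ : 'rV[R]_n * 'rV[R]_n) => c0 k).
  by rewrite /c0; case: k => [|k]; [rewrite oppr0; exact: csymbol_cst|exact: csymbol0].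
(* As an implication, [Q] allows a solution to be chosen for every [F], before induction shows that
   the sources that occur are symbols. *)
pose Q k (F b : cnet) := csymbol T true (- k%:R) F ->
  [/\ csymbol T true (- k%:R) b, forall e z, b e 0 z = c0 k &
    eq_on T (pderiv T None b) (fun e t z =>
      \sum_j pderiv T (Some (inr j)) u1 e t z * pderiv T (Some (inl j)) b e t z
      + A e t z * b e t z + F e t z)].
have /choice[sol Hsol] (kF : nat * cnet) : exists b, Q kF.1 kF.2 b.
  case: kF => k F; have [SF|nSF] := pselect (csymbol T true (- k%:R) F); last first.
    by exists (fun _ _ _ => 0) => /nSF.
  have [b Hb] := transport_exists T_gt0 S1 u1real u1indep SA SF (Sc0 k) AL (LM _ (ltW T_gt0)).
  by exists b => _.
pose src k (f : nat -> cnet) : cnet := fun e t z =>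
  'i%C * transport_source (u1 e) (u0 e) (fun j => f j e) k t z.
have [B HB] : exists B : nat -> cnet, forall k, B k = sol (k, src k B).
  apply: (@strong_recursion cnet (fun _ _ _ => 0) (fun k f => sol (k, src k f))).
  move=> k f f' ff; congr (sol (k, _)); apply/funext => e; apply/funext => t.
  apply/funext => z; rewrite /src /transport_source; congr (_ * _).
  by apply: eq_bigr => j _; rewrite ff.
have E1 := equiv_refl S1; have E0 := equiv_refl S0.
have Ssrc0 k : (forall j, (j < k)%N -> csymbol T true (- j%:R) (B j)) ->
    csymbol T true (- k%:R) (src k B).
  move=> H; have E := equiv_source T_gt0 E1 E0 (fun j jk => equiv_refl (H j jk)).
  by have [X _ _] := equivZ 'i%C E; exact: X.
have SB k : csymbol T true (- k%:R) (B k).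
  elim/ltn_ind: k => k IH; rewrite HB.
  by have [X _ _] := Hsol (k, src k B) (Ssrc0 k IH); exact: X.
have Ssrc k : csymbol T true (- k%:R) (src k B) by apply: Ssrc0 => j _; exact: SB.
have HB0 k e z : B k e 0 z = c0 k.
  by have [_ H _] := Hsol (k, src k B) (Ssrc k); rewrite HB; exact: H.
have HBt k : eq_on T (fun e => D_t T (B k e))
    (fun e => transport_rhs (u1 e) (u0 e) (fun j => B j e) k).
  move=> e t z he ht; have [_ _ +] := Hsol (k, src k B) (Ssrc k).
  rewrite -HB => /(_ e t z he ht) E.
  rewrite /D_t -[time_deriv T (B k e) t z]/(pderiv T None (B k) e t z) E.
  rewrite /transport_rhs taylor_term1 /A /src.
  have ii : - 'i%C * 'i%C = 1 :> R[i] by rewrite mulNr -expr2 sqr_i opprK.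
  rewrite mulrDr mulrDr; congr (_ + _ + _).
  - by rewrite mulr_sumr; apply: eq_bigr => j _; rewrite mulrCA.
  - by rewrite !mulrA ii mul1r.
  - by rewrite mulrA ii mul1r.
have bE j v : (Msc (CSym T (- j%:R)) v /\
    Neg (CSym T (- j%:R)) (fun e => v e - B j e)) -> equiv T (- j%:R) v (B j).
  move=> [Mv Nv]; split; [exact: Msc_csymbol|exact: SB|exact: Neg_csymbol].
have init j v : (Msc (CSym T (- j%:R)) v /\
    Neg (CSym T (- j%:R)) (fun e => v e - B j e)) ->
    Neg (Sym (- j%:R)) (fun e z => v e 0 z - c0 j).
  (* [B j] has the exact initial value, and a difference negligible on [-T, T] is negligible at time
     0. *)
  move=> /bE[_ _ D]; have T0 : `|0 : R| <= T by rewrite normr0 ltW.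
  have := csymbol_Neg_at T_gt0 T0 D; congr (Neg _ _).
  by apply/funext => e; apply/funext => z; rewrite HB0.
exists (fun j => [set v | Msc (CSym T (- j%:R)) v /\
  Neg (CSym T (- j%:R)) (fun e => v e - B j e)]); split.
- by move=> j; exists (B j) => //; exact: csymbol_Msc.
(* Arbitrary representatives are exchanged for [u1], [u0] and [B], for which the equation holds
   exactly; both sides change by negligible nets. *)
- move=> k w1 w0 v a1w1 a0w0 bv; apply: csymbol_Neg => //.
  have [_ _ D1] := equiv_rhs T_gt0 k (Gsc_equiv T_gt0 a1_symbol a1w1 a1u1)
    (Gsc_equiv T_gt0 a0_symbol a0w0 a0u0) (fun j => bE j (v j) (bv j)).
  have := equivZ (- 'i%C) (equiv_pderiv T_gt0 None (bE k (v k) (bv k))).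
  rewrite subr0 => -[_ _ D2].
  apply: csymbol_ext (csymbolB D2 D1) => e t z he ht.
  have := HBt k e t z he ht; rewrite /D_t /= => ->.
  by rewrite opprB subrKA.
- by have := init 0%N; rewrite oppr0.
- by move=> j j0 v /init; rewrite /c0 gtn_eqF.
Qed.
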